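(* Let $\Gamma$ be a finite group and $\xi\in R_{\mathbb Z}(\Gamma)$ a self-dual virtual character. For $\alpha,\beta\in R_{\mathbb Z}(\Gamma)$, the following identity for a product of two vertex operators acting on $\mathcal F_\Gamma$ holds: $$X(\alpha,z)X(\beta,w)=\epsilon(\alpha,\beta)\,:X(\alpha,z)X(\beta,w):\,(z-w)^{\langle\alpha,\beta\rangle_\xi},$$ where $(z-w)^{\langle\alpha,\beta\rangle_\xi}$ is understood as the formal series $z^{\langle\alpha,\beta\rangle_\xi}\sum_{k\ge0}\binom{\langle\alpha,\beta\rangle_\xi}{k}(-z^{-1}w)^k$.
   Context: $\Gamma$ is a finite group; $\Gamma^*=\{\gamma_0,\dots,\gamma_r\}$ its complex irreducible characters; $\Gamma_*$ its conjugacy classes; $R(\Gamma)=\bigoplus_i\mathbb C\gamma_i$, $R_{\mathbb Z}(\Gamma)=\bigoplus_i\mathbb Z\gamma_i$. For a finite group $G$, $\langle f,g\rangle_G=\frac1{|G|}\sum_{x\in G}f(x)g(x^{-1})$; $*$ is pointwise multiplication. $\xi$ is self-dual: $\xi(x)=\xi(x^{-1})$. The weighted form on $R(\Gamma)$ is $\langle f,g\rangle_\xi=\langle\xi*f,g\rangle_\Gamma$; it makes $R_{\mathbb Z}(\Gamma)$ an integral lattice. Wreath products: $\Gamma_n=\Gamma^n\rtimes S_n$ with $(g,\sigma)(h,\tau)=(g\,\sigma(h),\sigma\tau)$, $\sigma(g_1,\dots,g_n)=(g_{\sigma^{-1}(1)},\dots,g_{\sigma^{-1}(n)})$; $R(\Gamma_n)$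 is the space of complex class functions and $R_\Gamma=\bigoplus_{n\ge0}R(\Gamma_n)$. For a representation $V$ of $\Gamma$ with character $\gamma$, $\eta_n(\gamma)$ is the character of the $\Gamma_n$-module $V^{\otimes n}$, and $\varepsilon_n(\gamma)$ is the character of $V^{\otimes n}$ tensored with the sign representation of $S_n$. The map $\eta_n$ is extended to virtual characters by $\eta_n(\beta-\gamma)=\sum_{m=0}^n(-1)^m\mathrm{Ind}_{\Gamma_{n-m}\times\Gamma_m}^{\Gamma_n}[\eta_{n-m}(\beta)\otimes\varepsilon_m(\gamma)]$; $\varepsilon_n(\gamma)$ for virtual $\gamma$ is $\eta_n(\gamma)$ times the sign character. The weighted form on $R(\Gamma_n)$ is $\langle f,g\rangle_\xi=\langle\eta_n(\xi)*f,g\rangle_{\Gamma_n}$. Operators on $R_\Gamma$ ($n\ge0$): $H_{-n}(\gamma)$ sends $f\in R(\Gamma_m)$ to $\mathrm{Ind}_{\Gamma_n\times\Gamma_m}^{\Gamma_{n+m}}(\eta_n(\gamma)\otimes f)$; $E_n(\gamma)$ sends $f\in R(\Gamma_m)$ to the element of $R(\Gamma_{m-n})$ obtained by restricting $f$ to $\Gamma_n\times\Gamma_{m-n}$ and applying $\langle\varepsilon_n(\gamma),\cdot\rangle_\xi$ to the first factor (zero if $n>m$); $H_0=E_0=\mathrm{id}$. Put $H_+(\gamma,z)=\sum_{n\ge0}H_{-n}(\gamma)z^n$, $E_-(\gamma,z)=\sum_{n\ge0}E_n(\gamma)(-z)^{-n}$. Heisenberg operators on $R_\Gamma$ ($n>0$,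 $\gamma\in R(\Gamma)$): let $\sigma_n(\gamma)$ be the class function on $\Gamma_n$ with value $n\gamma(c)$ on elements $(g,s)$ with $s$ an $n$-cycle $(i_1\cdots i_n)$ and $g_{i_n}\cdots g_{i_1}\in c$ (for each $c\in\Gamma_*$), and $0$ elsewhere. Then $a_{-n}(\gamma)$ sends $f\in R(\Gamma_m)$ to $\mathrm{Ind}(\sigma_n(\gamma)\otimes f)\in R(\Gamma_{n+m})$, and $a_n(\gamma)$ sends $f\in R(\Gamma_m)$ to the element of $R(\Gamma_{m-n})$ obtained by restricting to $\Gamma_n\times\Gamma_{m-n}$ and applying $\langle\sigma_n(\gamma),\cdot\rangle_\xi$ to the first factor. Cocycle: $\epsilon:R_{\mathbb Z}(\Gamma)\times R_{\mathbb Z}(\Gamma)\to\mathbb C^\times$ is a fixed 2-cocycle, i.e. $\epsilon(\gamma,0)=\epsilon(0,\gamma)=1$ and $\epsilon(\alpha,\beta)\epsilon(\alpha+\beta,\gamma)=\epsilon(\alpha,\beta+\gamma)\epsilon(\beta,\gamma)$, with $\epsilon(\alpha,\beta)\epsilon(\beta,\alpha)^{-1}=(-1)^{\langle\alpha,\beta\rangle_\xi+\langle\alpha,\alpha\rangle_\xi\langle\beta,\beta\rangle_\xi}$ (such $\epsilon$ exists and is unique up to equivalence). $\mathbb C[R_{\mathbb Z}(\Gamma)]$ has basis $e^\beta$, $\beta\in R_{\mathbb Z}(\Gamma)$. The operator $e^\alpha$ acts by $e^\alpha.e^\beta=\epsilon(\alpha,\beta)e^{\alpha+\beta}$, $\partial_\gamma$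 acts by $\partial_\gamma e^\beta=\langle\gamma,\beta\rangle_\xi e^\beta$, and $z^{\partial_\gamma}e^\beta=z^{\langle\gamma,\beta\rangle_\xi}e^\beta$. $\mathcal F_\Gamma=R_\Gamma\otimes\mathbb C[R_{\mathbb Z}(\Gamma)]$, each operator acting on its own tensor factor. Vertex operator: $X(\gamma,z)=H_+(\gamma,z)E_-(\gamma,z)e^\gamma z^{\partial_\gamma}$ for $\gamma\in R_{\mathbb Z}(\Gamma)$. Normal ordered product: $$:X(\alpha,z)X(\beta,w):\ =\exp\Bigl(\sum_{n\ge1}\tfrac1n\bigl(a_{-n}(\alpha)z^n+a_{-n}(\beta)w^n\bigr)\Bigr)\exp\Bigl(-\sum_{n\ge1}\tfrac1n\bigl(a_n(\alpha)z^{-n}+a_n(\beta)w^{-n}\bigr)\Bigr)e^{\alpha+\beta}z^{\partial_\alpha}w^{\partial_\beta}.$$ *)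

(* Defs.v *)
From HB Require Import structures.
From mathcomp Require Import all_boot all_order all_algebra all_fingroup.
From mathcomp Require Import mxrepresentation character.
From mathcomp Require Import boolp classical_sets functions cardinality fsbigop.

Set Implicit Arguments.
Unset Strict Implicit.
Unset Printing Implicit Defensive.

Import Order.TTheory GRing.Theory Num.Theory.
Local Open Scope ring_scope.

Record wreath (gT : finGroupType) (n : nat) :=
  Wreath { wr_base : {ffun 'I_n -> gT}; wr_perm : 'S_n }.

Section WreathGroup.
Variables (gT : finGroupType) (n : nat).
Local Notation W := (wreath gT n).

Definition wr_pair (x : W) := (wr_base x, wr_perm x).
Definition pair_wr (p : {ffun 'I_n -> gT} * 'S_n) : W := Wreath p.1 p.2.
Lemma wr_pairK : cancel wr_pair pair_wr. Proof. by case. Qed.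

HB.instance Definition _ := Finite.copy W (can_type wr_pairK).

Lemma wr_eq (x y : W) :
  wr_base x =1 wr_base y -> wr_perm x = wr_perm y -> x = y.
Proof. by case: x y => [g s] [h t] /= /ffunP -> ->. Qed.

(* The paper composes permutations from right to left, so its product s t is
   (t * s)%g in the library. *)
Definition wr_mul (x y : W) : W :=
  Wreath [ffun i => (wr_base x i * wr_base y ((wr_perm x)^-1 i))%g]
         (wr_perm y * wr_perm x)%g.
Definition wr_one : W := Wreath [ffun=> 1%g] 1%g.
Definition wr_inv (x : W) : W :=
  Wreath [ffun i => ((wr_base x (wr_perm x i))^-1)%g] ((wr_perm x)^-1)%g.

Lemma wr_mulA : associative wr_mul.
Proof.
move=> x y z; apply: wr_eq => [i|] /=; last by rewrite mulgA.
by rewrite !ffunE invMg permM mulgA.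
Qed.
Lemma wr_mul1 : left_id wr_one wr_mul.
Proof.
by move=> x; apply: wr_eq => [i|] /=; rewrite ?ffunE ?mul1g ?invg1 ?perm1 ?mulg1.
Qed.
Lemma wr_mulV : left_inverse wr_one wr_inv wr_mul.
Proof.
move=> x; apply: wr_eq => [i|] /=; last by rewrite mulgV.
by rewrite !ffunE invgK mulVg.
Qed.

HB.instance Definition _ := Finite_isGroup.Build W wr_mulA wr_mul1 wr_mulV.

End WreathGroup.

Section WreathEmbedding.
Variables (gT : finGroupType) (n m : nat).

Definition perm_sum_fun (s : 'S_n) (t : 'S_m) (i : 'I_(n + m)) : 'I_(n + m) :=
  match fintype.split i with
  | inl a => lshift m (s a)
  | inr b => rshift n (t b)
  end.

Lemma perm_sum_inj s t : injective (perm_sum_fun s t).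
Proof.
move=> i j; rewrite /perm_sum_fun.
case: (splitP i) => a ia; case: (splitP j) => b jb e; apply: val_inj.
- by rewrite /= ia jb (perm_inj (lshift_inj e)).
- by move/eqP: e; rewrite eq_lrshift.
- by move/eqP: e; rewrite eq_rlshift.
- by rewrite /= ia jb (perm_inj (rshift_inj e)).
Qed.

Definition perm_sum s t : 'S_(n + m) := perm (@perm_sum_inj s t).

(* The inclusion of Gamma_n x Gamma_m in Gamma_{n+m}. *)
Definition wr_embed (p : wreath gT n * wreath gT m) : wreath gT (n + m) :=
  Wreath [ffun i => match fintype.split i with
                    | inl a => wr_base p.1 a
                    | inr b => wr_base p.2 b
                    end]
         (perm_sum (wr_perm p.1) (wr_perm p.2)).

Lemma perm_sumM s1 s2 t1 t2 :
  perm_sum (s1 * s2)%g (t1 * t2)%g = (perm_sum s1 t1 * perm_sum s2 t2)%g.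
Proof.
apply/permP => i; rewrite permM !permE /perm_sum_fun.
by case: (fintype.split i) => a; rewrite ?(unsplitK (inl _)) ?(unsplitK (inr _)) permM.
Qed.

Lemma perm_sum1 : perm_sum 1 1 = 1%g.
Proof.
apply/permP => i; rewrite perm1 permE /perm_sum_fun -[RHS]fintype.splitK.
by case: (fintype.split i) => a; rewrite /= perm1.
Qed.

Lemma perm_sumV s t : (perm_sum s t)^-1%g = perm_sum s^-1 t^-1.
Proof.
by apply/eqP; rewrite eq_invg_mul -perm_sumM !mulgV perm_sum1.
Qed.

Lemma wr_embedM : {morph wr_embed : p q / (p * q)%g}.
Proof.
move=> [x1 x2] [y1 y2]; apply: wr_eq => [i|] /=; last by rewrite perm_sumM.
rewrite !ffunE perm_sumV permE /perm_sum_fun.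
by case: (fintype.split i) => a; rewrite ?(unsplitK (inl _)) ?(unsplitK (inr _)) ffunE.
Qed.

End WreathEmbedding.

Section Characters.
Variable C : numClosedFieldType.

Definition gform (gT : finGroupType) (f g : gT -> C) : C :=
  #|gT|%:R^-1 * \sum_(x : gT) f x * g (x^-1)%g.

(* Induction along an injective morphism i : H -> G. *)
Definition induce (H G : finGroupType) (i : H -> G) (f : H -> C) (x : G) : C :=
  #|H|%:R^-1 * \sum_(g : G) \sum_(y : H | i y == (x ^ g)%g) f y.

Definition rep (gT : finGroupType) := representation C [set: gT]%G.

Definition rep_char (gT : finGroupType) (V : rep gT) (x : gT) : C := \tr (V x).

Definition irrs (gT : finGroupType) : irrType C [set: gT]%G :=
  DecSocleType (regular_repr C [set: gT]%G).

(* The lattice of virtual characters, in coordinates with respect to the basis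
   of irreducible characters. *)
Definition RZ (gT : finGroupType) := {ffun irrs gT -> int}.

Section Virtual.
Variable gT : finGroupType.

Definition vchar (a : RZ gT) (x : gT) : C :=
  \sum_(i : irrs gT) (a i)%:~R * \tr (irr_repr i x).

Definition rep_of_mult (m : irrs gT -> nat) : rep gT :=
  \big[@dadd_grepr C gT [set: gT]%G/@grepr0 C gT [set: gT]%G]_(i : irrs gT)
    muln_grepr (Representation (irr_repr i)) (m i).

Definition pos_rep (a : RZ gT) : rep gT :=
  rep_of_mult (fun i => absz (Num.max (a i) 0)).
Definition neg_rep (a : RZ gT) : rep gT :=
  rep_of_mult (fun i => absz (Num.max (- a i) 0)).

Lemma rep_char_mult m x :
  rep_char (rep_of_mult m) x = \sum_(i : irrs gT) (m i)%:R * \tr (irr_repr i x).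
Proof.
have add V W : rep_char (dadd_grepr V W) x = rep_char V x + rep_char W x.
  exact: mxtrace_block.
have zero : rep_char (@grepr0 C gT [set: gT]%G) x = 0 by rewrite /rep_char mxtrace1.
rewrite /rep_of_mult (big_morph (fun V => rep_char V x) add zero).
apply: eq_bigr => i _; rewrite /muln_grepr (big_morph (fun V => rep_char V x) add zero).
by rewrite sumr_const card_ord mulr_natl.
Qed.

Lemma vchar_pos_neg a x :
  vchar a x = rep_char (pos_rep a) x - rep_char (neg_rep a) x.
Proof.
rewrite !rep_char_mult -sumrB; apply: eq_bigr => i _; rewrite -mulrBl.
congr (_ * _); set k := a i; case: k => k.
  by rewrite maxEge /= maxEge oppr_ge0; case: k => [|k] /=; rewrite subr0.
by rewrite NegzE opprK !maxEge oppr_ge0 /= sub0r rmorphN.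
Qed.

Definition wform (xi a b : RZ gT) : C :=
  gform (fun x => vchar xi x * vchar a x) (vchar b).

(* wform takes integral values; iform is that value as an element of int. *)
Definition iform (xi a b : RZ gT) : int :=
  xget 0 [set k : int | k%:~R = wform xi a b]%classic.

End Virtual.

(* The matrix of (g, s) on the n-th tensor power, in the basis of the tensors
   e_I with I : 'I_n -> 'I_d; (g, s) maps v_1 (x) ... (x) v_n to the tensor with
   i-th factor g_i v_{s^-1 i}. *)
Section TensorPower.
Variables (gT : finGroupType) (n : nat) (V : rep gT).
Local Notation d := (rdegree V).

Definition tens_idx (I : 'I_#|{ffun 'I_n -> 'I_d}|) : {ffun 'I_n -> 'I_d} :=
  enum_val I.

Definition tens_mx (x : wreath gT n) : 'M[C]_(#|{ffun 'I_n -> 'I_d}|) :=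
  \matrix_(I, J) \prod_(i < n)
     V (wr_base x i) (tens_idx I i) (tens_idx J ((wr_perm x)^-1%g i)).

Lemma tens_mx_repr : mx_repr [set: wreath gT n]%G tens_mx.
Proof.
split=> [|x y _ _]; apply/matrixP => I J; rewrite !mxE.
  under eq_bigr => i _ do rewrite ffunE repr_mx1 mxE invg1 perm1.
  case: eqVneq => [->|neIJ]; first by rewrite big1 // => i _; rewrite eqxx.
  have [i ne_i] : exists i, tens_idx I i != tens_idx J i.
    apply/existsP; apply: contraNT neIJ => /existsPn eIJ; apply/eqP.
    by apply: enum_val_inj; apply/ffunP => i; apply/eqP; move: (eIJ i); rewrite negbK.
  by rewrite (bigD1 i) //= (negbTE ne_i) mul0r.
under eq_bigr => i _ do rewrite ffunE repr_mxM ?inE // mxE.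
rewrite bigA_distr_bigA /=.
under [RHS]eq_bigr => K _ do rewrite !mxE.
pose sh (s : 'S_n) (K : {ffun 'I_n -> 'I_d}) := [ffun i => K (s i)].
have shK s : cancel (sh s) (sh s^-1%g).
  by move=> K; apply/ffunP => i; rewrite !ffunE permKV.
have shVK s : cancel (sh s^-1%g) (sh s).
  by move=> K; apply/ffunP => i; rewrite !ffunE permK.
rewrite (reindex (sh (wr_perm x)^-1%g)) /=; last first.
  by apply: onW_bij; exists (sh (wr_perm x)).
rewrite [RHS](reindex (@enum_rank {ffun 'I_n -> 'I_d})) /=; last first.
  by apply: onW_bij; exact: enum_rank_bij.
apply: eq_bigr => K _; rewrite big_split /= /tens_idx enum_rankK.
congr (_ * _); first by apply: eq_bigr => i _; rewrite ffunE.
rewrite [RHS](reindex_inj (@perm_inj _ (wr_perm x)^-1%g)) /=.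
by apply: eq_bigr => i _; rewrite ffunE invMg permM.
Qed.

Definition tens_rep : rep (wreath gT n) :=
  Representation (MxRepresentation tens_mx_repr).

End TensorPower.

(* The disjoint union of the groups Gamma_n; a function on one Gamma_n is
   extended to it by zero by means of untag. *)
Definition wr_all (gT : finGroupType) := {n : nat & wreath gT n}.

Section WreathCharacters.
Variable gT : finGroupType.
Local Notation T := (wr_all gT).

Definition wr_elt n (x : wreath gT n) : T := existT (wreath gT) n x.

Definition ind_prod n m (f : wreath gT n -> C) (g : wreath gT m -> C) : T -> C :=
  untag 0 (induce (@wr_embed gT n m) (fun p => f p.1 * g p.2)).

Definition wr_sign n (x : wreath gT n) : C := (-1) ^+ odd_perm (wr_perm x).

Definition eta_rep (V : rep gT) n : wreath gT n -> C :=
  rep_char (tens_rep n V).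
Definition eps_rep (V : rep gT) n (x : wreath gT n) : C :=
  rep_char (tens_rep n V) x * wr_sign x.

(* eta_n (b - c) = \sum_m (-1)^m Ind (eta_{n-m}(b) (x) eps_m(c)), applied to the
   decomposition of a as the character of pos_rep a minus that of neg_rep a. *)
Definition eta (a : RZ gT) n (x : wreath gT n) : C :=
  \sum_(m < n.+1) (-1) ^+ m *
     ind_prod (@eta_rep (pos_rep a) (n - m)) (@eps_rep (neg_rep a) m) (wr_elt x).
Definition eps (a : RZ gT) n (x : wreath gT n) : C := eta a x * wr_sign x.

Definition wr_wform (xi : RZ gT) n (f g : wreath gT n -> C) : C :=
  gform (fun x => eta xi x * f x) g.

(* If s is an n-cycle (i_1 ... i_n) then traject s i_1 n is [:: i_1; ...; i_n].
   The value does not depend on the choice of i_1 when a is a class function. *)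
Definition sigma (a : gT -> C) n (x : wreath gT n) : C :=
  if [pick i : 'I_n | porbit (wr_perm x) i == [set: 'I_n]] is Some i1
  then n%:R * a (\prod_(j <- rev (traject (wr_perm x) i1 n)) wr_base x j)%g
  else 0.

(* The graded space R_Gamma: class functions on every Gamma_n, vanishing for n
   large. *)
Definition in_RGam : {pred T -> C^o} := fun f =>
  `[< (forall n (x y : wreath gT n), f (wr_elt (x ^ y)%g) = f (wr_elt x)) /\
      (exists N, forall n (x : wreath gT n), (N <= n)%N -> f (wr_elt x) = 0) >].

Lemma in_RGam_submod : submod_closed in_RGam.
Proof.
split=> [|k f g /asboolP[f1 [M f2]] /asboolP[g1 [N g2]]]; apply/asboolP; split.
- by [].
- by exists 0%N.
- by move=> n x y; rewrite !fctE f1 g1.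
- exists (maxn M N) => n x; rewrite geq_max => /andP[le1 le2].
  by rewrite !fctE f2 // g2 // scaler0 addr0.
Qed.

HB.instance Definition _ :=
  GRing.isSubmodClosed.Build C (T -> C^o) in_RGam in_RGam_submod.

Record RGam := MkRGam { rg_fun :> T -> C^o; rg_funP : rg_fun \in in_RGam }.
HB.instance Definition _ := [isSub for rg_fun].
HB.instance Definition _ := [Choice of RGam by <:].
HB.instance Definition _ := [SubChoice_isSubLmodule of RGam by <:].

Definition rg_comp (f : RGam) n (x : wreath gT n) : C := f (wr_elt x).

Lemma induceJ (H G : finGroupType) (i : H -> G) (f : H -> C) x y :
  induce i f (x ^ y)%g = induce i f x.
Proof.
congr (_ * _); rewrite [RHS](reindex_inj (mulgI y)) /=.
by apply: eq_bigr => g _; rewrite conjgM.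
Qed.

Lemma ind_prod_at n m (f : wreath gT n -> C) (g : wreath gT m -> C) x :
  ind_prod f g (wr_elt x) = induce (@wr_embed gT n m) (fun p => f p.1 * g p.2) x.
Proof. by rewrite /ind_prod (untagE _ _ (erefl : tag (wr_elt x) = n + m)%N). Qed.

Lemma ind_prod_ne n m (f : wreath gT n -> C) (g : wreath gT m -> C) t :
  tag t != (n + m)%N -> ind_prod f g t = 0.
Proof. exact: untag_dflt. Qed.

Lemma ind_prodJ n m (f : wreath gT n -> C) (g : wreath gT m -> C)
    k (x y : wreath gT k) :
  ind_prod f g (wr_elt (x ^ y)%g) = ind_prod f g (wr_elt x).
Proof.
have [e|ne] := eqVneq k (n + m)%N; last by rewrite !ind_prod_ne.
by subst k; rewrite !ind_prod_at induceJ.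
Qed.

(* f |-> Ind (phi (x) f), from R(Gamma_m) to R(Gamma_{n+m}) for all m. *)
Definition create_fun n (phi : wreath gT n -> C) (f : RGam) : T -> C^o :=
  fun t => \sum_(m < (tag t).+1) ind_prod phi (@rg_comp f m) t.

Lemma create_subproof n phi f : @create_fun n phi f \in in_RGam.
Proof.
have /asboolP[f1 [N f2]] := rg_funP f; apply/asboolP; split=> [k x y|].
  by apply: eq_bigr => m _; rewrite ind_prodJ.
exists (n + N)%N => k x le_k; apply: big1 => -[m lt_m] _ /=.
have [e|ne] := eqVneq k (n + m)%N; last by rewrite ind_prod_ne.
subst k; rewrite ind_prod_at.
rewrite /induce big1 ?mulr0 // => g _; apply: big1 => p _.
by rewrite /rg_comp f2 ?mulr0 // -(leq_add2l n).
Qed.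

Definition create n phi (f : RGam) : RGam := MkRGam (@create_subproof n phi f).

Lemma create_is_linear n phi : linear (@create n phi).
Proof.
move=> k f g; apply: val_inj; apply/funext => t /=.
rewrite !fctE /= /create_fun scaler_sumr -big_split /=; apply: eq_bigr => -[m lt_m] _ /=.
have [e|ne] := eqVneq (tag t) (n + m)%N; last first.
  by rewrite !ind_prod_ne // scaler0 addr0.
case: t lt_m e => j x /= lt_m e; subst j.
rewrite !ind_prod_at /induce [in RHS]/GRing.scale /= [k * (_ * _)]mulrCA -mulrDr [in RHS]mulr_sumr -big_split /=.
congr (_ * _); apply: eq_bigr => h _; rewrite [in RHS]mulr_sumr -big_split /=.
by apply: eq_bigr => p _; rewrite /rg_comp /= !fctE mulrDr [in LHS]/GRing.scale /= [in LHS]mulrCA.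
Qed.
HB.instance Definition _ n phi :=
  GRing.isLinear.Build C RGam RGam _ (@create n phi) (@create_is_linear n phi).

(* Restrict f from Gamma_m to Gamma_n x Gamma_{m-n} and apply <phi, . >_xi to
   the first factor. *)
Definition annih_fun (xi : RZ gT) n (phi : wreath gT n -> C) (f : RGam) :
    T -> C^o :=
  fun t => wr_wform xi phi
             (fun x => f (wr_elt (wr_embed (x, tagged t)))).

Lemma annih_subproof xi n phi f : @annih_fun xi n phi f \in in_RGam.
Proof.
have /asboolP[f1 [N f2]] := rg_funP f; apply/asboolP; split=> [k x y|].
  congr (_ * _); apply: eq_bigr => z _; congr (_ * _) => /=.
  rewrite -[RHS](f1 _ _ (wr_embed (1%g, y))); congr (f (wr_elt _)).
  apply: (mulgI (wr_embed (1%g, y))); rewrite -conjgC -!wr_embedM.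
  congr (wr_embed (_, _)); first exact: etrans (mul1g _) (esym (mulg1 _)).
  exact/esym/conjgC.
exists N => k x le_k; rewrite /annih_fun /wr_wform /gform big1 ?mulr0 // => z _.
by rewrite f2 ?mulr0 //= (leq_trans le_k) ?leq_addl.
Qed.

Definition annih xi n phi (f : RGam) : RGam :=
  MkRGam (@annih_subproof xi n phi f).

Lemma annih_is_linear xi n phi : linear (@annih xi n phi).
Proof.
move=> k f g; apply: val_inj; apply/funext => t /=.
rewrite !fctE /= /annih_fun /wr_wform /gform.
rewrite [in RHS]/GRing.scale /= [k * (_ * _)]mulrCA -mulrDr [in RHS]mulr_sumr -big_split /=.
by congr (_ * _); apply: eq_bigr => x _; rewrite !fctE mulrDr [in LHS]/GRing.scale /= [in LHS]mulrCA.
Qed.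
HB.instance Definition _ xi n phi :=
  GRing.isLinear.Build C RGam RGam _ (@annih xi n phi)
    (@annih_is_linear xi n phi).

(* F_Gamma = R_Gamma (x) C[R_Z(Gamma)]: finitely supported families of elements
   of R_Gamma indexed by the basis e^b of the group algebra. *)
Definition in_Fock : {pred RZ gT -> RGam} := fun u =>
  `[< finite_set [set b | u b != 0]%classic >].

Lemma in_Fock_submod : submod_closed in_Fock.
Proof.
split=> [|k u v /asboolP fu /asboolP fv]; apply/asboolP.
  by apply: (@sub_finite_set _ _ set0) => // b /= /eqP[].
apply: (@sub_finite_set _ _ ([set b | u b != 0] `|` [set b | v b != 0])%classic).
  move=> b /= ne0; have [u0|] := eqVneq (u b) 0; last by left.
  by right; apply: contraNneq ne0 => v0; rewrite !fctE u0 v0 scaler0 addr0.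
by rewrite finite_setU.
Qed.

HB.instance Definition _ :=
  GRing.isSubmodClosed.Build C (RZ gT -> RGam) in_Fock in_Fock_submod.

Record Fock := MkFock { fk_fun :> RZ gT -> RGam; fk_funP : fk_fun \in in_Fock }.
HB.instance Definition _ := [isSub for fk_fun].
HB.instance Definition _ := [Choice of Fock by <:].
HB.instance Definition _ := [SubChoice_isSubLmodule of Fock by <:].

(* f (x) e^b *)
Lemma pure_subproof (f : RGam) (b : RZ gT) :
  (fun c => if c == b then f else 0) \in in_Fock.
Proof.
apply/asboolP; apply: (@sub_finite_set _ _ [set b]%classic) => // c /=.
by case: (c =P b) => // _ /eqP[].
Qed.
Definition pure f b : Fock := MkFock (pure_subproof f b).

(* A (x) id *)
Lemma lift_subproof (A : {linear RGam -> RGam}) (u : Fock) :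
  (fun b => A (u b)) \in in_Fock.
Proof.
have /asboolP fu := fk_funP u; apply/asboolP; apply: sub_finite_set fu => b /=.
by apply: contraNneq => ->; rewrite linear0.
Qed.
Definition lift_op (A : {linear RGam -> RGam}) (u : Fock) : Fock :=
  MkFock (lift_subproof A u).

Lemma lift_op_pure A f b : lift_op A (pure f b) = pure (A f) b.
Proof.
by apply/val_inj/funext => c /=; case: ifP => // _; rewrite linear0.
Qed.

(* id (x) e^a *)
Lemma e_op_subproof (epsilon : RZ gT -> RZ gT -> C) (a : RZ gT) (u : Fock) :
  (fun b => epsilon a (b - a) *: u (b - a)) \in in_Fock.
Proof.
have /asboolP fu := fk_funP u; apply/asboolP.
apply: sub_finite_set (finite_image (fun b => a + b) fu) => b /= ne0.
exists (b - a); last by rewrite addrC subrK.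
by apply: contraNneq ne0 => ->; rewrite scaler0.
Qed.
Definition e_op epsilon a (u : Fock) : Fock := MkFock (e_op_subproof epsilon a u).

Lemma e_op_pure epsilon a f b :
  e_op epsilon a (pure f b) = epsilon a b *: pure f (a + b).
Proof.
apply/val_inj/funext => c /=; rewrite !fctE /=.
have [->|ne] := eqVneq c (a + b); first by rewrite addrC addKr eqxx.
rewrite ifN ?scaler0 //; apply: contraNneq ne => <-.
by rewrite addrC subrK.
Qed.

(* The coefficient of z^k in id (x) z^{partial_a}. *)
Lemma z_op_subproof (xi a : RZ gT) (k : int) (u : Fock) :
  (fun b => if iform xi a b == k then u b else 0) \in in_Fock.
Proof.
have /asboolP fu := fk_funP u; apply/asboolP; apply: sub_finite_set fu => b /=.
by case: ifP => // _; rewrite eqxx.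
Qed.
Definition z_op xi a k (u : Fock) : Fock := MkFock (z_op_subproof xi a k u).

Lemma z_op_pure xi a k f b :
  z_op xi a k (pure f b) = if iform xi a b == k then pure f b else 0.
Proof.
apply/val_inj/funext => c /=.
have [->|ne] := eqVneq c b; first by case: ifP => //= _; rewrite eqxx.
by case: ifP; case: ifP => //= _ _; rewrite (negbTE ne).
Qed.

End WreathCharacters.

(* Formal series with operator coefficients, indexed by the exponents in I. The
   sums below range over infinite index sets; each of them is locally finite in
   the uses made here, i.e. has finite support on every vector of Fock. *)
Section Series.
Variables (I : zmodType) (V : lmodType C).

Definition opser := I -> V -> V.

Definition ser_const (A : V -> V) : opser := fun p v => if p == 0 then A v else 0.
Definition ser_scal (s : I -> C) : opser := fun p v => s p *: v.
Definition ser_add (A B : opser) : opser := fun p v => A p v + B p v.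
Definition ser_opp (A : opser) : opser := fun p v => - A p v.
Definition ser_mul (A B : opser) : opser := fun p v =>
  \sum_(q \in [set: I]%classic) A q (B (p - q) v).
Definition ser_exp (A : opser) : opser := fun p v =>
  \sum_(k \in [set: nat]%classic)
     (k`!)%:R^-1 *: iter k (ser_mul A) (ser_const id) p v.

End Series.

(* Series in one variable, viewed as series in z, resp. in w. *)
Definition in_z (V : lmodType C) (A : opser int V) : opser (int * int)%type V :=
  fun p v => if p.2 == 0 then A p.1 v else 0.
Definition in_w (V : lmodType C) (A : opser int V) : opser (int * int)%type V :=
  fun p v => if p.1 == 0 then A p.2 v else 0.

Definition gbinom (c : int) (k : nat) : C :=
  (\prod_(i < k) (c - i%:Z)%:~R) / (k`!)%:R.

(* (z - w)^c = \sum_(k >= 0) binom(c, k) (-1)^k z^(c - k) w^k *)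
Definition zw_pow (c : int) (p : int * int) : C :=
  if (0 <= p.2) && (p.1 == c - p.2)
  then gbinom c `|p.2|%N * (-1) ^+ `|p.2|%N else 0.

Section VertexOperators.
Variables (gT : finGroupType) (xi : RZ gT) (epsilon : RZ gT -> RZ gT -> C).
Local Notation RZ := (RZ gT).
Local Notation F := (Fock gT).

Definition is_cocycle : Prop :=
  [/\ forall a b, epsilon a b != 0,
      forall a, epsilon a 0 = 1 /\ epsilon 0 a = 1,
      forall a b c,
        epsilon a b * epsilon (a + b) c = epsilon a (b + c) * epsilon b c
    & forall a b,
        epsilon a b * (epsilon b a)^-1 =
          (-1) ^ (iform xi a b + iform xi a a * iform xi b b)].

(* H_{-n} and E_n *)
Definition H_op (a : RZ) n : F -> F := lift_op (create (@eta gT a n)).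
Definition E_op (a : RZ) n : F -> F := lift_op (annih xi (@eps gT a n)).

Definition H_plus (a : RZ) : opser int F :=
  fun k u => if 0 <= k then H_op a `|k|%N u else 0.
Definition E_minus (a : RZ) : opser int F :=
  fun k u => if k <= 0 then (-1) ^+ `|k|%N *: E_op a `|k|%N u else 0.

Definition vertex (a : RZ) : opser int F :=
  ser_mul (ser_mul (ser_mul (H_plus a) (E_minus a))
             (ser_const (e_op epsilon a)))
    (z_op xi a).

(* a_{-n} and a_n *)
Definition a_neg (a : gT -> C) n : F -> F := lift_op (create (@sigma gT a n)).
Definition a_pos (a : gT -> C) n : F -> F := lift_op (annih xi (@sigma gT a n)).

(* \sum_(n >= 1) 1/n a_{-n} z^n and \sum_(n >= 1) 1/n a_n z^{-n} *)
Definition heis_neg (a : RZ) : opser int F := fun k u =>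
  if 0 < k then (`|k|%N)%:R^-1 *: a_neg (vchar a) `|k|%N u else 0.
Definition heis_pos (a : RZ) : opser int F := fun k u =>
  if k < 0 then (`|k|%N)%:R^-1 *: a_pos (vchar a) `|k|%N u else 0.

Definition normal_ordered (a b : RZ) : opser (int * int)%type F :=
  ser_mul (ser_mul (ser_mul (ser_mul
    (ser_exp (ser_add (in_z (heis_neg a)) (in_w (heis_neg b))))
    (ser_exp (ser_opp (ser_add (in_z (heis_pos a)) (in_w (heis_pos b))))))
    (ser_const (e_op epsilon (a + b))))
    (in_z (z_op xi a)))
    (in_w (z_op xi b)).

End VertexOperators.
End Characters.

(* Main.v *)
From HB Require Import structures.
Require Import Defs.
From mathcomp Require Import all_boot all_order all_algebra all_fingroup.
From mathcomp Require Import mxrepresentation character boolp.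
From mathcomp Require Import zify ring mxtens reals complex.

Set Implicit Arguments.
Unset Strict Implicit.
Unset Printing Implicit Defensive.

Import Order.TTheory GRing.Theory Num.Theory.
Local Open Scope ring_scope.

(** The groups Gamma_n are treated together: [wr_all gT] is their disjoint union.
    If a subset [A] of the indices is stable under the permutation of [x], then
    [x] restricts to an element [x|A], well defined up to conjugacy. A class
    function induced from Gamma_n x Gamma_m takes at [x] the value
      sum over stable [A] with n elements of F(x|A) G(x|A^c)
    ([induce_stab]), so induction becomes the convolution [conv] over stable
    subsets. Its associativity, its commutativity and its restriction to a
    disjoint union ([conv2_dsum], the Mackey formula) are then statements about
    finite sets, and the average over Gamma_n of a convolution is a sum of
    products of averages ([avg_conv2]).

    A class function is multiplicative if F(x u y) = F(x) F(y) for the disjoint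
    union u. Counting pairs made of an index and the cycle that contains it gives
      n F_n = sum_k F^c_k F_(n-k)
    where F^c is [cycpart F], the function F restricted to the cycles and weighted
    by their length ([multf_rec]). The characters eta(a) and eps(a) are
    multiplicative and, since the trace of a cycle on a tensor power is the trace
    of the product of its entries, their cycle parts are sigma(a) up to sign
    ([cycpart_eta], [cycpart_eps]). The recursion thus yields Newton's relations
    between the H_(-n), E_n and the Heisenberg operators ([Hop_rec], [Eop_rec]).
    Since a power series is determined by its logarithmic derivative, H_+ and E_-
    are the exponentials that occur in the normal ordered product
    ([ser_exp_pair]).

    For multiplicative functions the Mackey formula gives ([ann_conv], [Eop_Hop])
      E_n(a) H_(-m)(b) = sum_k c_k H_(-(m-k))(b) E_(n-k)(a)
    with c_k = < eps_k(a), eta_k(b) >_xi. The function averaged in c_k is again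
    multiplicative, and its recursion reads
      (k+1) c_(k+1) = (< a, b >_xi - k) c_k,
    so that c_k is a binomial coefficient ([pnumE]) and moving E_-(a, z) past
    H_+(b, w) produces (1 - w/z)^(< a, b >_xi) ([HE_HE]). The pairing < a, b >_xi
    is an integer because the average of the trace of a representation is the rank
    of a projector ([wform_int]). What remains is to compare coefficients on
    F_Gamma, where e^a shifts the index of a family by [a] ([local_vertex],
    [local_normal_ordered]) and the cocycle identity collects the scalars. *)

(** * Relabelling elements of wreath products *)

Section Relabel.
Variable gT : finGroupType.

(** [y] is the pullback of [x] along the injection [h], up to conjugation by an
    element [b] of the base group. As [h] intertwines the permutations, its image
    is stable under [x]. The condition on the base is stated at [wr_perm y j]
    rather than at [j], which avoids inverse permutations. *)
Definition emb k n (h : 'I_k -> 'I_n) (y : wreath gT k) (x : wreath gT n) :=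
  [/\ injective h,
      forall j, h (wr_perm y j) = wr_perm x (h j)
    & exists b : 'I_k -> gT, forall j,
        wr_base y (wr_perm y j) =
          ((b (wr_perm y j))^-1 * wr_base x (wr_perm x (h j)) * b j)%g].

Lemma emb_id n (x : wreath gT n) : emb id x x.
Proof. by split=> //; exists (fun=> 1%g) => j; rewrite invg1 mul1g mulg1. Qed.

Lemma emb_comp k n m (h : 'I_k -> 'I_n) (h' : 'I_n -> 'I_m) y x w :
  emb h y x -> emb h' x w -> emb (h' \o h) y w.
Proof.
move=> [hi hs [b hb]] [hi' hs' [b' hb']]; split.
- exact: inj_comp.
- by move=> j /=; rewrite hs hs'.
exists (fun j => b' (h j) * b j)%g => j /=.
by rewrite hb hb' hs invMg !mulgA.
Qed.

Lemma wr_conj_perm n (x g : wreath gT n) j :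
  wr_perm g (wr_perm (x ^ g)%g j) = wr_perm x (wr_perm g j).
Proof. by rewrite /= !permM permKV. Qed.

Lemma wr_baseM n (x y : wreath gT n) i :
  wr_base (x * y)%g i = (wr_base x i * wr_base y ((wr_perm x)^-1 i))%g.
Proof. by rewrite /= ffunE. Qed.

Lemma wr_baseV n (x : wreath gT n) i :
  wr_base (x^-1)%g i = ((wr_base x (wr_perm x i))^-1)%g.
Proof. by rewrite /= ffunE. Qed.
Lemma wr_permV n (x : wreath gT n) : wr_perm (x^-1)%g = ((wr_perm x)^-1)%g.
Proof. by []. Qed.

Lemma wr_conj_base n (x g : wreath gT n) j :
  wr_base (x ^ g)%g (wr_perm (x ^ g)%g j) =
    ((wr_base g (wr_perm g (wr_perm (x ^ g)%g j)))^-1 *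
      wr_base x (wr_perm x (wr_perm g j)) * wr_base g (wr_perm g j))%g.
Proof.
move: (wr_perm (x ^ g)%g j) (wr_conj_perm x g j) => i e.
rewrite -e conjgE !wr_baseM wr_baseV wr_permV invgK -mulgA.
congr (_ * (_ * wr_base g _))%g.
by apply: (@perm_inj _ (wr_perm x)); rewrite permKV -e.
Qed.

Lemma emb_conj n (x g : wreath gT n) : emb (wr_perm g) (x ^ g)%g x.
Proof.
split; [exact: perm_inj | by move=> j; rewrite wr_conj_perm |].
by exists (fun j => wr_base g (wr_perm g j)) => j; rewrite wr_conj_base.
Qed.

Lemma emb_inv k n (h : 'I_k -> 'I_n) y x : emb h y x -> emb h y^-1%g x^-1%g.
Proof.
move=> [hi hs [b hb]]; have hsV j : h ((wr_perm y)^-1 j)%g = ((wr_perm x)^-1 (h j))%g.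
  by apply: (perm_inj (s := wr_perm x)); rewrite -hs !permKV.
split=> //; exists b => j.
rewrite !wr_baseV wr_permV permKV -[in wr_base y j](permKV (wr_perm y) j) hb permKV.
by rewrite wr_permV permKV -hs permKV !invMg invgK !mulgA.
Qed.

(** Two pullbacks along injections with the same image are conjugate. The equation
    [e] between the sizes is needed to state this. *)
Lemma emb_uniq k k' n (h : 'I_k -> 'I_n) (h' : 'I_k' -> 'I_n) y y' x :
  emb h y x -> emb h' y' x -> h @: [set: 'I_k] = h' @: [set: 'I_k'] ->
  exists (e : k' = k) (g : wreath gT k), y = ((ecast k (wreath gT k) e y') ^ g)%g.
Proof.
move=> [hi hs [b hb]] [hi' hs' [b' hb']] im.
have e : k' = k.
  by rewrite -[k']card_ord -[k]card_ord -!cardsT -(card_imset _ hi) -(card_imset _ hi') im.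
exists e; subst k' => /=.
have tP i : exists j, h' j == h i.
  have : h i \in h' @: [set: 'I_k] by rewrite -im imset_f.
  by case/imsetP => j _ ->; exists j.
pose t i := xchoose (tP i).
have ht i : h' (t i) = h i by apply/eqP/(xchooseP (tP i)).
have ti : injective t by move=> i j eij; apply: hi; rewrite -!ht eij.
have sE i : wr_perm y' (t i) = t (wr_perm y i).
  by apply: hi'; rewrite ht hs' ht hs.
pose g : wreath gT k := Wreath [ffun i => ((b' i)^-1 * b ((perm ti)^-1 i))%g] (perm ti).
exists g; have eP i : wr_perm (y' ^ g)%g i = wr_perm y i.
  by apply: (@perm_inj _ (wr_perm g)); rewrite wr_conj_perm /= !permE sE.
apply: wr_eq => [i|]; last by apply/permP => i; rewrite eP.
rewrite -(permKV (wr_perm (y' ^ g)%g) i) wr_conj_base.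
move: (((wr_perm (y' ^ g))^-1)%g i) => j; rewrite eP hb /=.
rewrite !ffunE !permK !permE hb' sE !ht !invMg !invgK.
by rewrite -!mulgA !(mulKVg, mulKg).
Qed.

(** * Restriction to stable subsets *)

(** Class functions on the disjoint union of the groups [wreath gT n]. *)
Definition classf S (F : wr_all gT -> S) :=
  forall n (x y : wreath gT n), F (wr_elt (x ^ y)%g) = F (wr_elt x).

Lemma classf_emb S (F : wr_all gT -> S) k k' n (h : 'I_k -> 'I_n)
    (h' : 'I_k' -> 'I_n) y y' x :
  classf F -> emb h y x -> emb h' y' x -> h @: [set: 'I_k] = h' @: [set: 'I_k'] ->
  F (wr_elt y) = F (wr_elt y').
Proof.
move=> cF hy hy' im; have [e [g ->]] := emb_uniq hy hy' im.
by subst k'; rewrite cF.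
Qed.

Lemma classf_embT S (F : wr_all gT -> S) k n (h : 'I_k -> 'I_n) y x :
  classf F -> emb h y x -> h @: [set: 'I_k] = [set: 'I_n] -> F (wr_elt y) = F (wr_elt x).
Proof. by move=> cF hy im; apply: (classf_emb cF hy (emb_id x)); rewrite im imset_id. Qed.

(** The subset [A] is a union of cycles of [x]. *)
Definition stab n (x : wreath gT n) (A : {set 'I_n}) :=
  [forall i, (wr_perm x i \in A) == (i \in A)].

Lemma stabP n (x : wreath gT n) (A : {set 'I_n}) :
  reflect (forall i, (wr_perm x i \in A) = (i \in A)) (stab x A).
Proof. by apply: (iffP forallP) => sA i; apply/eqP; rewrite sA. Qed.

Lemma stabC n (x : wreath gT n) A : stab x (~: A) = stab x A.
Proof.
by apply/stabP/stabP => sA i; [move: (sA i); rewrite !inE => /negb_inj | rewrite !inE sA].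
Qed.

Lemma stabD n (x : wreath gT n) A B : stab x A -> stab x B -> stab x (A :\: B).
Proof. by move=> /stabP sA /stabP sB; apply/stabP => i; rewrite !inE sA sB. Qed.

Lemma stabT n (x : wreath gT n) : stab x [set: 'I_n].
Proof. by apply/stabP => i; rewrite !inE. Qed.

Lemma emb_stab k n (h : 'I_k -> 'I_n) y x (B : {set 'I_k}) :
  emb h y x -> stab x (h @: B) = stab y B.
Proof.
move=> [hi hs _]; apply/stabP/stabP => sB i.
  by move: (sB (h i)); rewrite -hs !(mem_imset _ _ hi).
have [/imsetP[j jB ->]|nB] := boolP (i \in h @: B).
  by rewrite -hs mem_imset ?sB.
apply: contraNF nB => /imsetP[j jB e].
rewrite -(permKV (wr_perm y) j) hs in e; move/perm_inj: e => ->.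
by rewrite imset_f // -sB permKV.
Qed.

(** The pullback along [h] exists when the image of [h] is stable; this one is not
    twisted on the base. *)
Lemma emb_ex k n (h : 'I_k -> 'I_n) (x : wreath gT n) :
  injective h -> stab x (h @: [set: 'I_k]) ->
  exists2 y, emb h y x & forall i, wr_base y i = wr_base x (h i).
Proof.
move=> hi /stabP sx.
have sP i : exists j, h j == wr_perm x (h i).
  have : wr_perm x (h i) \in h @: [set: 'I_k] by rewrite sx imset_f.
  by case/imsetP => j _ ->; exists j.
pose s i := xchoose (sP i).
have hs i : h (s i) = wr_perm x (h i) by apply/eqP/(xchooseP (sP i)).
have si : injective s by move=> i j e; apply/hi/(@perm_inj _ (wr_perm x)); rewrite -!hs e.
exists (Wreath [ffun i => wr_base x (h i)] (perm si)); last by move=> i; rewrite ffunE.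
split=> // [j /=|]; first by rewrite permE hs.
by exists (fun=> 1%g) => j /=; rewrite ffunE permE hs invg1 mul1g mulg1.
Qed.

(** The restriction of [x] to the stable subset [A], as an element of the wreath
    product with [#|A|] factors. It is a chosen pullback along the enumeration of
    [A], hence only meaningful up to conjugacy; the value is [1] in degree 0 when
    [A] is not stable. *)
Definition res n (x : wreath gT n) (A : {set 'I_n}) : wr_all gT :=
  if pselect (exists y : wreath gT #|A|, emb (@enum_val _ (mem A)) y x) is left e
  then wr_elt (projT1 (cid e)) else wr_elt (1%g : wreath gT 0).

Lemma enum_val_setT n (A : {set 'I_n}) : (@enum_val _ (mem A)) @: [set: 'I_#|A|] = A.
Proof.
apply/setP => i; apply/imsetP/idP => [[j _ ->]|iA]; first exact: enum_valP.
by exists (enum_rank_in iA i); rewrite ?inE // enum_rankK_in.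
Qed.

Lemma res_emb n (x : wreath gT n) (A : {set 'I_n}) : stab x A ->
  exists (h : 'I_#|A| -> 'I_n) y, [/\ res x A = wr_elt y, emb h y x & h @: [set: 'I_#|A|] = A].
Proof.
move=> sA; rewrite /res; case: pselect => [e|[]].
  exists (@enum_val _ (mem A)), (projT1 (cid e)).
  by split; [ | exact: (projT2 (cid e)) | exact: enum_val_setT].
have [||y hy _] := @emb_ex _ _ (@enum_val _ (mem A)) x; last by exists y.
  exact: enum_val_inj.
by rewrite enum_val_setT.
Qed.

Lemma classf_res S (F : wr_all gT -> S) k n (h : 'I_k -> 'I_n) y x A :
  classf F -> emb h y x -> h @: [set: 'I_k] = A -> F (res x A) = F (wr_elt y).
Proof.
move=> cF hy im; have : stab x A by rewrite -im (emb_stab _ hy) stabT.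
case/res_emb => h' [y' [-> hy' im']].
by apply: classf_emb cF hy' hy _; rewrite im im'.
Qed.

Lemma classf_resT S (F : wr_all gT -> S) n (x : wreath gT n) :
  classf F -> F (res x [set: 'I_n]) = F (wr_elt x).
Proof. by move=> cF; apply: (classf_res cF (emb_id x)); rewrite imset_id. Qed.

Lemma tag_res n (x : wreath gT n) A : stab x A -> tag (res x A) = #|A|.
Proof. by case/res_emb => h [y [-> _ _]]. Qed.

Lemma classf_res_res S (F : wr_all gT -> S) k n (h : 'I_k -> 'I_n) y x (B : {set 'I_k}) :
  classf F -> emb h y x -> stab y B -> F (res y B) = F (res x (h @: B)).
Proof.
move=> cF hy /res_emb[h' [y' [-> hy' im']]]; symmetry.
by apply: classf_res cF (emb_comp hy' hy) _; rewrite imset_comp im'.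
Qed.

(** * Disjoint unions *)

Lemma perm_sum_l n m (s : 'S_n) (t : 'S_m) i : perm_sum s t (lshift m i) = lshift m (s i).
Proof. by rewrite permE /perm_sum_fun (unsplitK (inl _)). Qed.
Lemma perm_sum_r n m (s : 'S_n) (t : 'S_m) i : perm_sum s t (rshift n i) = rshift n (t i).
Proof. by rewrite permE /perm_sum_fun (unsplitK (inr _)). Qed.
Lemma wr_embed_l n m (p : wreath gT n * wreath gT m) i :
  wr_base (wr_embed p) (lshift m i) = wr_base p.1 i.
Proof. by rewrite ffunE (unsplitK (inl _)). Qed.
Lemma wr_embed_r n m (p : wreath gT n * wreath gT m) i :
  wr_base (wr_embed p) (rshift n i) = wr_base p.2 i.
Proof. by rewrite ffunE (unsplitK (inr _)). Qed.

Lemma emb_lshift n m (x : wreath gT n) (y : wreath gT m) :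
  emb (@lshift n m) x (wr_embed (x, y)).
Proof.
split; [exact: lshift_inj | by move=> j; rewrite perm_sum_l |].
by exists (fun=> 1%g) => j; rewrite perm_sum_l wr_embed_l invg1 mul1g mulg1.
Qed.
Lemma emb_rshift n m (x : wreath gT n) (y : wreath gT m) :
  emb (@rshift n m) y (wr_embed (x, y)).
Proof.
split; [exact: rshift_inj | by move=> j; rewrite perm_sum_r |].
by exists (fun=> 1%g) => j; rewrite perm_sum_r wr_embed_r invg1 mul1g mulg1.
Qed.

(** The map on ['I_(n + m)] given by [h1] on the first [n] indices and [h2] on the others. *)
Definition copair S n m (h1 : 'I_n -> S) (h2 : 'I_m -> S) (i : 'I_(n + m)) : S :=
  match fintype.split i with inl a => h1 a | inr b => h2 b end.
Lemma copair_l S n m (h1 : 'I_n -> S) (h2 : 'I_m -> S) i :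
  copair h1 h2 (lshift m i) = h1 i.
Proof. by rewrite /copair (unsplitK (inl _)). Qed.
Lemma copair_r S n m (h1 : 'I_n -> S) (h2 : 'I_m -> S) i :
  copair h1 h2 (rshift n i) = h2 i.
Proof. by rewrite /copair (unsplitK (inr _)). Qed.

Lemma imset_copair (S : finType) n m (h1 : 'I_n -> S) (h2 : 'I_m -> S) :
  copair h1 h2 @: [set: 'I_(n + m)] = h1 @: [set: 'I_n] :|: h2 @: [set: 'I_m].
Proof.
apply/setP => i; apply/imsetP/setUP.
  case=> k _ ->; case: (split_ordP k) => j ->; rewrite ?copair_l ?copair_r.
  - by left; rewrite imset_f.
  - by right; rewrite imset_f.
case=> /imsetP[j _ ->].
- by exists (lshift m j); rewrite ?copair_l.
- by exists (rshift n j); rewrite ?copair_r.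
Qed.

Lemma emb_copair n m N (h1 : 'I_n -> 'I_N) (h2 : 'I_m -> 'I_N) y1 y2 x :
  emb h1 y1 x -> emb h2 y2 x -> [disjoint h1 @: [set: 'I_n] & h2 @: [set: 'I_m]] ->
  emb (copair h1 h2) (wr_embed (y1, y2)) x.
Proof.
move=> [hi hs [b hb]] [hi' hs' [b' hb']] dis.
have ne i j : h1 i <> h2 j.
  move=> e; move/pred0P: dis => /(_ (h1 i)) /=.
  by rewrite {2}e !imset_f.
split.
- move=> i j; case: (split_ordP i) => i' ->; case: (split_ordP j) => j' ->;
    rewrite ?copair_l ?copair_r => e; first by rewrite (hi _ _ e).
  + by case: (ne _ _ e).
  + by case: (ne _ _ (esym e)).
  + by rewrite (hi' _ _ e).
- move=> j; case: (split_ordP j) => j' ->; rewrite ?perm_sum_l ?perm_sum_r.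
  + by rewrite !copair_l hs.
  + by rewrite !copair_r hs'.
exists (copair b b') => j; case: (split_ordP j) => j' ->.
- by rewrite perm_sum_l wr_embed_l !copair_l hb.
- by rewrite perm_sum_r wr_embed_r !copair_r hb'.
Qed.

(** * Induction from a product of two wreath products *)

Lemma wr_embed_inj n m : injective (@wr_embed gT n m).
Proof.
move=> p q e; rewrite [p]surjective_pairing [q]surjective_pairing; congr (_, _).
- apply: wr_eq => [i|]; first by rewrite -!wr_embed_l e.
  apply/permP => i; apply: (@lshift_inj n m).
  by move/(congr1 (fun z => wr_perm z (lshift m i))): e; rewrite !perm_sum_l.
- apply: wr_eq => [i|]; first by rewrite -!wr_embed_r e.
  apply/permP => i; apply: (@rshift_inj n m).
  by move/(congr1 (fun z => wr_perm z (rshift n i))): e; rewrite !perm_sum_r.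
Qed.

(** The first [n] indices. *)
Definition lpart n m : {set 'I_(n + m)} := @lshift n m @: [set: 'I_n].

Lemma mem_lpart_l n m i : lshift m i \in lpart n m.
Proof. exact: imset_f. Qed.
Lemma mem_lpart_r n m i : rshift n i \in lpart n m = false.
Proof. by apply/negP => /imsetP[j _ /eqP]; rewrite eq_rlshift. Qed.

Lemma lpartC n m : ~: lpart n m = @rshift n m @: [set: 'I_m].
Proof.
apply/setP => i; rewrite inE; case: (split_ordP i) => j ->.
  rewrite mem_lpart_l; apply/esym/negP => /imsetP[k _ /eqP]; by rewrite eq_lrshift.
by rewrite mem_lpart_r imset_f.
Qed.

(** Gamma_n x Gamma_m is the stabilizer of the set of the first [n] indices. *)
Lemma wr_embedP n m (y : wreath gT (n + m)) :
  reflect (exists p, wr_embed p = y) (stab y (lpart n m)).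
Proof.
apply: (iffP idP) => [sy|[[y1 y2] <-]]; last first.
  by rewrite (emb_stab _ (emb_lshift _ _)) stabT.
have [||y1 [_ s1 _] b1] := @emb_ex n _ (@lshift n m) y => //; first exact: lshift_inj.
have [||y2 [_ s2 _] b2] := @emb_ex m _ (@rshift n m) y; first exact: rshift_inj.
  by rewrite -lpartC stabC.
exists (y1, y2); apply: wr_eq => [i|].
  case: (split_ordP i) => j ->; first by rewrite wr_embed_l b1.
  by rewrite wr_embed_r b2.
apply/permP => i; case: (split_ordP i) => j ->; first by rewrite perm_sum_l s1.
by rewrite perm_sum_r s2.
Qed.

Lemma perm_lpart n m (A : {set 'I_(n + m)}) : #|A| = n ->
  exists s : 'S_(n + m), s @: lpart n m = A.
Proof.
move=> cA; have cA' : #|~: A| = m by apply/eqP; rewrite -(eqn_add2l #|A|) cardsC card_ord cA.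
pose h1 i := @enum_val _ (mem A) (cast_ord (esym cA) i).
pose h2 i := @enum_val _ (mem (~: A)) (cast_ord (esym cA') i).
have m1 i : h1 i \in A by apply: enum_valP.
have m2 i : h2 i \notin A by have := enum_valP (cast_ord (esym cA') i); rewrite inE.
have inj : injective (copair h1 h2).
  move=> i j; case: (split_ordP i) => i' ->; case: (split_ordP j) => j' ->;
    rewrite ?copair_l ?copair_r => e.
  - by move/enum_val_inj/cast_ord_inj: e => ->.
  - by have := m1 i'; rewrite e (negbTE (m2 _)).
  - by have := m1 j'; rewrite -e (negbTE (m2 _)).
  - by move/enum_val_inj/cast_ord_inj: e => ->.
exists (perm inj); apply/eqP; rewrite eqEcard; apply/andP; split.
  apply/subsetP => i /imsetP[j /imsetP[k _ ->] ->].
  by rewrite permE copair_l.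
rewrite card_imset; last exact: perm_inj.
by rewrite card_imset ?cardsT ?card_ord ?cA //; exact: lshift_inj.
Qed.

(** The elements that send the first [n] indices to [A] form a coset of
    Gamma_n x Gamma_m. *)
Lemma card_perm_lpart n m (A : {set 'I_(n + m)}) : #|A| = n ->
  #|[pred g : wreath gT (n + m) | wr_perm g @: lpart n m == A]| =
    #|{: wreath gT n * wreath gT m}|.
Proof.
case/perm_lpart => s sA; pose g0 : wreath gT (n + m) := Wreath [ffun=> 1%g] s.
have inj : injective (fun p => (g0 * @wr_embed gT n m p)%g).
  by move=> p q /mulgI/wr_embed_inj.
rewrite -[RHS]cardsT -(card_imset _ inj); apply: eq_card => g.
rewrite inE; apply/eqP/imsetP => [gA|[p _ ->]]; last first.
  have : stab (wr_embed p) (lpart n m) by apply/wr_embedP; exists p.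
  rewrite /= -[in RHS]sA.
  move/stabP => st; apply/setP => i; apply/imsetP/imsetP => -[j jL ->].
    by exists (wr_perm (wr_embed p) j); rewrite ?st // permM.
  exists ((wr_perm (wr_embed p))^-1 j)%g; last by rewrite permM permKV.
  by rewrite -st permKV.
have : stab (g0^-1 * g)%g (lpart n m).
  apply/stabP => i; rewrite /= permM -(mem_imset _ _ (@perm_inj _ s)) permKV sA -gA.
  by rewrite mem_imset //; apply: perm_inj.
by case/wr_embedP => p e; exists p => //; rewrite e mulKVg.
Qed.

Section Convolution.
Variable C : numClosedFieldType.
Local Notation T := (wr_all gT).

(** Class functions of two variables. *)
Definition classf2 (Phi : T -> T -> C) :=
  (forall t, classf (Phi t)) /\ (forall t, classf (Phi^~ t)).

(** The sum of [Phi (x|A) (x|A^c)] over the stable subsets [A] of [x]. *)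
Definition conv2 (Phi : T -> T -> C) (t : T) : C :=
  \sum_(A | stab (tagged t) A) Phi (res (tagged t) A) (res (tagged t) (~: A)).

(** An induced class function is a sum over stable subsets: the conjugate [x ^ g]
    lies in Gamma_n x Gamma_m if and only if the image under [g] of the first [n]
    indices is stable under [x]. *)
Lemma induce_stab n m (Phi : T -> T -> C) (x : wreath gT (n + m)) : classf2 Phi ->
  induce (@wr_embed gT n m) (fun p => Phi (wr_elt p.1) (wr_elt p.2)) x =
  \sum_(A | stab x A && (#|A| == n)) Phi (res x A) (res x (~: A)).
Proof.
move=> [c1 c2]; rewrite /induce.
pose Ag (g : wreath gT (n + m)) := wr_perm g @: lpart n m.
have inner (g : wreath gT (n + m)) :
  \sum_(p | wr_embed p == (x ^ g)%g) Phi (wr_elt p.1) (wr_elt p.2) =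
  if stab x (Ag g) then Phi (res x (Ag g)) (res x (~: Ag g)) else 0.
  rewrite (emb_stab _ (emb_conj x g)).
  case: ifP => [/wr_embedP[[y1 y2] e]|/wr_embedP ne]; last first.
    by apply: big_pred0 => p; apply/negP => /eqP e; apply: ne; exists p.
  rewrite (big_pred1 (y1, y2)) => [|p]; last by rewrite -e (inj_eq (@wr_embed_inj _ _)).
  have e1 : emb (wr_perm g \o @lshift n m) y1 x.
    by apply: (emb_comp _ (emb_conj x g)); rewrite -e; exact: emb_lshift.
  have e2 : emb (wr_perm g \o @rshift n m) y2 x.
    by apply: (emb_comp _ (emb_conj x g)); rewrite -e; exact: emb_rshift.
  have a1 : (wr_perm g \o @lshift n m) @: [set: 'I_n] = Ag g by rewrite imset_comp.
  have a2 : (wr_perm g \o @rshift n m) @: [set: 'I_m] = ~: Ag g.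
    rewrite imset_comp -lpartC; apply/setP => i; rewrite inE -(permKV (wr_perm g) i).
    by rewrite !(mem_imset _ _ (@perm_inj _ _)) inE.
  have r1 t := @classf_res _ (Phi^~ t) _ _ _ _ _ _ (c2 t) e1 a1.
  have r2 t := @classf_res _ (Phi t) _ _ _ _ _ _ (c1 t) e2 a2.
  by rewrite /= in r1; rewrite r1 r2.
under eq_bigr => g _ do rewrite inner.
rewrite (partition_big Ag (fun A => #|A| == n)) /=; last first.
  move=> g _; rewrite card_imset; last exact: perm_inj.
  by rewrite card_imset ?cardsT ?card_ord //; exact: lshift_inj.
rewrite [RHS]big_mkcondl /= mulr_sumr; apply: eq_bigr => A /eqP cA.
under eq_bigr => g /eqP e do rewrite e.
rewrite sumr_const card_perm_lpart // -[X in _ * X = _]mulr_natl mulKf // pnatr_eq0 -lt0n.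
by apply/card_gt0P; exists (1%g, 1%g).
Qed.

(** The value of [conv2 Phi] at a pullback is a sum over the stable subsets of the image. *)
Lemma conv2_emb Phi k n (h : 'I_k -> 'I_n) y x : classf2 Phi -> emb h y x ->
  conv2 Phi (wr_elt y) =
  \sum_(B | stab x B && (B \subset h @: [set: 'I_k]))
     Phi (res x B) (res x (h @: [set: 'I_k] :\: B)).
Proof.
move=> [c1 c2] hy; have [hi _ _] := hy; rewrite /conv2 /=.
rewrite [RHS](reindex_onto (fun A : {set 'I_k} => h @: A) (fun B => h @^-1: B)) /=; last first.
  move=> B /andP[_ /subsetP sB]; apply/setP => i; apply/imsetP/idP => [[j]|iB].
    by rewrite inE => ? ->.
  by have /imsetP[j _ e] := sB _ iB; exists j; rewrite // inE -e.
apply: eq_big => A.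
  rewrite (emb_stab _ hy) imsetS ?subsetT // andbT.
  rewrite (_ : h @^-1: _ = A) ?eqxx ?andbT //.
  by apply/setP => i; rewrite inE mem_imset.
move=> sA; have r1 t := @classf_res_res _ (Phi^~ t) _ _ _ _ _ _ (c2 t) hy sA.
have r2 t : Phi t (res y (~: A)) = Phi t (res x (h @: ~: A)).
  by apply: classf_res_res (c1 t) hy _; rewrite stabC.
rewrite /= in r1; rewrite r1 r2.
congr (Phi _ (res x _)); apply/setP => i; rewrite inE.
apply/imsetP/andP => [[j]|[nA /imsetP[j _ e]]].
  by rewrite inE => jA ->; rewrite mem_imset // jA imset_f.
by exists j; rewrite // inE; apply: contraNN nA; rewrite e; apply: imset_f.
Qed.

Lemma classf_conv2 Phi : classf2 Phi -> classf (conv2 Phi).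
Proof.
move=> cP n x y; rewrite (conv2_emb cP (emb_conj x y)) (conv2_emb cP (emb_id x)).
rewrite imset_id (_ : wr_perm y @: _ = [set: 'I_n]) //.
by apply/setP => i; rewrite inE -(permKV (wr_perm y) i) imset_f.
Qed.

End Convolution.

Section ConvolutionProduct.
Variable C : numClosedFieldType.
Local Notation T := (wr_all gT).

(** The induction product, in all degrees at once. *)
Definition conv (F G : T -> C) : T -> C := conv2 (fun a b => F a * G b).

Lemma convE F G t : conv F G t =
  \sum_(A | stab (tagged t) A) F (res (tagged t) A) * G (res (tagged t) (~: A)).
Proof. by []. Qed.

Lemma classf2M (F G : T -> C) : classf F -> classf G -> classf2 (fun a b => F a * G b).
Proof. by move=> cF cG; split=> t n x y; rewrite ?cF ?cG. Qed.

Lemma classf_conv F G : classf F -> classf G -> classf (conv F G).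
Proof. by move=> cF cG; apply/classf_conv2/classf2M. Qed.

Lemma convC F G : conv F G = conv G F.
Proof.
apply/funext => t; rewrite /conv /conv2 [RHS](reindex_inj (@setC_inj _)) /=.
by apply: eq_big => [A|A _]; rewrite ?stabC // setCK mulrC.
Qed.

Lemma conv_res F G n (x : wreath gT n) A : classf F -> classf G -> stab x A ->
  conv F G (res x A) =
  \sum_(B | stab x B && (B \subset A)) F (res x B) * G (res x (A :\: B)).
Proof.
move=> cF cG /res_emb[h [y [-> hy im]]].
by rewrite /conv (conv2_emb (classf2M cF cG) hy) im.
Qed.

Lemma convA F G H : classf F -> classf G -> classf H ->
  conv F (conv G H) = conv (conv F G) H.
Proof.
move=> cF cG cH; apply/funext => -[n x]; rewrite (convE F) [RHS]convE /=.
under eq_bigr => A sA do rewrite conv_res ?stabC // mulr_sumr.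
under [RHS]eq_bigr => A sA do rewrite conv_res // mulr_suml.
rewrite [RHS](exchange_big_dep (stab x)) /=; last by move=> A B _ /andP[].
apply: eq_bigr => A sA.
rewrite [RHS](reindex_onto (fun B => A :|: B) (fun B => B :\: A)) /=; last first.
  by move=> B /and3P[_ _ sub]; rewrite setDE setUIr setUCr setIT; apply/setUidPr.
apply: eq_big => B.
  rewrite sA subsetUl /= andbT setDUl setDv set0U.
  apply/andP/andP => [[sB sub]|[sAB /eqP e]].
    rewrite (_ : B :\: A = B) ?eqxx; last by apply/setDidPl; rewrite disjoints_subset.
    by split=> //; rewrite -stabC setCU -setDE stabD // stabC.
  rewrite -e; split; last by rewrite setDE subsetIr.
  by rewrite -[B :\: A]set0U -(setDv A) -setDUl stabD.
move=> /andP[sB sub]; rewrite mulrA.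
have dAB : [disjoint B & A] by rewrite disjoints_subset.
rewrite setDUl setDv set0U (setDidPl dAB); congr (_ * _ * H (res x _)).
by rewrite setCU setDE.
Qed.

Lemma conv_suml (I : Type) (r : seq I) (P : pred I) (F : I -> T -> C) G t :
  conv (fun a => \sum_(i <- r | P i) F i a) G t = \sum_(i <- r | P i) conv (F i) G t.
Proof.
rewrite /conv /conv2 exchange_big /=; apply: eq_bigr => A _; exact: mulr_suml.
Qed.

(** * Restriction to a product of two wreath products *)

(** The disjoint union, that is, the image under Gamma_n x Gamma_m -> Gamma_(n+m). *)
Definition dsum (s t : T) : T := wr_elt (wr_embed (tagged s, tagged t)).

Lemma wr_embedJ n m (x g : wreath gT n) (y h : wreath gT m) :
  wr_embed ((x ^ g)%g, (y ^ h)%g) = (wr_embed (x, y) ^ wr_embed (g, h))%g.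
Proof.
apply: (mulgI (wr_embed (g, h))); rewrite -conjgC -!wr_embedM; congr (wr_embed (_, _)).
- exact/esym/conjgC.
- exact/esym/conjgC.
Qed.

Lemma wr_embedV n m (x : wreath gT n) (y : wreath gT m) :
  (wr_embed (x, y))^-1%g = wr_embed (x^-1, y^-1)%g.
Proof.
apply/eqP; rewrite eq_invg_mul -wr_embedM; apply/eqP.
apply: (mulgI (wr_embed (x, y))); rewrite -wr_embedM mulg1; congr (wr_embed (_, _)).
- by rewrite mulgV; exact: mulg1.
- by rewrite mulgV; exact: mulg1.
Qed.

Lemma classf_dsum_l S (F : T -> S) t : classf F -> classf (fun s => F (dsum s t)).
Proof.
move=> cF n x y; rewrite /dsum /=.
by rewrite -[tagged t in LHS](conjg1 (tagged t)) wr_embedJ cF.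
Qed.
Lemma classf_dsum_r S (F : T -> S) t : classf F -> classf (fun s => F (dsum t s)).
Proof.
move=> cF n x y; rewrite /dsum /=.
by rewrite -[tagged t in LHS](conjg1 (tagged t)) wr_embedJ cF.
Qed.

Lemma disjoint_lr n m (A : {set 'I_n}) (B : {set 'I_m}) :
  [disjoint @lshift n m @: A & @rshift n m @: B].
Proof.
apply/pred0P => i /=; apply/negP => /andP[/imsetP[j _ ->] /imsetP[k _ /eqP]].
by rewrite eq_lrshift.
Qed.

Lemma classf_res_embed S (F : T -> S) n m (x : wreath gT n) (y : wreath gT m) A B :
  classf F -> stab x A -> stab y B ->
  F (res (wr_embed (x, y)) (@lshift n m @: A :|: @rshift n m @: B)) =
  F (dsum (res x A) (res y B)).
Proof.
move=> cF /res_emb[h1 [y1 [-> e1 im1]]] /res_emb[h2 [y2 [-> e2 im2]]].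
have e1' := emb_comp e1 (emb_lshift x y); have e2' := emb_comp e2 (emb_rshift x y).
have dis : [disjoint (@lshift n m \o h1) @: [set: 'I_#|A|] &
                    (@rshift n m \o h2) @: [set: 'I_#|B|]].
  by rewrite (imset_comp (@lshift n m)) (imset_comp (@rshift n m)) disjoint_lr.
have im : copair (@lshift n m \o h1) (@rshift n m \o h2) @: [set: 'I_(#|A| + #|B|)] =
          @lshift n m @: A :|: @rshift n m @: B.
  by rewrite imset_copair (imset_comp (@lshift n m)) (imset_comp (@rshift n m)) im1 im2.
exact: (@classf_res S F _ _ _ _ _ _ cF (emb_copair e1' e2' dis) im).
Qed.

Lemma stab_embed n m (x : wreath gT n) (y : wreath gT m) (A : {set 'I_n}) (B : {set 'I_m}) :
  stab (wr_embed (x, y)) (@lshift n m @: A :|: @rshift n m @: B) = stab x A && stab y B.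
Proof.
have ml j : (lshift m j \in @lshift n m @: A :|: @rshift n m @: B) = (j \in A).
  rewrite inE (mem_imset _ _ (@lshift_inj _ _)) orb_idr // => /imsetP[k _ /eqP].
  by rewrite eq_lrshift.
have mr j : (rshift n j \in @lshift n m @: A :|: @rshift n m @: B) = (j \in B).
  rewrite inE (mem_imset _ _ (@rshift_inj _ _)) orb_idl // => /imsetP[k _ /eqP].
  by rewrite eq_rlshift.
apply/stabP/andP => [st|[/stabP sA /stabP sB] i].
  split; apply/stabP => i.
    by rewrite -ml -(perm_sum_l _ (wr_perm y)) -[RHS]ml; apply: st.
  by rewrite -mr -(perm_sum_r (wr_perm x)) -[RHS]mr; apply: st.
by case: (split_ordP i) => j ->; rewrite ?perm_sum_l ?perm_sum_r ?ml ?mr.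
Qed.

(** The stable subsets of a disjoint union are the unions of stable subsets. *)
Lemma conv2_dsum Phi s t : classf2 Phi ->
  conv2 Phi (dsum s t) =
  \sum_(A | stab (tagged s) A) \sum_(B | stab (tagged t) B)
    Phi (dsum (res (tagged s) A) (res (tagged t) B))
        (dsum (res (tagged s) (~: A)) (res (tagged t) (~: B))) :> C.
Proof.
move=> [c1 c2]; case: s t => [n x] [m y]; rewrite /conv2 /dsum /=.
rewrite pair_big /=.
pose f (p : {set 'I_n} * {set 'I_m}) := @lshift n m @: p.1 :|: @rshift n m @: p.2.
pose f' (A : {set 'I_(n + m)}) := (@lshift n m @^-1: A, @rshift n m @^-1: A).
have fl p j : (lshift m j \in f p) = (j \in p.1).
  rewrite inE (mem_imset _ _ (@lshift_inj _ _)) orb_idr // => /imsetP[k _ /eqP].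
  by rewrite eq_lrshift.
have fr p j : (rshift n j \in f p) = (j \in p.2).
  rewrite inE (mem_imset _ _ (@rshift_inj _ _)) orb_idl // => /imsetP[k _ /eqP].
  by rewrite eq_rlshift.
rewrite (reindex_onto f f') /=; last first.
  move=> A _; apply/setP => i; case: (split_ordP i) => j ->.
    by rewrite fl inE.
  by rewrite fr inE.
apply: eq_big => [[A B]|[A B] /andP[sf _]] /=.
  rewrite /f stab_embed /= (_ : f' _ = (A, B)) ?eqxx ?andbT //.
  by congr (_, _); apply/setP => i; rewrite inE -/(f (A, B)) ?fl ?fr.
move: sf; rewrite /f stab_embed /= => /andP[sA sB].
have -> : ~: (@lshift n m @: A :|: @rshift n m @: B) = f (~: A, ~: B).
  apply/setP => i; rewrite in_setC -/(f (A, B)); case: (split_ordP i) => j ->.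
    by rewrite !fl inE.
  by rewrite !fr inE.
have r1 t := @classf_res_embed _ (Phi^~ t) _ _ x y A B (c2 t) sA sB.
have r2 t := @classf_res_embed _ (Phi t) _ _ x y (~: A) (~: B) (c1 t).
by rewrite /= in r1; rewrite r1 /f r2 ?stabC.
Qed.

(** * Multiplicative functions *)

(** Class functions that are 1 in degree 0 and turn disjoint unions into products. *)
Definition multf (F : T -> C) :=
  [/\ classf F, forall t, tag t = 0%N -> F t = 1
    & forall s t, F (dsum s t) = F s * F t].

Lemma classf_split F n (x : wreath gT n) A : classf F -> stab x A ->
  F (wr_elt x) = F (dsum (res x A) (res x (~: A))) :> C.
Proof.
move=> cF sA.
have /res_emb[h1 [y1 [-> e1 im1]]] := sA.
have : stab x (~: A) by rewrite stabC.
case/res_emb=> h2 [y2 [-> e2 im2]].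
have dis : [disjoint h1 @: [set: 'I_#|A|] & h2 @: [set: 'I_#|~: A|]].
  by rewrite im1 im2 disjoints_subset setCK.
symmetry; apply: (@classf_embT C F _ _ _ _ _ cF (emb_copair e1 e2 dis)).
by rewrite imset_copair im1 im2 setUCr.
Qed.

Lemma multf_stab F n (x : wreath gT n) A : multf F -> stab x A ->
  F (wr_elt x) = F (res x A) * F (res x (~: A)).
Proof. by move=> [cF _ mF] sA; rewrite -mF; apply: classf_split. Qed.

Lemma multfM F G : multf F -> multf G -> multf (fun t => F t * G t).
Proof.
move=> [cF F1 mF] [cG G1 mG]; split.
- by move=> n x y; rewrite cF cG.
- by move=> t t0; rewrite F1 ?G1 ?mulr1.
- by move=> s t; rewrite mF mG mulrACA.
Qed.

Lemma multf_conv F G : multf F -> multf G -> multf (conv F G).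
Proof.
move=> [cF F1 mF] [cG G1 mG]; split; first exact: classf_conv.
  move=> [n x] /= n0; rewrite /conv /conv2 /=.
  rewrite (big_pred1 [set: 'I_n]) => [|A].
    have s0 : stab x (~: [set: 'I_n]) by rewrite stabC stabT.
    by rewrite F1 ?G1 ?mulr1 // tag_res ?stabT // ?setCT ?cards0 // cardsT card_ord.
  have -> : A = [set: 'I_n] by apply/setP => -[i lt]; exfalso; rewrite n0 in lt.
  by rewrite stabT /= eqxx.
move=> s t; rewrite /conv (conv2_dsum _ _ (classf2M cF cG)) /conv2 mulr_suml.
apply: eq_bigr => A _; rewrite mulr_sumr; apply: eq_bigr => B _.
by rewrite mF mG mulrACA.
Qed.

(** The permutation of [t] is a single cycle; false in degree 0. *)
Definition iscycle (t : T) := [exists i, porbit (wr_perm (tagged t)) i == [set: 'I_(tag t)]].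

Lemma emb_porbit k n (h : 'I_k -> 'I_n) y x i : emb h y x ->
  porbit (wr_perm x) (h i) = h @: porbit (wr_perm y) i.
Proof.
move=> [_ hs _]; have hsX a : h ((wr_perm y ^+ a) i)%g = ((wr_perm x ^+ a) (h i))%g.
  by elim: a => [|a IH]; rewrite ?expg0 ?perm1 // !expgSr !permM hs IH.
apply/setP => j; apply/porbitP/imsetP => [[a ->]|[k' /porbitP[a ->] ->]].
  by exists ((wr_perm y ^+ a) i)%g; rewrite ?hsX // mem_porbit.
by exists a; rewrite hsX.
Qed.

Lemma iscycle_emb k n (h : 'I_k -> 'I_n) y x : emb h y x ->
  iscycle (wr_elt y) = (h @: [set: 'I_k] \in porbits (wr_perm x)).
Proof.
move=> hy; have [hi _ _] := hy; apply/existsP/imsetP => -[ i].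
  by move/eqP => /= e; exists (h i) => //; rewrite (emb_porbit _ hy) e.
move=> _ e; have /imsetP[j _ ej] : i \in h @: [set: 'I_k] by rewrite e porbit_id.
by exists j; move: e; rewrite ej (emb_porbit _ hy) => /(imset_inj hi)/= <-.
Qed.

Lemma iscycle_res n (x : wreath gT n) A : stab x A ->
  iscycle (res x A) = (A \in porbits (wr_perm x)).
Proof. by case/res_emb=> h [y [-> hy {2}<-]]; apply: iscycle_emb. Qed.

Lemma classf_iscycle : classf iscycle.
Proof.
move=> n x y; rewrite (iscycle_emb (emb_conj x y)) (iscycle_emb (emb_id x)) imset_id.
rewrite (_ : wr_perm y @: [set: 'I_n] = [set: 'I_n]) //; apply/setP => i.
by rewrite inE -(permKV (wr_perm y) i) imset_f.
Qed.

Lemma porbit_stab n (x : wreath gT n) i : stab x (porbit (wr_perm x) i).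
Proof. by apply/stabP => j; rewrite -!eq_porbit_mem -(porbit_perm _ 1%N j) expg1. Qed.

(** The part of [F] carried by the elements whose permutation is a single cycle,
    weighted by the length of the cycle. *)
Definition cycpart (F : T -> C) (t : T) : C := if iscycle t then (tag t)%:R * F t else 0.

Lemma classf_cycpart F : classf F -> classf (cycpart F).
Proof. by move=> cF n x y; rewrite /cycpart classf_iscycle cF. Qed.

(** The stable subsets that contribute are the cycles of [t], each weighted by its
    length, and the lengths add up to the degree. *)
Lemma cycpart_conv F t : multf F -> conv (cycpart F) F t = (tag t)%:R * F t.
Proof.
move=> mF; case: t => n x; rewrite /conv /conv2 /=.
under eq_bigr => A sA do
  rewrite /cycpart iscycle_res // tag_res // (fun_if ( *%R^~ _)) mul0r -mulrA -multf_stab //.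
rewrite -big_mkcondr /= -mulr_suml -natr_sum; congr (_%:R * _).
rewrite -[RHS]card_ord -sum1_card.
rewrite (partition_big (porbit (wr_perm x)) (mem (porbits (wr_perm x)))) /=; last first.
  by move=> i _; apply: imset_f.
apply: eq_big => [A|A /andP[_ /imsetP[i _ ->]]].
  by rewrite andb_idl // => /imsetP[i _ ->]; apply: porbit_stab.
by rewrite sum1_card; apply: eq_card => j; rewrite -eq_porbit_mem.
Qed.

(** A cycle has only two stable subsets. *)
Lemma conv_cycle F G t : multf F -> multf G -> iscycle t -> conv F G t = F t + G t.
Proof.
move=> [cF F1 _] [cG G1 _]; case: t => n x /existsP[/= i /eqP oi].
have n0 : set0 != [set: 'I_n] :> {set 'I_n}.
  by apply/eqP => /setP/(_ i); rewrite !inE.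
have s0 : stab x set0 by rewrite -(setCT 'I_n) stabC stabT.
rewrite convE /= (bigD1 [set: 'I_n]) ?stabT //= (bigD1 set0) /=; last by rewrite s0 n0.
rewrite big1 => [|A /andP[/andP[/stabP sA neT] ne0]]; last first.
  case/set0Pn: ne0 => j jA; case/negP: neT; rewrite eqEsubset subsetT -oi.
  apply/subsetP => k; rewrite -eq_porbit_mem => /eqP ek.
  have: k \in porbit (wr_perm x) j.
    by rewrite -eq_porbit_mem ek eq_sym eq_porbit_mem oi inE.
  by case/porbitP => a ->; elim: a => [|a IH]; rewrite ?expg0 ?perm1 // expgSr permM sA.
rewrite addr0 setCT setC0 (F1 (res x set0)) ?(G1 (res x set0)) ?tag_res ?cards0 //.
by rewrite !classf_resT // mulr1 mul1r.
Qed.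

(** * Averages *)

(** The average of [P] over Gamma_n. *)
Definition avg n (P : T -> C) : C := #|{: wreath gT n}|%:R^-1 * \sum_(x : wreath gT n) P (wr_elt x).

Lemma eq_avg n (P Q : T -> C) : (forall t, tag t = n -> P t = Q t) -> avg n P = avg n Q.
Proof. by move=> e; congr (_ * _); apply: eq_bigr => x _; rewrite e. Qed.

Lemma avg_scalel n a (P : T -> C) : avg n (fun t => a * P t) = a * avg n P.
Proof. by rewrite /avg -mulr_sumr mulrCA. Qed.
Lemma avg_scaler n a (P : T -> C) : avg n (fun t => P t * a) = avg n P * a.
Proof. by rewrite /avg -mulr_suml mulrA. Qed.
Lemma avg_sum n (I : Type) (r : seq I) (p : pred I) (P : I -> T -> C) :
  avg n (fun t => \sum_(i <- r | p i) P i t) = \sum_(i <- r | p i) avg n (P i).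
Proof. by rewrite /avg exchange_big mulr_sumr. Qed.

Lemma avg_exchange n m (P : T -> T -> C) :
  avg n (fun s => avg m (P s)) = avg m (fun t => avg n (P^~ t)).
Proof. by rewrite /avg -!mulr_sumr mulrCA exchange_big. Qed.
Lemma avg0 n (P : T -> C) : (forall t, tag t = n -> P t = 0) -> avg n P = 0.
Proof. by move=> P0; rewrite /avg big1 ?mulr0 // => x _; rewrite P0. Qed.

Lemma wreath_neq0 n : #|{: wreath gT n}|%:R != 0 :> C.
Proof. by rewrite pnatr_eq0 -lt0n; apply/card_gt0P; exists 1%g. Qed.

Lemma avg_induce n m (f : wreath gT n * wreath gT m -> C) :
  #|{: wreath gT (n + m)}|%:R^-1 * (\sum_x induce (@wr_embed gT n m) f x) =
  #|{: wreath gT n * wreath gT m}|%:R^-1 * \sum_p f p.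
Proof.
rewrite /induce -mulr_sumr mulrCA; congr (_ * _).
rewrite exchange_big /= (eq_bigr (fun=> \sum_p f p)) => [|g _].
  by rewrite sumr_const -[X in _ * X = _]mulr_natl mulKf // wreath_neq0.
rewrite (exchange_big_dep predT) //=; apply: eq_bigr => p _.
rewrite (big_pred1 (wr_embed p ^ g^-1)%g) // => x /=.
by apply/eqP/eqP => ->; rewrite ?conjgK ?conjgKV.
Qed.

(** The average of an induced function is the average of the function. *)
Lemma avg_conv2 N Phi : classf2 Phi ->
  avg N (conv2 Phi) = \sum_(k < N.+1) avg k (fun s => avg (N - k) (Phi s)).
Proof.
move=> cP.
have split_k n m : #|{: wreath gT (n + m)}|%:R^-1 *
    (\sum_(x : wreath gT (n + m)) \sum_(A | stab x A && (#|A| == n)) Phi (res x A) (res x (~: A))) =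
    avg n (fun s => avg m (Phi s)).
  under eq_bigr => x _ do rewrite -induce_stab //.
  rewrite avg_induce card_prod natrM invfM -mulrA; congr (_ * _).
  rewrite /avg /= -mulr_sumr; congr (_ * _).
  by rewrite pair_bigA.
have e (x : wreath gT N) : conv2 Phi (wr_elt x) = \sum_(k < N.+1) \sum_(A | stab x A && (#|A| == k))
    Phi (res x A) (res x (~: A)).
  rewrite /conv2 /= (partition_big (fun A : {set 'I_N} => inord #|A| : 'I_N.+1) predT) //=.
  apply: eq_bigr => k _; apply: eq_bigl => A; congr (_ && _).
  by rewrite -val_eqE /= inordK // ltnS -[X in (_ <= X)%N]card_ord max_card.
rewrite {1}/avg; under eq_bigr => x _ do rewrite e.
rewrite exchange_big mulr_sumr /=; apply: eq_bigr => -[k lek] _ /=.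
by have := subnKC (lek : (k <= N)%N); move: (N - k)%N => m; move=> <-; rewrite split_k.
Qed.

(** The component of degree [k]. *)
Definition cut (k : nat) (F : T -> C) (t : T) : C := if tag t == k then F t else 0.

Lemma classf_cut k F : classf F -> classf (cut k F).
Proof. by move=> cF n x y; rewrite /cut cF. Qed.

(** Inversion in each Gamma_n. *)
Definition invt (t : T) : T := wr_elt (tagged t)^-1%g.

Lemma invt_dsum s t : invt (dsum s t) = dsum (invt s) (invt t).
Proof. by rewrite /invt /dsum /= wr_embedV. Qed.

Lemma classf_invt S (F : T -> S) : classf F -> classf (fun t => F (invt t)).
Proof.
move=> cF n x y; rewrite -(cF _ (x^-1)%g y); congr (F (wr_elt _)).
exact: esym (conjVg x y).
Qed.

Lemma stabV n (x : wreath gT n) A : stab x^-1%g A = stab x A.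
Proof.
apply/stabP/stabP => sA i; first by rewrite -[in LHS]sA permK.
by rewrite -[in LHS]sA permKV.
Qed.

Lemma classf_resV S (F : T -> S) n (x : wreath gT n) A : classf F -> stab x A ->
  F (res x^-1%g A) = F (invt (res x A)).
Proof.
move=> cF /res_emb[h [y [-> hy im]]].
exact: (@classf_res S F _ _ _ _ _ _ cF (emb_inv hy) im).
Qed.

Lemma disjoint_imset (S S1 S2 : finType) (h1 : S1 -> S) (h2 : S2 -> S) :
  (forall i j, h1 i != h2 j) -> [disjoint h1 @: [set: S1] & h2 @: [set: S2]].
Proof.
move=> ne; apply/pred0P => i /=; apply/negP => /andP[/imsetP[j _ ->] /imsetP[k _ /eqP]].
by rewrite (negbTE (ne _ _)).
Qed.

Lemma classf_dsumA S (F : T -> S) a b c : classf F ->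
  F (dsum (dsum a b) c) = F (dsum a (dsum b c)).
Proof.
move=> cF; case: a b c => [n x] [m y] [l z]; rewrite /dsum /=; symmetry.
have e1 : emb (@lshift (n + m) l \o @lshift n m) x (wr_embed (wr_embed (x, y), z)).
  exact: emb_comp (emb_lshift _ _) (emb_lshift _ _).
have e2 : emb (@lshift (n + m) l \o @rshift n m) y (wr_embed (wr_embed (x, y), z)).
  exact: emb_comp (emb_rshift _ _) (emb_lshift _ _).
have e3 : emb (@rshift (n + m) l) z (wr_embed (wr_embed (x, y), z)) := emb_rshift _ _.
have d23 : [disjoint (@lshift (n + m) l \o @rshift n m) @: [set: 'I_m] &
    @rshift (n + m) l @: [set: 'I_l]].
  by apply: disjoint_imset => i j; rewrite eq_lrshift.
have d14 : [disjoint (@lshift (n + m) l \o @lshift n m) @: [set: 'I_n] &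
    copair (@lshift (n + m) l \o @rshift n m) (@rshift (n + m) l) @: [set: 'I_(m + l)]].
  apply: disjoint_imset => i j; case: (split_ordP j) => k ->.
    by rewrite copair_l /= (inj_eq (@lshift_inj _ _)) eq_lrshift.
  by rewrite copair_r /= eq_lrshift.
apply: (@classf_embT _ F _ _ _ _ _ cF (emb_copair e1 (emb_copair e2 e3 d23) d14)).
apply/setP => i; rewrite inE; apply/imsetP.
case: (split_ordP i) => j ->; last first.
  by exists (rshift n (rshift m j)); rewrite ?copair_r.
case: (split_ordP j) => k ->.
  by exists (lshift (m + l) k); rewrite ?copair_l.
by exists (rshift n (lshift l k)); rewrite ?copair_r ?copair_l.
Qed.

(** * Adjoint operators *)

(** Restriction of [f] to Gamma_n x Gamma_m, followed by the pairing with [P] on the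
    first factor, with weight [xi]. *)
Definition ann (xi : T -> C) n (P f : T -> C) (t : T) : C :=
  avg n (fun s => xi s * P s * f (dsum (invt s) t)).

Lemma conv_cut_tag (k l : nat) P Q t : tag t != (k + l)%N -> conv (cut k P) (cut l Q) t = 0.
Proof.
move=> ne; rewrite convE big1 // => A sA.
rewrite /cut !tag_res ?stabC //; case: eqP => [e1|_]; last by rewrite mul0r.
case: eqP => [e2|_]; last by rewrite mulr0.
by case/eqP: ne; rewrite -e1 -e2 cardsC card_ord.
Qed.

(** Composing two such operators amounts to taking the induction product of the
    functions, as a restriction to Gamma_l x Gamma_k x Gamma_m can be made in two
    steps. *)
Lemma ann_ann xi (k l : nat) P Q f t : multf xi -> classf P -> classf Q -> classf f ->
  ann xi k P (ann xi l Q f) t = ann xi (l + k) (conv (cut l Q) (cut k P)) f t.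
Proof.
move=> [cxi xi1 mxi] cP cQ cf.
pose Phi a b := xi a * cut l Q a * (xi b * cut k P b) * f (dsum (invt a) (dsum (invt b) t)).
have cfi : classf (fun s => f (dsum (invt s) t)).
  exact: (classf_invt (classf_dsum_l t cf)).
have c2 : classf2 Phi.
  split=> s n x y; rewrite /Phi !(classf_cut _ cP, classf_cut _ cQ, cxi); congr (_ * _).
    exact: (classf_invt (classf_dsum_l t (classf_dsum_r (invt s) cf))).
  exact: (classf_invt (classf_dsum_l (dsum (invt s) t) cf)).
have -> : ann xi (l + k) (conv (cut l Q) (cut k P)) f t = avg (l + k) (conv2 Phi).
  congr (_ * _); apply: eq_bigr => x _; rewrite convE /conv2 mulr_sumr mulr_suml.
  apply: eq_bigr => A /= sA; rewrite /Phi (multf_stab (And3 cxi xi1 mxi) sA).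
  rewrite mulrACA -classf_dsumA // -invt_dsum; congr (_ * _).
  exact: (classf_split cfi sA).
rewrite avg_conv2 // (bigD1 (inord l)) //= [X in _ + X]big1 ?addr0.
  rewrite inordK ?ltnS ?leq_addr // addKn /ann avg_exchange.
  under eq_avg => s es do rewrite -avg_scalel.
  apply: eq_avg => s es; apply: eq_avg => a ea.
  rewrite /Phi /cut es ea !eqxx !mulrA; congr (_ * _).
  by rewrite -mulrA mulrC !mulrA.
move=> i ne; apply: avg0 => a ea; apply: avg0 => b eb.
rewrite /Phi /cut ea ifN ?mulr0 ?mul0r //.
apply: contraNneq ne => e; apply/eqP/val_inj; rewrite /= inordK ?e //.
by rewrite ltnS leq_addr.
Qed.

(** The commutation relation between pairing with [P] and induction product with
    [Q]. A stable subset of a disjoint union is a pair of stable subsets; the part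
    of [Q] of degree [m] splits accordingly into a factor paired with [P] and a
    factor that stays. *)
Lemma ann_conv xi (n m : nat) P Q f t : multf xi -> multf P -> multf Q -> classf f ->
  ann xi n P (conv (cut m Q) f) t =
  \sum_(k < n.+1 | (k <= m)%N) avg k (fun s => xi s * P s * Q (invt s)) *
     conv (cut (m - k) Q) (ann xi (n - k) P f) t.
Proof.
move=> [cxi xi1 mxi] [cP P1 mP] [cQ Q1 mQ] cf.
pose Psi a := xi a * P a.
have mPsi : multf Psi by apply: multfM.
have [cPsi _ _] := mPsi.
pose Phi a b := Psi a * Psi b *
  \sum_(B | stab (tagged t) B)
     cut m Q (dsum (invt a) (res (tagged t) B)) *
     f (dsum (invt b) (res (tagged t) (~: B))).
have cmQ : classf (cut m Q) by apply: classf_cut.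
have c2 : classf2 Phi.
  split=> s k x y; rewrite /Phi cPsi; congr (_ * _); apply: eq_bigr => B _.
    by congr (_ * _); apply: (classf_invt (classf_dsum_l _ cf)).
  by congr (_ * _); apply: (classf_invt (classf_dsum_l _ cmQ)).
have -> : ann xi n P (conv (cut m Q) f) t = avg n (conv2 Phi).
  congr (_ * _); apply: eq_bigr => x _.
  rewrite /conv (conv2_dsum _ _ (classf2M cmQ cf)) /conv2 mulr_sumr /=.
  apply: eq_big => [A|A]; rewrite stabV // => sA; rewrite /Phi.
  rewrite -/(Psi _) (multf_stab mPsi sA); congr (_ * _); apply: eq_bigr => B _.
  congr (_ * _); first exact: (classf_resV (classf_dsum_l _ cmQ) sA).
  by apply: (classf_resV (classf_dsum_l _ cf)); rewrite stabC.
rewrite avg_conv2 // [RHS]big_mkcond /=; apply: eq_bigr => k _.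
case: leqP => [lekm|ltmk]; last first.
  apply: avg0 => a ea; apply: avg0 => b eb; rewrite /Phi big1 ?mulr0 // => B _.
  by rewrite /cut /= ea ifN ?mul0r // gtn_eqF // ltn_addr.
rewrite -avg_scaler; apply: eq_avg => a ea.
rewrite convE -mulrA -/(Psi a).
transitivity (Psi a * (Q (invt a) *
   avg (n - k) (fun b => \sum_(B | stab (tagged t) B) cut (m - k) Q (res (tagged t) B) *
     (Psi b * f (dsum (invt b) (res (tagged t) (~: B))))))).
  rewrite -!avg_scalel; apply: eq_avg => b eb; rewrite /Phi -mulrA; congr (_ * _).
  rewrite !mulr_sumr; apply: eq_bigr => B sB.
  have e : (#|B| == m - k)%N = (k + #|B| == m)%N by rewrite -(eqn_add2l k) subnKC.
  rewrite /cut /= ea tag_res // e.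
  case: ifP => _; last by rewrite !(mul0r, mulr0).
  by move: (Psi b) => p; rewrite mQ -!mulrA mulrCA; congr (_ * _); rewrite mulrCA.
rewrite avg_sum; congr (_ * (_ * _)); apply: eq_bigr => B _.
by rewrite avg_scalel.
Qed.

End ConvolutionProduct.
End Relabel.

(** * Graded pieces *)

Section Graded.
Variables (gT : finGroupType) (C : numClosedFieldType).
Local Notation T := (wr_all gT).

Lemma eq_conv (F F' G G' : T -> C) t :
  (forall s, (tag s <= tag t)%N -> F s = F' s) -> (forall s, (tag s <= tag t)%N -> G s = G' s) ->
  conv F G t = conv F' G' t.
Proof.
move=> eF eG; apply: eq_bigr => A sA.
have le (B : {set 'I_(tag t)}) : (#|B| <= tag t)%N by rewrite -[leqRHS]card_ord max_card.
by rewrite eF ?eG ?tag_res ?stabC.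
Qed.

Lemma conv_sumr (I : Type) (r : seq I) (P : pred I) (F : T -> C) (G : I -> T -> C) t :
  conv F (fun a => \sum_(i <- r | P i) G i a) t = \sum_(i <- r | P i) conv F (G i) t.
Proof. by rewrite convC conv_suml; apply: eq_bigr => i _; rewrite convC. Qed.

Lemma conv_scalel a (F G : T -> C) t : conv (fun s => a * F s) G t = a * conv F G t.
Proof. by rewrite !convE mulr_sumr; apply: eq_bigr => A _; rewrite mulrA. Qed.
Lemma sum_cut N (F : T -> C) t : (tag t < N)%N -> \sum_(k < N) cut k F t = F t.
Proof.
move=> lt; rewrite (bigD1 (Ordinal lt)) //= /cut eqxx big1 ?addr0 // => i ne.
by rewrite ifN //; apply: contraNneq ne => e; apply/eqP/val_inj.
Qed.

Lemma conv_cut (F G : T -> C) N t : tag t = N ->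
  conv F G t = \sum_(k < N.+1) conv (cut k F) (cut (N - k) G) t.
Proof.
move=> eN; transitivity (conv (fun s => \sum_(k < N.+1) cut k F s) G t).
  by apply: eq_conv => // s les; rewrite sum_cut // ltnS -eN.
rewrite conv_suml; apply: eq_bigr => k _; rewrite !convE; apply: eq_bigr => A sA.
rewrite /cut !tag_res ?stabC //; case: eqP => e; rewrite ?mul0r // ifT //.
by rewrite -(eqn_add2l #|A|) cardsC card_ord e subnKC ?eN // -ltnS.
Qed.

Lemma cut_conv (F G : T -> C) n t :
  cut n (conv F G) t = \sum_(k < n.+1) conv (cut k F) (cut (n - k) G) t.
Proof.
rewrite {1}/cut; case: eqP => [e|/eqP ne]; first exact: conv_cut.
by rewrite big1 // => k _; rewrite conv_cut_tag // subnKC // -ltnS.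
Qed.

(** The recursion satisfied by the graded pieces of a multiplicative function:
    a point of a permuted set determines the cycle that contains it. *)
Lemma multf_rec (F : T -> C) n t : multf F ->
  n%:R * cut n F t = \sum_(k < n.+1) conv (cut k (cycpart F)) (cut (n - k) F) t.
Proof.
move=> mF; rewrite -cut_conv /cut; case: eqP => [<-|]; last by rewrite mulr0.
by rewrite cycpart_conv.
Qed.

Lemma ind_prod_conv (F G : T -> C) n m t : classf F -> classf G ->
  ind_prod (fun x : wreath gT n => F (wr_elt x)) (fun x : wreath gT m => G (wr_elt x)) t =
  conv (cut n F) (cut m G) t.
Proof.
move=> cF cG; have [e|ne] := eqVneq (tag t) (n + m)%N; last first.
  by rewrite ind_prod_ne // conv_cut_tag.
case: t e => j x /= e; subst j; rewrite ind_prod_at.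
rewrite (induce_stab (Phi := fun a b => F a * G b)); last exact: classf2M.
rewrite convE big_mkcondr /=; apply: eq_bigr => A sA.
rewrite /cut !tag_res ?stabC //; case: eqP => e; rewrite ?mul0r // ifT //.
by rewrite -(eqn_add2l #|A|) cardsC card_ord e.
Qed.

Lemma RGam_classf (f : RGam C gT) : classf (f : T -> C).
Proof. by have /asboolP[] := rg_funP f. Qed.

Lemma createE (F : T -> C) n (f : RGam C gT) t : classf F ->
  create (fun x : wreath gT n => F (wr_elt x)) f t = conv (cut n F) f t.
Proof.
move=> cF; rewrite /= /create_fun.
have e m := @ind_prod_conv F f n m t cF (RGam_classf f).
rewrite (eq_bigr _ (fun m _ => e (nat_of_ord m))) -conv_sumr; apply: eq_conv => // s le.
by rewrite sum_cut.
Qed.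

End Graded.

(** * Traces of products of matrices *)

Section CycleProduct.
Variable C : numClosedFieldType.

(** The product [A (n-1) *m ... *m A 0]. *)
Fixpoint mxprod d (A : nat -> 'M[C]_d) n : 'M[C]_d :=
  if n is m.+1 then mxprod (fun k => A k.+1) m *m A 0%N else 1%:M.

Lemma big_tuple_recl d n (F : n.+1.-tuple 'I_d -> C) :
  \sum_t F t = \sum_(c : 'I_d) \sum_(t : n.-tuple 'I_d) F [tuple of c :: t].
Proof.
rewrite pair_big /= (reindex (fun p : 'I_d * n.-tuple 'I_d => [tuple of p.1 :: p.2])) //=.
exists (fun t : n.+1.-tuple 'I_d => (thead t, [tuple of behead t])).
  by move=> [c t] _ /=; congr (_, _); apply: val_inj.
by move=> t _ /=; rewrite -tuple_eta.
Qed.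

(** The walk that corresponds to [t] starts at [b], visits the entries of [t] and has
    to end at [a]. *)
Lemma mxprodE d n (A : nat -> 'M[C]_d) a b :
  mxprod A n a b = \sum_(t : n.-tuple 'I_d)
     (\prod_(k < n) A k (nth b (b :: t) k.+1) (nth b (b :: t) k)) * (a == nth b (b :: t) n)%:R.
Proof.
elim: n A b => [|n IH] A b /=.
  rewrite mxE (bigD1 [tuple]) //= big_ord0 mul1r big1 ?addr0 // => t.
  by rewrite [t]tuple0.
rewrite mxE big_tuple_recl; apply: eq_bigr => c _.
rewrite IH mulr_suml; apply: eq_bigr => t _.
rewrite big_ord_recl /= mulrC mulrA; congr (_ * _ * _%:R).
  apply: eq_bigr => k _; rewrite /bump /= !add1n.
  congr (A _ _ _); first by apply: set_nth_default; rewrite size_tuple.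
  by case: k => [[|k] /= lt] //; apply: set_nth_default; rewrite size_tuple ltnW.
congr (nat_of_bool (_ == _)); case: n t {IH} => [|n] t //=; apply: set_nth_default.
by rewrite size_tuple.
Qed.

(** A trace of a product of matrices is a sum over closed walks. *)
Lemma tr_mxprod d n (A : nat -> 'M[C]_d) (b0 : 'I_d) :
  \tr (mxprod A n.+1) = \sum_(t : n.+1.-tuple 'I_d)
     \prod_(k < n.+1) A k (nth b0 t k) (nth b0 (last b0 t :: t) k).
Proof.
rewrite /mxtrace; under eq_bigr => b _ do rewrite mxprodE.
rewrite exchange_big /=; apply: eq_bigr => t _.
have nE b k : (k < n.+1)%N -> nth b t k = nth b0 t k.
  by move=> lt; apply: set_nth_default; rewrite size_tuple.
have lE b : nth b t n = last b0 t by rewrite nE // (last_nth b0) size_tuple.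
rewrite (bigD1 (last b0 t)) //= [X in _ + X]big1 ?addr0 => [|b ne]; last first.
  by rewrite lE (negbTE ne) mulr0.
rewrite lE eqxx mulr1; apply: eq_bigr => k _.
congr (A _ _ _); first exact: nE.
by case: k => [[|k] /= lt] //; rewrite nE // ltnW.
Qed.

End CycleProduct.

(** * The characters eta and eps *)

Section EtaEps.
Variables (gT : finGroupType) (C : numClosedFieldType).
Local Notation T := (wr_all gT).

(** The trace on a tensor power, for matrices that need not be a representation. *)
Definition tens_tr d (M : gT -> 'M[C]_d) (t : T) : C :=
  \sum_(K : {ffun 'I_(tag t) -> 'I_d}) \prod_(i < tag t)
     M (wr_base (tagged t) i) (K i) (K (((wr_perm (tagged t))^-1)%g i)).

(** [eta_rep V] as a function on the union of the Gamma_n. *)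
Definition eta_repT (V : rep C gT) (t : T) : C := eta_rep V (tagged t).

Lemma eta_repE V t : eta_repT V t = tens_tr V t.
Proof.
rewrite /eta_repT /eta_rep /rep_char /mxtrace /tens_tr.
rewrite (reindex (@enum_rank {ffun 'I_(tag t) -> 'I_(rdegree V)})) /=; last first.
  by apply: onW_bij; exact: enum_rank_bij.
by apply: eq_bigr => K _; rewrite mxE /tens_idx enum_rankK.
Qed.

Lemma tens_tr_dsum d (M : gT -> 'M[C]_d) s t :
  tens_tr M (dsum s t) = tens_tr M s * tens_tr M t.
Proof.
case: s t => [n x] [m y]; rewrite /tens_tr /dsum /= mulr_suml.
under [RHS]eq_bigr => K _ do rewrite mulr_sumr.
rewrite pair_big /=.
pose f (p : {ffun 'I_n -> 'I_d} * {ffun 'I_m -> 'I_d}) : {ffun 'I_(n + m) -> 'I_d} :=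
  [ffun i => copair p.1 p.2 i].
rewrite (reindex f) /=; last first.
  exists (fun K : {ffun 'I_(n + m) -> 'I_d} =>
    ([ffun i => K (lshift m i)], [ffun i => K (rshift n i)])).
    move=> [K L] _; congr (_, _); apply/ffunP => i; rewrite !ffunE.
      by rewrite copair_l.
    by rewrite copair_r.
  move=> K _; apply/ffunP => i; rewrite ffunE.
  by case: (split_ordP i) => j ->; rewrite ?copair_l ?copair_r ffunE.
apply: eq_bigr => -[K L] _; rewrite big_split_ord /=; congr (_ * _).
  apply: eq_bigr => i _.
  by rewrite (wr_embed_l (x, y)) /= perm_sumV perm_sum_l !ffunE !copair_l.
apply: eq_bigr => i _.
by rewrite (wr_embed_r (x, y)) /= perm_sumV perm_sum_r !ffunE !copair_r.
Qed.

Lemma multf_eta_rep V : multf (eta_repT V).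
Proof.
split.
- move=> n x y; rewrite /eta_repT /eta_rep /rep_char /=.
  have rJ : tens_mx V (x ^ y)%g = tens_mx V y^-1%g *m (tens_mx V x *m tens_mx V y).
    by have /= := repr_mxM (tens_rep n V) => rMM; rewrite conjgE !rMM ?inE.
  rewrite rJ mxtrace_mulC -mulmxA.
  have /= rMM := repr_mxM (tens_rep n V); rewrite -rMM ?inE //.
  have /= r1 := repr_mx1 (tens_rep n V).
  by rewrite mulgV r1 mulmx1.
- case=> n x /= n0; subst n; rewrite eta_repE /tens_tr /=.
  rewrite (eq_bigr (fun=> 1)) => [|K _]; last by rewrite big_ord0.
  by rewrite sumr_const card_ffun !card_ord expn0.
- by move=> s t; rewrite !eta_repE tens_tr_dsum.
Qed.

(** The sign character of the permutation part. *)
Definition signT (t : T) : C := wr_sign C (tagged t).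

Lemma tperm_perm_sum_l n m (i j : 'I_n) :
  perm_sum (tperm i j) (1 : 'S_m) = tperm (lshift m i) (lshift m j).
Proof.
apply/permP => k; case: (split_ordP k) => k' ->.
  rewrite perm_sum_l; case: tpermP => [->|->|/eqP ni /eqP nj]; rewrite ?tpermL ?tpermR //.
  by rewrite tpermD // (inj_eq (@lshift_inj _ _)) eq_sym.
by rewrite perm_sum_r perm1 tpermD // eq_lrshift.
Qed.
Lemma tperm_perm_sum_r n m (i j : 'I_m) :
  perm_sum (1 : 'S_n) (tperm i j) = tperm (rshift n i) (rshift n j).
Proof.
apply/permP => k; case: (split_ordP k) => k' ->.
  by rewrite perm_sum_l perm1 tpermD // eq_rlshift.
rewrite perm_sum_r; case: tpermP => [->|->|/eqP ni /eqP nj]; rewrite ?tpermL ?tpermR //.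
by rewrite tpermD // (inj_eq (@rshift_inj _ _)) eq_sym.
Qed.

Lemma odd_perm_sum n m (s : 'S_n) (t : 'S_m) : perm_sum s t = odd_perm s (+) odd_perm t :> bool.
Proof.
have -> : perm_sum s t = (perm_sum s 1 * perm_sum 1 t)%g by rewrite -perm_sumM mulg1 mul1g.
rewrite odd_permM; congr (_ (+) _).
  have [ts -> _] := prod_tpermP s.
  elim: ts => [|p ts IH]; first by rewrite big_nil perm_sum1 !odd_perm1.
  rewrite big_cons -(mulg1 (1%g : 'S_m)) perm_sumM !odd_permM IH tperm_perm_sum_l !odd_tperm.
  by rewrite (inj_eq (@lshift_inj _ _)).
have [ts -> _] := prod_tpermP t.
elim: ts => [|p ts IH]; first by rewrite big_nil perm_sum1 !odd_perm1.
rewrite big_cons -(mulg1 (1%g : 'S_n)) perm_sumM !odd_permM IH tperm_perm_sum_r !odd_tperm.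
by rewrite (inj_eq (@rshift_inj _ _)).
Qed.

Lemma multf_sign : multf signT.
Proof.
split.
- move=> n x y; rewrite /signT /wr_sign /=; congr (_ ^+ _).
  by rewrite !odd_permM odd_permV addbC addbA addbb.
- case=> n x /= n0; subst n; rewrite /signT /wr_sign /=.
  have -> : wr_perm x = 1%g by apply/permP => -[].
  by rewrite odd_perm1.
- by move=> s t; rewrite /signT /wr_sign /= odd_perm_sum signr_addb.
Qed.

Lemma multf_degsign : multf (fun t : T => (-1) ^+ tag t : C).
Proof. by split=> [n x y|t ->|s t] //=; rewrite exprD. Qed.

Lemma signT_cycle t : iscycle t -> signT t = - (-1) ^+ tag t.
Proof.
case: t => n x /existsP[/= i /eqP oi]; rewrite /signT /wr_sign /= /odd_perm.
have -> : porbits (wr_perm x) = [set [set: 'I_n]].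
  apply/setP => A; rewrite inE; apply/imsetP/eqP => [[j _ ->]|->]; last by exists i.
  by apply/eqP; rewrite -oi eq_porbit_mem oi inE.
by rewrite cards1 card_ord addbT signrN signr_odd.
Qed.

(** [eta a] and [eps a] as functions on the union of the Gamma_n. *)
Definition etaT (a : RZ C gT) (t : T) : C := eta a (tagged t).
Definition epsvT (a : RZ C gT) (t : T) : C := eps a (tagged t).

(** The definition of eta on virtual characters is an induction product of two
    multiplicative functions. *)
Lemma etaE a : etaT a = conv (eta_repT (pos_rep a))
   (fun t => (-1) ^+ tag t * (eta_repT (neg_rep a) t * signT t)).
Proof.
apply/funext => -[n x]; rewrite convC (conv_cut _ _ (erefl : tag (wr_elt x) = n)).
rewrite /etaT /eta /=; apply: eq_bigr => m _.
have [cp _ _] := multf_eta_rep (pos_rep a).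
have [ce _ _] := multfM (multf_eta_rep (neg_rep a)) multf_sign.
have := ind_prod_conv (n - m) m (wr_elt x) cp ce; rewrite /eta_repT /signT /= => ->.
rewrite convC -conv_scalel; apply: eq_conv => // s _.
by rewrite /cut; case: eqP => [<-|]; rewrite ?mulr0.
Qed.

Lemma multf_eta a : multf (etaT a).
Proof.
rewrite etaE; apply: multf_conv; first exact: multf_eta_rep.
apply: multfM; first exact: multf_degsign.
by apply: multfM; [exact: multf_eta_rep | exact: multf_sign].
Qed.

Lemma multf_eps a : multf (epsvT a).
Proof. exact: multfM (multf_eta a) multf_sign. Qed.

Lemma eta_cycle a t : iscycle t ->
  etaT a t = eta_repT (pos_rep a) t - eta_repT (neg_rep a) t.
Proof.
move=> ct; rewrite etaE conv_cycle //; last 2 first.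
- exact: multf_eta_rep.
- apply: multfM; first exact: multf_degsign.
  by apply: multfM; [exact: multf_eta_rep | exact: multf_sign].
congr (_ + _); rewrite signT_cycle // mulrCA mulrN -signr_odd mulrN.
by rewrite -signr_addb addbb mulr1.
Qed.

End EtaEps.

(** * Values on cycles *)

Section CycleValues.
Variables (gT : finGroupType) (C : numClosedFieldType).
Local Notation T := (wr_all gT).

(** The product of the entries of [x] along the orbit of [i], with the entry at [i]
    last. It is used when this orbit contains all the indices. *)
Definition cycprod n (x : wreath gT n) (i : 'I_n) : gT :=
  (\prod_(j <- rev (traject (wr_perm x) i n)) wr_base x j)%g.

(** On a cycle, the indices of a tensor form a closed walk along the cycle. *)
Lemma tens_tr_cycle d (M : gT -> 'M[C]_d) n (x : wreath gT n) i1 :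
  porbit (wr_perm x) i1 = [set: 'I_n] ->
  tens_tr M (wr_elt x) = \tr (mxprod (fun k => M (wr_base x (iter k (wr_perm x) i1))) n).
Proof.
case: d M => [|d] M oi.
  rewrite /mxtrace big_ord0 /tens_tr big1 // => K _.
  by case: (K i1) => j; rewrite ltn0.
case: n x i1 oi => [x [//]|m x i1 oi]; set s := wr_perm x.
have cn : #|porbit s i1| = m.+1 by rewrite oi cardsT card_ord.
pose e (k : 'I_m.+1) := iter k s i1.
have e_inj : injective e.
  move=> k l ekl; apply/val_inj/eqP.
  have := uniq_traject_porbit s i1; rewrite cn => u.
  have nE (j : 'I_m.+1) : nth i1 (traject s i1 m.+1) j = e j by rewrite nth_traject.
  have sz (j : 'I_m.+1) : (j < size (traject s i1 m.+1))%N by rewrite size_traject.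
  by rewrite -(nth_uniq i1 (sz k) (sz l) u) !nE ekl.
pose p := perm e_inj.
have pE (k : 'I_m.+1) : p k = iter k s i1 by rewrite permE.
have itn : iter m.+1 s i1 = i1 by have := iter_porbit s i1; rewrite cn.
rewrite (tr_mxprod _ _ ord0) /tens_tr /=.
rewrite (reindex (fun t : m.+1.-tuple 'I_d.+1 => [ffun i => tnth t (p^-1%g i)])) /=; last first.
  exists (fun K : {ffun 'I_m.+1 -> 'I_d.+1} => [tuple K (p k) | k < m.+1]).
    by move=> t _; apply: eq_from_tnth => k; rewrite tnth_mktuple ffunE permK.
  by move=> K _; apply/ffunP => i; rewrite ffunE tnth_mktuple permKV.
apply: eq_bigr => t _; rewrite (reindex_inj (@perm_inj _ p)) /=.
apply: eq_bigr => k _; rewrite !ffunE permK pE (tnth_nth ord0); congr (M _ _ _).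
case: k => [[|k] lt] /=.
  rewrite (_ : (s^-1)%g i1 = p ord_max) ?permK ?(tnth_nth ord0).
    by rewrite (last_nth ord0) size_tuple.
  by apply: (@perm_inj _ s); rewrite permKV pE /= -iterS itn.
have ltk : (k < m.+1)%N by rewrite ltnW.
by rewrite permK -[iter k s i1]/(iter (Ordinal ltk) s i1) -pE permK (tnth_nth ord0).
Qed.

Lemma mxprod_rep (V : rep C gT) n (s : 'S_n) (g : 'I_n -> gT) m i :
  mxprod (fun k => V (g (iter k s i))) m = V (\prod_(j <- rev (traject s i m)) g j)%g.
Proof.
elim: m i => [|m IH] i /=; first by rewrite big_nil repr_mx1.
rewrite rev_cons big_rcons /= repr_mxM ?inE // -IH; congr (mxprod _ m *m _).
by apply/funext => k; rewrite -iterSr.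
Qed.

Lemma mxprod_dual (V : rep C gT) n (s : 'S_n) (g : 'I_n -> gT) m i :
  mxprod (fun k => (V (g (iter k s i))^-1%g)^T) m =
  (V (\prod_(j <- rev (traject s i m)) g j)^-1%g)^T.
Proof.
elim: m i => [|m IH] i /=; first by rewrite big_nil invg1 repr_mx1 trmx1.
rewrite rev_cons big_rcons /= invMg repr_mxM ?inE // trmx_mul -IH.
by congr (mxprod _ m *m _); apply/funext => k; rewrite -iterSr.
Qed.

(** The trace at the inverse is the trace on the tensor power of the dual representation. *)
Lemma eta_rep_inv (V : rep C gT) t :
  eta_repT V (invt t) = tens_tr (fun g => (V g^-1%g)^T) t.
Proof.
rewrite eta_repE; case: t => n x; rewrite /tens_tr /=; apply: eq_bigr => K _.
rewrite [RHS](reindex_inj (@perm_inj _ (wr_perm x))) /=; apply: eq_bigr => i _.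
by rewrite mxE ffunE permK invgK.
Qed.

Lemma eta_rep_cycle (V : rep C gT) n (x : wreath gT n) i :
  porbit (wr_perm x) i = [set: 'I_n] ->
  eta_repT V (wr_elt x) = rep_char V (cycprod x i).
Proof. by move=> oi; rewrite eta_repE (tens_tr_cycle _ oi) mxprod_rep. Qed.

Lemma eta_rep_cycleV (V : rep C gT) n (x : wreath gT n) i :
  porbit (wr_perm x) i = [set: 'I_n] ->
  eta_repT V (invt (wr_elt x)) = rep_char V (cycprod x i)^-1%g.
Proof. by move=> oi; rewrite eta_rep_inv (tens_tr_cycle _ oi) mxprod_dual mxtrace_tr. Qed.

Lemma eta_cycprod (a : RZ C gT) n (x : wreath gT n) i :
  porbit (wr_perm x) i = [set: 'I_n] -> etaT a (wr_elt x) = vchar a (cycprod x i).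
Proof.
move=> oi; rewrite eta_cycle ?vchar_pos_neg ?(eta_rep_cycle _ oi) //.
by apply/existsP; exists i; apply/eqP.
Qed.

Lemma eta_cycprodV (a : RZ C gT) n (x : wreath gT n) i :
  porbit (wr_perm x) i = [set: 'I_n] ->
  etaT a (invt (wr_elt x)) = vchar a (cycprod x i)^-1%g.
Proof.
move=> oi; rewrite eta_cycle ?vchar_pos_neg ?(eta_rep_cycleV _ oi) //.
by apply/existsP; exists i; rewrite /= porbitV; apply/eqP.
Qed.

(** [sigma] as a function on the union of the Gamma_n. *)
Definition sigmaT (a : gT -> C) (t : T) : C := sigma a (tagged t).

(** Case analysis on whether [x] is a cycle; the starting point [i] chosen by [sigma]
    is only known to generate the full cycle. *)
Variant sigma_spec (a : gT -> C) n (x : wreath gT n) : bool -> C -> Type :=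
| SigmaCycle i of porbit (wr_perm x) i = [set: 'I_n] :
    sigma_spec a x true (n%:R * a (cycprod x i))
| SigmaOther : sigma_spec a x false 0.

Lemma sigmaP a n (x : wreath gT n) : sigma_spec a x (iscycle (wr_elt x)) (sigma a x).
Proof.
rewrite /sigma /iscycle; case: pickP => [i|no].
  move=> oi; have -> : [exists i, porbit (wr_perm x) i == [set: 'I_n]] by apply/existsP; exists i.
  by apply: SigmaCycle; apply/eqP.
have -> : [exists i, porbit (wr_perm x) i == [set: 'I_n]] = false.
  by apply/existsP => -[ i]; rewrite no.
exact: SigmaOther.
Qed.

(** The Heisenberg class functions are the cycle parts of eta and, up to sign, of eps. *)
Lemma cycpart_eta (a : RZ C gT) : cycpart (etaT a) = sigmaT (vchar a).
Proof.
apply/funext => -[n x]; rewrite /cycpart /sigmaT /=; case: sigmaP => // i oi.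
by rewrite (eta_cycprod _ oi).
Qed.

Lemma cycpart_eps (a : RZ C gT) t :
  cycpart (epsvT a) t = - (-1) ^+ tag t * sigmaT (vchar a) t.
Proof.
rewrite -cycpart_eta /cycpart; case: ifP => ct; last by rewrite mulr0.
by rewrite [RHS]mulrCA [_ * etaT a t]mulrC -(signT_cycle C ct).
Qed.

Lemma classf_sigma (a : RZ C gT) : classf (sigmaT (vchar a)).
Proof. by rewrite -cycpart_eta; apply: classf_cycpart; case: (multf_eta a). Qed.

(** * Averages over cycles *)

Lemma multf_invt (F : T -> C) : multf F -> multf (fun t => F (invt t)).
Proof.
move=> [cF F1 mF]; split; first exact: classf_invt.
  by move=> t t0; rewrite F1.
by move=> s t; rewrite invt_dsum mF.
Qed.

(** The recursion [cycpart_conv], averaged over Gamma_k. *)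
Lemma avg_rec (M : T -> C) k : multf M ->
  k%:R * avg k M = \sum_(j < k.+1) avg j (cycpart M) * avg (k - j) M.
Proof.
move=> mM; have [cM _ _] := mM.
rewrite -avg_scalel (@eq_avg _ _ _ _ (conv (cycpart M) M)); last first.
  by move=> t <-; rewrite cycpart_conv.
rewrite /conv avg_conv2; last by apply: classf2M => //; apply: classf_cycpart.
apply: eq_bigr => j _; rewrite -avg_scaler; apply: eq_avg => t _.
by rewrite avg_scalel.
Qed.

Lemma multf1 : multf (fun _ : T => 1 : C).
Proof. by split=> // s t; rewrite mulr1. Qed.

Lemma avg1 k : avg k (fun _ : T => 1 : C) = 1.
Proof. by rewrite /avg sumr_const -[X in _ * X]mulr_natl mulr1 mulVf // wreath_neq0. Qed.

(** The proportion of cycles in Gamma_k is 1/k. Instead of counting them, the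
    recursion is applied to the constant function 1: k is the sum of these
    averages over the degrees at most k. *)
Lemma avg_cycpart1 k : (0 < k)%N -> avg k (cycpart (fun _ : T => 1 : C)) = 1.
Proof.
case: k => // k _; have e m : m%:R = \sum_(j < m.+1) avg j (cycpart (fun _ : T => 1 : C)).
  have := avg_rec m multf1; rewrite {1}avg1 mulr1 => ->; apply: eq_bigr => j _.
  by rewrite avg1 mulr1.
have := e k.+1; rewrite big_ord_recr /= -e -natr1.
by move/addrI.
Qed.

Lemma cycpart1 : cycpart (fun _ : T => 1 : C) = sigmaT (fun=> 1).
Proof. by apply/funext => -[n x]; rewrite /cycpart /sigmaT /=; case: sigmaP. Qed.

(** Multiplication by [h] of the entry of [x] at the starting point used by [sigma]. *)
Definition cyc_shift n (h : gT) (x : wreath gT n) : wreath gT n :=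
  Wreath [ffun i => if Some i == [pick i : 'I_n | porbit (wr_perm x) i == [set: 'I_n]]
                    then (wr_base x i * h)%g else wr_base x i] (wr_perm x).

Lemma cyc_shiftK n h : cancel (@cyc_shift n h) (cyc_shift h^-1%g).
Proof.
move=> x; apply: wr_eq => [i|] //=; rewrite !ffunE.
by case: eqP => // _; rewrite mulgK.
Qed.

Lemma sigma_shift (a : gT -> C) n h (x : wreath gT n) :
  sigma a (cyc_shift h x) = sigma (fun g => a (g * h)%g) x.
Proof.
rewrite /cyc_shift /sigma /=; case ep: [pick i | _] => [i1|] //.
congr (_ * a _); have oi : porbit (wr_perm x) i1 = [set: 'I_n].
  by case: pickP ep => // i /eqP oi [<-].
have cn : #|porbit (wr_perm x) i1| = n by rewrite oi cardsT card_ord.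
have := uniq_traject_porbit (wr_perm x) i1; rewrite cn.
case: n x i1 ep oi cn => [x [//]|n x i1 ep oi cn] /= /andP[ni _].
rewrite rev_cons !big_rcons /= ffunE eqxx mulgA; congr (_ * _ * _)%g.
rewrite !big_seq; apply: eq_bigr => j; rewrite mem_rev => jt.
by rewrite ffunE ifN //; apply: contraNneq ni => -[e]; rewrite -{1}e.
Qed.

Lemma avg_sigma (a : gT -> C) n : (0 < n)%N ->
  avg n (sigmaT a) = #|gT|%:R^-1 * \sum_g a g.
Proof.
move=> n0; have cg : #|gT|%:R != 0 :> C.
  by rewrite pnatr_eq0 -lt0n; apply/card_gt0P; exists 1%g.
apply: (mulfI cg); rewrite mulVKf //.
(* The translates of [a] by all [h] add up to a constant, and translating [a]
   permutes the elements of Gamma_n, so [a] may be replaced by its mean. *)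
transitivity (avg n (fun t => sigmaT (fun=> 1) t * \sum_g a g)); last first.
  by rewrite avg_scaler -cycpart1 avg_cycpart1 // mul1r.
rewrite /avg mulrCA; congr (_ * _).
rewrite mulr_natl -sumr_const /=.
transitivity (\sum_(h : gT) \sum_(x : wreath gT n) sigma (fun g => a (g * h)%g) x).
  apply: eq_bigr => h _; rewrite (reindex_inj (can_inj (@cyc_shiftK n h))) /=.
  by apply: eq_bigr => x _; rewrite /sigmaT /= sigma_shift.
rewrite exchange_big /=; apply: eq_bigr => x _; rewrite /sigmaT /= /sigma.
case: pickP => [i1 _|_]; last by rewrite mul0r big1.
rewrite mulr1 -mulr_sumr; congr (_ * _).
by rewrite [RHS](reindex_inj (mulgI (cycprod x i1))).
Qed.

End CycleValues.

(** * The weighted pairing *)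

Section Pairing.
Variables (gT : finGroupType) (C : numClosedFieldType).
Local Notation T := (wr_all gT).

Lemma tr_idempotent d (P : 'M[C]_d) : P *m P = P -> \tr P = (\rank P)%:R.
Proof.
move=> PP; have e := mulmx_base P.
have fr := row_base_free P; have fc := col_base_full P.
move: (row_base P) (col_base P) fr fc e => X Y fr fc e.
have rc : X *m Y = 1%:M.
  apply: (row_free_inj fr); apply: (row_full_inj fc).
  by rewrite /= mul1mx !mulmxA e -mulmxA e PP.
by rewrite -[in LHS]e mxtrace_mulC rc mxtrace1.
Qed.

(** The average of a representation is an idempotent matrix, the projector onto the
    invariants, so the average of the trace is its rank. *)
Lemma mean_trace_nat d (rho : gT -> 'M[C]_d) : {morph rho : x y / (x * y)%g >-> x *m y} ->
  exists n : nat, #|gT|%:R^-1 * (\sum_x \tr (rho x)) = n%:R.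
Proof.
move=> rM; have cg : #|gT|%:R != 0 :> C.
  by rewrite pnatr_eq0 -lt0n; apply/card_gt0P; exists 1%g.
pose P := #|gT|%:R^-1 *: \sum_x rho x.
have rP x : rho x *m P = P.
  rewrite -scalemxAr; congr (_ *: _); rewrite mulmx_sumr [RHS](reindex_inj (mulgI x)).
  by apply: eq_bigr => y _; rewrite rM.
exists (\rank P); rewrite -tr_idempotent; last first.
  rewrite -scalemxAl mulmx_suml (eq_bigr (fun=> P)) => [|x _]; last exact: rP.
  by rewrite sumr_const -scaler_nat scalerA mulVf // scale1r.
by rewrite mxtraceZ; congr (_ * _); rewrite raddf_sum.
Qed.

Lemma mxtrace_tens m n (A : 'M[C]_m) (B : 'M[C]_n) : \tr (A *t B) = \tr A * \tr B.
Proof.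
rewrite /mxtrace mulr_suml (eq_bigr _ (fun i _ => mulr_sumr _ _ _ _)) pair_big /=.
rewrite (reindex (@mxtens_index m n)) /=; last first.
  by apply: onW_bij; exists (@mxtens_unindex m n);
    [exact: mxtens_indexK | exact: mxtens_unindexK].
by apply: eq_bigr => -[i j] _; rewrite tensmxE.
Qed.

(** The representation is U (x) V (x) W^*. *)
Lemma mean_triple_nat (U V W : rep C gT) :
  exists n : nat, gform (fun x => rep_char U x * rep_char V x) (rep_char W) = n%:R.
Proof.
have [|n e] := @mean_trace_nat _ (fun x => U x *t V x *t (W x^-1%g)^T).
  move=> x y /=; rewrite invMg !repr_mxM ?inE // trmx_mul.
  by rewrite !tensmx_mul.
exists n; rewrite -e; congr (_ * _); apply: eq_bigr => x _.
by rewrite !mxtrace_tens mxtrace_tr.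
Qed.

Lemma wform_int (xi a b : RZ C gT) : exists k : int, k%:~R = wform xi a b.
Proof.
pose isint (z : C) := exists k : int, k%:~R = z.
have iD y z : isint y -> isint z -> isint (y + z).
  by move=> [k <-] [l <-]; exists (k + l); rewrite rmorphD.
have iM y z : isint y -> isint z -> isint (y * z).
  by move=> [k <-] [l <-]; exists (k * l); rewrite rmorphM.
have e : wform xi a b = \sum_i \sum_j \sum_k
   (xi i)%:~R * (a j)%:~R * (b k)%:~R *
   gform (fun x => \tr (irr_repr i x) * \tr (irr_repr j x))
         (fun x => \tr (irr_repr k x)).
  rewrite /wform /gform.
  under eq_bigr => x _ do rewrite /vchar mulr_suml mulr_suml.
  rewrite exchange_big mulr_sumr; apply: eq_bigr => i _ /=.
  under eq_bigr => x _ do rewrite -mulrA mulrCA mulr_suml.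
  rewrite exchange_big mulr_sumr; apply: eq_bigr => j _ /=.
  under eq_bigr => x _ do rewrite mulrA mulr_sumr.
  rewrite exchange_big mulr_sumr; apply: eq_bigr => k _ /=.
  rewrite [RHS]mulrCA [in RHS]mulr_sumr; congr (_ * _); apply: eq_bigr => x _.
  ring.
rewrite -/(isint _) e.
have i0 : isint 0 by exists 0.
apply: (big_ind isint) => // i _; apply: (big_ind isint) => // j _.
apply: (big_ind isint) => // k _; apply: iM.
  by exists (xi i * a j * b k); rewrite !rmorphM.
have [n en] := mean_triple_nat (Representation (irr_repr i))
  (Representation (irr_repr j)) (Representation (irr_repr k)).
by exists n%:Z; apply: esym; exact: en.
Qed.

Lemma iformE (xi a b : RZ C gT) : (iform xi a b)%:~R = wform xi a b.
Proof.
rewrite /iform; have [k e] := wform_int xi a b.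
exact: (@classical_sets.xgetPex _ 0 (fun k : int => k%:~R = wform xi a b) (ex_intro _ k e)).
Qed.

Lemma vcharD (a b : RZ C gT) x : vchar (a + b) x = vchar a x + vchar b x.
Proof.
by rewrite /vchar -big_split /=; apply: eq_bigr => i _; rewrite ffunE rmorphD mulrDl.
Qed.

Lemma iformDr (xi a b c : RZ C gT) : iform xi a (b + c) = iform xi a b + iform xi a c.
Proof.
apply: (@intr_inj C); rewrite rmorphD /= !iformE /wform /gform -mulrDr -big_split /=.
by congr (_ * _); apply: eq_bigr => x _; rewrite vcharD mulrDr.
Qed.

(** The weighted pairing of eps_k(a) with eta_k(b). *)
Definition pnum (xi a b : RZ C gT) k : C :=
  avg k (fun s => etaT xi s * epsvT a s * etaT b (invt s)).

Lemma multf_pair (xi a b : RZ C gT) :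
  multf (fun s => etaT xi s * epsvT a s * etaT b (invt s)).
Proof.
apply: multfM; last exact/multf_invt/multf_eta.
by apply: multfM; [exact: multf_eta | exact: multf_eps].
Qed.

Lemma avg_cycpart_pair (xi a b : RZ C gT) k : (0 < k)%N ->
  avg k (cycpart (fun s => etaT xi s * epsvT a s * etaT b (invt s))) =
  - (-1) ^+ k * (iform xi a b)%:~R.
Proof.
move=> k0; rewrite iformE /wform /gform.
rewrite -(avg_sigma (fun x => vchar xi x * vchar a x * vchar b x^-1%g) k0) -avg_scalel.
apply: eq_avg => -[n x] /= <- {k k0}; rewrite /cycpart /sigmaT /=.
case: sigmaP => [i oi|]; last by rewrite mulr0.
rewrite (eta_cycprod _ oi) (eta_cycprodV _ oi).
have -> : epsvT a (wr_elt x) = vchar a (cycprod x i) * - (-1) ^+ n.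
  rewrite -(eta_cycprod _ oi) -[n in RHS]/(tag (wr_elt x)) -(signT_cycle C) //.
  by apply/existsP; exists i; apply/eqP.
rewrite [RHS]mulrCA; congr (_ * _).
by rewrite mulrA [RHS]mulrC mulrAC.
Qed.

Lemma pnum0 (xi a b : RZ C gT) : pnum xi a b 0 = 1.
Proof.
have [_ M1 _] := multf_pair xi a b.
rewrite /pnum -[RHS](avg1 gT C 0); apply: eq_avg => t t0; exact: M1.
Qed.

Lemma pnum_rec (xi a b : RZ C gT) k :
  k.+1%:R * pnum xi a b k.+1 = ((iform xi a b)%:~R - k%:R) * pnum xi a b k.
Proof.
set w := _%:~R.
have r m : m.+1%:R * pnum xi a b m.+1 = \sum_(j < m.+1) (-1) ^+ j * w * pnum xi a b (m - j).
  rewrite /pnum avg_rec; last exact: multf_pair.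
  rewrite big_ord_recl /= [X in X * _]avg0 ?mul0r ?add0r; last first.
    by move=> t t0; rewrite /cycpart t0 mul0r if_same.
  apply: eq_bigr => j _; rewrite avg_cycpart_pair // /bump /= add1n subSS.
  by rewrite exprS mulN1r opprK.
rewrite r; case: k => [|k].
  by rewrite big_ord_recl big_ord0 addr0 subr0 mul1r.
rewrite big_ord_recl /= expr0 mul1r subn0 mulrBl; congr (_ + _).
rewrite r -sumrN; apply: eq_bigr => j _.
by rewrite /bump /= add1n subSS exprS mulN1r !mulNr.
Qed.

Lemma pnumE (xi a b : RZ C gT) k : pnum xi a b k = gbinom C (iform xi a b) k.
Proof.
rewrite /gbinom; elim: k => [|k IH]; first by rewrite pnum0 big_ord0 fact0 divr1.
have k0 : k.+1%:R != 0 :> C by rewrite pnatr_eq0.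
apply: (mulfI k0); rewrite pnum_rec IH big_ord_recr /= factS natrM invfM.
rewrite [RHS]mulrCA [k.+1%:R * _]mulVKf // mulrA; congr (_ / _).
by rewrite mulrC rmorphB.
Qed.

End Pairing.

(** * Operators on the space of class functions *)

Section Operators.
Variables (gT : finGroupType) (C : numClosedFieldType) (xi : RZ C gT).
Local Notation T := (wr_all gT).
Local Notation V := (RGam C gT).

(** The operators H_(-n)(a) and a_(-n)(a) on R_Gamma. *)
Definition Hop (a : RZ C gT) n : V -> V := create (@eta C gT a n).
Definition Aneg (a : RZ C gT) n : V -> V := create (@sigma C gT (vchar a) n).
(** The coefficient of z^(-n) in E_-(a, z); it includes the sign (-1)^n. *)
Definition Eop (a : RZ C gT) n (f : V) : V := (-1) ^+ n *: annih xi (@eps C gT a n) f.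
(** The operator a_n(a). *)
Definition Apos (a : RZ C gT) n : V -> V := annih xi (@sigma C gT (vchar a) n).

Lemma RGam_eq (f g : V) : (f : T -> C) =1 g -> f = g.
Proof. by move=> e; apply/val_inj/funext. Qed.

Lemma RGam_sum (I : Type) (r : seq I) (P : pred I) (F : I -> V) (t : T) :
  (\sum_(i <- r | P i) F i : V) t = \sum_(i <- r | P i) F i t.
Proof. by elim/big_rec2: _ => // i y1 y2 _ <-. Qed.

Lemma HopE a n f : (Hop a n f : T -> C) = conv (cut n (etaT a)) f.
Proof. by apply/funext => t; apply: (createE (F := etaT a)); case: (multf_eta a). Qed.
Lemma AnegE a n f : (Aneg a n f : T -> C) = conv (cut n (sigmaT (vchar a))) f.
Proof. by apply/funext => t; apply: (createE (F := sigmaT (vchar a))); apply: classf_sigma. Qed.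
Lemma EopE a n f t : Eop a n f t = (-1) ^+ n * ann (etaT xi) n (epsvT a) f t.
Proof. by []. Qed.
Lemma AposE a n f : (Apos a n f : T -> C) = ann (etaT xi) n (sigmaT (vchar a)) f.
Proof. by []. Qed.

Lemma Hop_linear a n : linear (Hop a n).
Proof. exact: create_is_linear. Qed.
Lemma Apos_linear a n : linear (Apos a n).
Proof. exact: annih_is_linear. Qed.
Lemma Eop_linear a n : linear (Eop a n).
Proof. by move=> k f g; rewrite /Eop linearP scalerDr !scalerA mulrC. Qed.

Lemma classf_eta a : classf (@etaT gT C a).
Proof. by case: (multf_eta a). Qed.
Lemma classf_eps a : classf (@epsvT gT C a).
Proof. by case: (multf_eps a). Qed.

Lemma convCA (F G H : T -> C) : classf F -> classf G -> classf H ->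
  conv F (conv G H) = conv G (conv F H).
Proof. by move=> cF cG cH; rewrite !convA // (convC F). Qed.

Lemma AnegC a b m n f : Aneg a m (Aneg b n f) = Aneg b n (Aneg a m f).
Proof.
apply: RGam_eq => t; rewrite (AnegE a m) (AnegE b n) (AnegE b n (Aneg a m f)) (AnegE a m f).
have e := convCA (classf_cut m (@classf_sigma _ C a)) (classf_cut n (@classf_sigma _ C b))
  (RGam_classf f).
exact: (congr1 (fun F => F t) e).
Qed.

Lemma Aneg_HopC a b m n f : Aneg a m (Hop b n f) = Hop b n (Aneg a m f).
Proof.
apply: RGam_eq => t; rewrite (AnegE a m) (HopE b n) (HopE b n (Aneg a m f)) (AnegE a m f).
have e := convCA (classf_cut m (@classf_sigma _ C a)) (classf_cut n (@classf_eta b))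
  (RGam_classf f).
exact: (congr1 (fun F => F t) e).
Qed.

(** Newton's relation between complete functions and power sums. *)
Lemma Hop_rec a n f : n%:R *: Hop a n f = \sum_(k < n.+1) Aneg a k (Hop a (n - k) f).
Proof.
have cf := RGam_classf f; apply: RGam_eq => t; rewrite RGam_sum.
rewrite -[LHS]/(n%:R * Hop a n f t) HopE -conv_scalel.
have -> : (fun s => n%:R * cut n (etaT a) s) = _ := funext (fun s => multf_rec n s (multf_eta a)).
rewrite conv_suml; apply: eq_bigr => k _; rewrite (AnegE a k) (HopE a (n - k)) cycpart_eta.
have e := convA (classf_cut k (@classf_sigma _ C a)) (classf_cut (n - k) (@classf_eta a)) cf.
exact: (congr1 (fun F => F t) (esym e)).
Qed.

Lemma Hop0 a f : Hop a 0 f = f.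
Proof.
have cf := RGam_classf f; apply: RGam_eq => -[n x]; rewrite HopE convE.
have [ce e1 _] := multf_eta a.
rewrite (bigD1 set0) /=; last by rewrite -(setCT 'I_n) stabC stabT.
have s0 : stab x set0 by rewrite -(setCT 'I_n) stabC stabT.
rewrite big1 ?addr0 => [|A /andP[sA ne]]; last first.
  by rewrite /cut tag_res // cards_eq0 (negbTE ne) mul0r.
by rewrite /cut tag_res // cards0 eqxx e1 ?tag_res ?cards0 // mul1r setC0 classf_resT.
Qed.

Lemma annC k l P Q (f : T -> C) t : classf P -> classf Q -> classf f ->
  ann (etaT xi) k P (ann (etaT xi) l Q f) t = ann (etaT xi) l Q (ann (etaT xi) k P f) t.
Proof.
move=> cP cQ cf; have mx := multf_eta xi.
by rewrite ann_ann // [RHS]ann_ann // convC addnC.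
Qed.

Lemma eq_ann n (P Q f : T -> C) t : (forall s, tag s = n -> P s = Q s) ->
  ann (etaT xi) n P f t = ann (etaT xi) n Q f t.
Proof. by move=> e; apply: eq_avg => s es; rewrite e. Qed.

Lemma annZ c n (P f : T -> C) t :
  ann (etaT xi) n (fun s => c * P s) f t = c * ann (etaT xi) n P f t.
Proof.
rewrite -avg_scalel; apply: eq_avg => s _; by rewrite mulrCA !mulrA.
Qed.

Lemma ann_suml (I : Type) (r : seq I) (p : pred I) (P : I -> T -> C) n (f : T -> C) t :
  ann (etaT xi) n (fun s => \sum_(i <- r | p i) P i s) f t =
  \sum_(i <- r | p i) ann (etaT xi) n (P i) f t.
Proof.
rewrite -avg_sum; apply: eq_avg => s _; by rewrite mulr_sumr mulr_suml.
Qed.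

Lemma Apos_C a b m n f : Apos a m (Apos b n f) = Apos b n (Apos a m f).
Proof.
have cf := RGam_classf f.
apply: RGam_eq => t.
exact: (@annC m n (sigmaT (vchar a)) (sigmaT (vchar b)) f t
  (@classf_sigma _ C a) (@classf_sigma _ C b) cf).
Qed.

Lemma Apos_EopC a b m n f : Apos a m (Eop b n f) = Eop b n (Apos a m f).
Proof.
have cf := RGam_classf f; rewrite /Eop (GRing.scalable_linear (Apos_linear a m)).
congr (_ *: _); apply: RGam_eq => t.
exact: (@annC m n (sigmaT (vchar a)) (epsvT b) f t (@classf_sigma _ C a) (@classf_eps b) cf).
Qed.

(** Newton's relation between elementary functions and power sums. *)
Lemma Eop_rec a n f : n%:R *: Eop a n f = - \sum_(k < n.+1) Apos a k (Eop a (n - k) f).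
Proof.
have cf := RGam_classf f; apply: RGam_eq => t; rewrite -sumrN RGam_sum.
rewrite -[LHS]/(n%:R * Eop a n f t) EopE mulrCA -annZ.
rewrite (@eq_ann _ _ (fun s => n%:R * cut n (epsvT a) s)); last first.
  by move=> s es; rewrite /cut es eqxx.
rewrite (@eq_ann _ _ _ _ _ (fun s _ => multf_rec n s (multf_eps a))).
rewrite ann_suml mulr_sumr; apply: eq_bigr => -[k lek] _ /=.
have {2}-> : n = (n - k + k)%N by rewrite subnK.
rewrite convC -ann_ann; last 4 first.
- exact: multf_eta.
- exact/classf_cycpart/classf_eps.
- exact: classf_eps.
- exact: cf.
rewrite (@eq_ann _ _ (fun s => - (-1) ^+ k * sigmaT (vchar a) s)); last first.
  by move=> s es; rewrite cycpart_eps es.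
rewrite annZ.
transitivity (- ((-1) ^+ (n - k) * ann (etaT xi) k (sigmaT (vchar a))
                                     (ann (etaT xi) (n - k) (epsvT a) f) t)).
  rewrite mulNr mulrN mulrA -exprD; congr (- (_ * _)).
  rewrite -[in LHS](subnK (lek : (k <= n)%N)) -addnA exprD addnn -mul2n exprM.
  by rewrite sqrrN expr1n expr1n mulr1.
have e : Apos a k (Eop a (n - k) f) =
    (-1) ^+ (n - k) *: Apos a k (annih xi (@eps C gT a (n - k)) f).
  exact: (GRing.scalable_linear (Apos_linear a k)).
by rewrite -[RHS]/(- (Apos a k (Eop a (n - k) f) t)) e.
Qed.

Lemma Eop0 a f : Eop a 0 f = f.
Proof.
have cf := RGam_classf f; have [_ x1 _] := multf_eta xi; have [_ e1 _] := multf_eps a.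
rewrite /Eop expr0 scale1r; apply: RGam_eq => t.
rewrite -[LHS]/(ann (etaT xi) 0 (epsvT a) f t) /ann.
rewrite (@eq_avg _ _ _ _ (fun=> 1 * f t)) ?avg_scaler ?avg1 ?mul1r //.
case=> k x /= k0; subst k; rewrite x1 // e1 // !mul1r; case: t => n y.
symmetry; apply: (@classf_embT _ _ f _ _ _ _ _ cf (emb_rshift x^-1%g y)).
apply/setP => i; rewrite inE; case: (split_ordP i) => j -> ; last exact: imset_f.
by case: j.
Qed.

Lemma Eop_Hop a b n m f :
  Eop a n (Hop b m f) = \sum_(k < n.+1 | (k <= m)%N)
    ((-1) ^+ k * gbinom C (iform xi a b) k) *: Hop b (m - k) (Eop a (n - k) f).
Proof.
have cf := RGam_classf f; apply: RGam_eq => t; rewrite RGam_sum EopE HopE.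
rewrite ann_conv; [|exact: multf_eta|exact: multf_eps|exact: multf_eta|exact: cf].
rewrite mulr_sumr; apply: eq_bigr => -[k lek] _ /=; rewrite -/(pnum xi a b k) pnumE.
have e : Hop b (m - k) (Eop a (n - k) f) =
    (-1) ^+ (n - k) *: Hop b (m - k) (annih xi (@eps C gT a (n - k)) f).
  exact: (GRing.scalable_linear (Hop_linear b (m - k))).
rewrite -[RHS]/(_ * Hop b (m - k) (Eop a (n - k) f) t) e.
rewrite -[X in _ = _ * X]/(_ * Hop b (m - k) (annih xi (@eps C gT a (n - k)) f) t) HopE.
have -> : (-1) ^+ n = (-1) ^+ k * (-1) ^+ (n - k) :> C by rewrite -exprD subnKC.
exact: mulrACA.
Qed.

(** The element [f] vanishes in degrees at least [N]. *)
Definition dbound N (f : V) := forall t : T, (N <= tag t)%N -> f t = 0.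

Lemma dbound_ex f : exists N, dbound N f.
Proof.
have /asboolP[_ [N fN]] := rg_funP f.
by exists N => -[n x] /= le; apply: fN.
Qed.

Lemma dboundW M N f : (M <= N)%N -> dbound M f -> dbound N f.
Proof. by move=> le bM t leN; apply: bM; apply: leq_trans leN. Qed.

Lemma dbound_Eop N a n f : dbound N f -> dbound N (Eop a n f).
Proof.
move=> bf t le; rewrite EopE /ann avg0 ?mulr0 // => s es.
by rewrite bf ?mulr0 //= (leq_trans le) // leq_addl.
Qed.

Lemma Eop_dbound N a n f : dbound N f -> (N <= n)%N -> Eop a n f = 0.
Proof.
move=> bf le; apply: RGam_eq => t; rewrite EopE /ann avg0 ?mulr0 // => s es.
by rewrite bf ?mulr0 //= es (leq_trans le) // leq_addr.
Qed.

Lemma dbound_Hop N a n f : dbound N f -> dbound (n + N) (Hop a n f).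
Proof.
move=> bf [k x] le; rewrite (HopE a n f) convE big1 // => A sA.
rewrite /cut tag_res //; case: eqP => e; last by rewrite mul0r.
by rewrite bf ?mulr0 // tag_res ?stabC //= -(leq_add2l n) -{2}e cardsC card_ord.
Qed.

Lemma dbound_sum N (I : Type) (r : seq I) (P : pred I) (F : I -> V) :
  (forall i, P i -> dbound N (F i)) -> dbound N (\sum_(i <- r | P i) F i).
Proof. by move=> b t le; rewrite RGam_sum big1 // => i Pi; apply: b. Qed.

End Operators.

From mathcomp Require Import classical_sets functions cardinality fsbigop.

(** * Exponentials of operator series *)

Lemma fsumE (I : choiceType) (V : zmodType) (r : seq I) (F : I -> V) :
  uniq r -> (forall q, q \notin r -> F q = 0) ->
  \sum_(q \in [set: I]%classic) F q = \sum_(q <- r) F q.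
Proof.
move=> u F0; rewrite (fsbigE r) // => [|q _]; last exact: F0.
by apply: eq_bigl => q; rewrite in_setT.
Qed.

Section LinearMaps.
Variables (R : pzRingType) (U V : lmodType R) (f : U -> V).
Hypothesis f_lin : linear f.

Lemma lin0 : f 0 = 0.
Proof. by have := f_lin (-1) 0 0; rewrite scaleN1r oppr0 addr0 scaleN1r addNr. Qed.
Lemma linZ c u : f (c *: u) = c *: f u.
Proof. by rewrite -[c *: u]addr0 f_lin lin0 addr0. Qed.
Lemma linD u v : f (u + v) = f u + f v.
Proof. by rewrite -[u]scale1r f_lin !scale1r. Qed.
Lemma linsum (I : Type) (r : seq I) (P : pred I) (F : I -> U) :
  f (\sum_(i <- r | P i) F i) = \sum_(i <- r | P i) f (F i).
Proof. exact: (big_morph f linD lin0). Qed.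

End LinearMaps.

Section SerExp.
Variables (C : numClosedFieldType) (V : lmodType C) (s : int).
Hypothesis hs : s = 1 \/ s = -1.

(** Series supported on the quadrant of pairs of exponents of sign [s]. The degree of
    a pair is the sum of the absolute values of its entries on that quadrant, and
    [box N] is the list of the pairs with entries at most [N] in absolute value. *)
Definition sector (p : int * int) := (0 <= s * p.1) && (0 <= s * p.2).
Definition deg (p : int * int) := s * (p.1 + p.2).
Definition box (N : nat) : seq (int * int) :=
  [seq (s * i%:Z, s * j%:Z) | i <- iota 0 N.+1, j <- iota 0 N.+1].

Lemma mem_box p N : (p \in box N) = [&& sector p, s * p.1 <= N%:Z & s * p.2 <= N%:Z].
Proof.
case: p => p1 p2; rewrite /sector /=; apply/allpairsP/idP => [[[i j]]|].
  by rewrite !mem_iota /= => -[hi hj [-> ->]]; case: hs => ->; lia.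
move=> h; exists (`|p1|%N, `|p2|%N); rewrite !mem_iota /=.
by case: hs h => -> h; split; try lia; congr (_, _); lia.
Qed.

Lemma box_uniq N : uniq (box N).
Proof.
apply: allpairs_uniq; rewrite ?iota_uniq // => -[i j] [k l] _ _ /= [].
by case: hs => -> e1 e2; congr (_, _); lia.
Qed.

Lemma sectorD p q : sector p -> sector q -> sector (p + q).
Proof. by case: p q => [p1 p2] [q1 q2]; rewrite /sector /=; case: hs => ->; lia. Qed.

Variables (A G : opser (int * int)%type V).
Hypothesis A_lin : forall q, linear (A q).
Hypothesis A_sec : forall q v, ~~ sector q -> A q v = 0.
Hypothesis A_0 : forall v, A 0 v = 0.
Hypothesis A_comm : forall q r v, A q (A r v) = A r (A q v).

Local Notation B k := (iter k (ser_mul A) (ser_const id)).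

Lemma ser_mul_box D N p v : (forall q v, ~~ sector q -> D q v = 0) ->
  s * p.1 <= N%:Z -> s * p.2 <= N%:Z ->
  ser_mul A D p v = \sum_(q <- box N) A q (D (p - q) v).
Proof.
move=> D0 le1 le2; apply: fsumE; first exact: box_uniq.
move=> q nq; have [sq|nsq] := boolP (sector q); last by rewrite A_sec.
rewrite D0 ?(lin0 (A_lin q)) //; apply: contra nq => spq; rewrite mem_box sq /=.
move: sq spq le1 le2; case: p q => [p1 p2] [q1 q2]; rewrite /sector /=.
by case: hs => ->; lia.
Qed.

Lemma iter_sector k p v : ~~ sector p -> B k p v = 0.
Proof.
elim: k p => [|k IH] p np /=.
  by rewrite /ser_const ifN //; apply: contraNneq np => ->; rewrite /sector !mulr0 lexx.
apply: fsbig1 => q _; have [sq|nsq] := boolP (sector q); last by rewrite A_sec.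
rewrite IH ?(lin0 (A_lin q)) //; apply: contra np => spq.
by rewrite -(subrK q p) sectorD.
Qed.

Lemma deg_sector p : sector p -> (0 <= deg p) && ((deg p == 0) == (p == 0)).
Proof.
case: p => p1 p2; rewrite /sector /deg -pair_eqE /pair_eq /=.
by case: hs => ->; lia.
Qed.

Lemma degB p q : deg (p - q) = deg p - deg q.
Proof. by case: p q => [p1 p2] [q1 q2]; rewrite /deg /=; lia. Qed.

Lemma iter_deg k p v : deg p < k%:Z -> B k p v = 0.
Proof.
elim: k p => [|k IH] p lt; have [sp|/iter_sector-> //] := boolP (sector p).
  by have := deg_sector sp; lia.
rewrite /=; apply: fsbig1 => q _; have [sq|nsq] := boolP (sector q); last by rewrite A_sec.
have [->|q0] := eqVneq q 0; first exact: A_0.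
rewrite IH ?(lin0 (A_lin q)) // degB; have := deg_sector sq.
by rewrite (negbTE q0); lia.
Qed.

(** The degree is a derivation, so the degree of a power is computed by the Leibniz
    rule, as the coefficients commute. *)
Lemma iter_rec N k (p : int * int) v : p \in box N ->
  (deg p)%:~R *: B k.+1 p v =
  k.+1%:R *: \sum_(q <- box N) (deg q)%:~R *: A q (B k (p - q) v).
Proof.
have sP j (q : int * int) w : s * q.1 <= N%:Z -> s * q.2 <= N%:Z ->
    B j.+1 q w = \sum_(r <- box N) A r (B j (q - r) w).
  by move=> l1 l2; apply: ser_mul_box => //; exact: iter_sector.
have subN (q r : int * int) : r \in box N -> s * q.1 <= N%:Z -> s * q.2 <= N%:Z ->
    s * (q - r).1 <= N%:Z /\ s * (q - r).2 <= N%:Z.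
  rewrite mem_box; case: q r => [q1 q2] [r1 r2]; rewrite /sector /=.
  by case: hs => ->; lia.
rewrite mem_box => /and3P[_ l1 l2]; elim: k p l1 l2 => [|k IH] p l1 l2.
  rewrite sP // scale1r scaler_sumr; apply: eq_big_seq => q qN /=.
  rewrite /ser_const; case: eqP => [/eqP|_]; last by rewrite (lin0 (A_lin q)) !scaler0.
  by rewrite subr_eq0 => /eqP ->.
rewrite sP // [LHS]scaler_sumr.
transitivity (\sum_(q <- box N) ((deg q)%:~R *: A q (B k.+1 (p - q) v) +
   A q (k.+1%:R *: \sum_(r <- box N) (deg r)%:~R *: A r (B k (p - q - r) v)))).
  apply: eq_big_seq => q qN; have [l1' l2'] := subN p q qN l1 l2.
  rewrite -IH // (linZ (A_lin q)) -scalerDl -rmorphD degB; congr (_%:~R *: _).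
  by rewrite addrC subrK.
rewrite big_split /= -[in RHS]nat1r scalerDl scale1r; congr (_ + _).
under eq_bigr => q _ do rewrite (linZ (A_lin q)) (linsum (A_lin q)).
rewrite -scaler_sumr; congr (_ *: _); rewrite exchange_big.
apply: eq_big_seq => r rN; have [l1' l2'] := subN p r rN l1 l2.
rewrite -[ser_mul A _ _ _]/(B k.+1 (p - r) v) sP // (linsum (A_lin r)) scaler_sumr.
apply: eq_bigr => q _.
by rewrite (linZ (A_lin q)) A_comm addrAC.
Qed.

Lemma ser_exp_sum K p v : deg p < K%:Z ->
  ser_exp A p v = \sum_(k < K) (k`!)%:R^-1 *: B k p v.
Proof.
move=> lt; rewrite /ser_exp (fsumE (r := iota 0 K)) ?iota_uniq.
- by rewrite -{1}(subn0 K) -/(index_iota 0 K) big_mkord.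
- by [].
move=> k; rewrite mem_iota /= add0n -leqNgt => le; rewrite iter_deg ?scaler0 //.
by apply: lt_le_trans lt _; rewrite lez_nat.
Qed.

Lemma ser_exp_rec N (p : int * int) v : p \in box N ->
  (deg p)%:~R *: ser_exp A p v =
  \sum_(q <- box N) (deg q)%:~R *: A q (ser_exp A (p - q) v).
Proof.
move=> pN; have lt : deg p < (2 * N).+1%:Z.
  by move: pN; rewrite mem_box /sector /deg; case: (p) => p1 p2 /=; case: hs => ->; lia.
rewrite (@ser_exp_sum (2 * N).+2); last by apply: lt_trans lt _; rewrite ltz_nat.
rewrite big_ord_recl /= scalerDr [X in X + _](_ : _ = 0); last first.
  rewrite /ser_const; case: eqP => [->|_]; last by rewrite !scaler0.
  by rewrite /deg addr0 mulr0 scale0r.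
rewrite add0r scaler_sumr.
transitivity (\sum_(k < (2 * N).+1) (k`!)%:R^-1 *:
    \sum_(q <- box N) (deg q)%:~R *: A q (B k (p - q) v)).
  apply: eq_bigr => k _; rewrite /bump /= add1n scalerA mulrC -scalerA.
  rewrite (iter_rec k v pN) scalerA; congr (_ *: _).
  by rewrite factS natrM invfM mulrC mulrA mulfV ?mul1r // pnatr_eq0.
under [LHS]eq_bigr => k _ do rewrite scaler_sumr.
rewrite exchange_big /=; apply: eq_big_seq => q qN.
rewrite (@ser_exp_sum (2 * N).+1); last first.
  rewrite degB; have : 0 <= deg q by move: qN; rewrite mem_box => /and3P[/deg_sector/andP[]].
  by move: lt; lia.
rewrite (linsum (A_lin q)). rewrite scaler_sumr; apply: eq_bigr => k _.
by rewrite (linZ (A_lin q)) !scalerA mulrC.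
Qed.

Hypothesis G_sec : forall p v, ~~ sector p -> G p v = 0.
Hypothesis G_0 : forall v, G 0 v = v.
Hypothesis G_rec : forall N p v, p \in box N ->
  (deg p)%:~R *: G p v = \sum_(q <- box N) (deg q)%:~R *: A q (G (p - q) v).

(** A series that vanishes outside a quadrant is determined by its logarithmic
    derivative with respect to the total degree. *)
Lemma ser_expE p v : ser_exp A p v = G p v.
Proof.
have [sp|np] := boolP (sector p); last first.
  rewrite G_sec // /ser_exp fsbig1 // => k _.
  by rewrite iter_sector ?scaler0.
have [m ltm] : exists m : nat, deg p < m%:Z by exists `|deg p|.+1; lia.
elim: m p sp ltm => [|m IH] p sp ltm; first by have := deg_sector sp; lia.
have [->|p0] := eqVneq p 0.
  rewrite G_0 (@ser_exp_sum 1%N) ?big_ord1 /=.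
    by rewrite /ser_const eqxx fact0 invr1 scale1r.
  by rewrite /deg addr0 mulr0.
have [N pN] : exists N, p \in box N.
  exists (`|p.1| + `|p.2|)%N; rewrite mem_box sp /=.
  by case: (p) => p1 p2 /=; case: hs => ->; lia.
have d0 : (deg p)%:~R != 0 :> C.
  by rewrite intr_eq0; have := deg_sector sp; rewrite (negbTE p0); lia.
apply: (scalerI d0); rewrite (ser_exp_rec v pN) (G_rec v pN).
apply: eq_big_seq => q qN; have [->|q0] := eqVneq q 0; first by rewrite !A_0.
have sq : sector q by move: qN; rewrite mem_box => /and3P[].
congr (_ *: A q _); have [spq|nspq] := boolP (sector (p - q)).
  apply: IH => //; rewrite degB; have := deg_sector sq; rewrite (negbTE q0).
  by move: ltm; lia.
rewrite G_sec // /ser_exp fsbig1 // => k _.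
by rewrite iter_sector ?scaler0.
Qed.

End SerExp.

Section LinearCombinations.
Variables (C : numClosedFieldType) (V : lmodType C).
Implicit Types f g : V -> V.

Lemma linear_cst0 : linear (fun _ : V => 0 : V).
Proof. by move=> k u v; rewrite scaler0 addr0. Qed.
Lemma linear_scale c f : linear f -> linear (fun v => c *: f v).
Proof. by move=> fl k u v; rewrite fl scalerDr !scalerA mulrC. Qed.
Lemma linear_add f g : linear f -> linear g -> linear (fun v => f v + g v).
Proof. by move=> fl gl k u v; rewrite fl gl scalerDr addrACA. Qed.
Lemma linear_if (b : bool) f : linear f -> linear (fun v => if b then f v else 0).
Proof. by case: b => // _; exact: linear_cst0. Qed.

End LinearCombinations.

(** The exponential of the generating series of two commuting families of
    operators [X1], [X2] is the product of [P1] and [P2] when these satisfy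
    Newton's relations with them. The sign [s] is 1 for creation operators and -1
    for annihilation operators; it governs both the exponents and the relations. *)
Section ExpPair.
Variables (C : numClosedFieldType) (V : lmodType C) (s : int).
Hypothesis hs : s = 1 \/ s = -1.
Variables X1 X2 P1 P2 : nat -> V -> V.
Hypothesis X1_lin : forall n, linear (X1 n).
Hypothesis X2_lin : forall n, linear (X2 n).
Hypothesis P1_lin : forall n, linear (P1 n).
Hypothesis X1_0 : forall v, X1 0 v = 0.
Hypothesis X2_0 : forall v, X2 0 v = 0.
Hypothesis P1_0 : forall v, P1 0 v = v.
Hypothesis P2_0 : forall v, P2 0 v = v.
Hypothesis X11 : forall m n v, X1 m (X1 n v) = X1 n (X1 m v).
Hypothesis X22 : forall m n v, X2 m (X2 n v) = X2 n (X2 m v).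
Hypothesis X12 : forall m n v, X1 m (X2 n v) = X2 n (X1 m v).
Hypothesis X2P1 : forall m n v, X2 m (P1 n v) = P1 n (X2 m v).
Hypothesis P1_rec : forall n v,
  n%:R *: P1 n v = s%:~R *: \sum_(k < n.+1) X1 k (P1 (n - k) v).
Hypothesis P2_rec : forall n v,
  n%:R *: P2 n v = s%:~R *: \sum_(k < n.+1) X2 k (P2 (n - k) v).

Let Y (X : nat -> V -> V) (k : int) v := if 0 < s * k then `|k|%N%:R^-1 *: X `|k|%N v else 0.

(** The sum over k >= 1 of s/k (X1_k z^(sk) + X2_k w^(sk)), and the product of the
    generating series of [P1] and [P2]. *)
Definition exp_arg : opser (int * int)%type V := fun q v =>
  s%:~R *: ((if q.2 == 0 then Y X1 q.1 v else 0) + (if q.1 == 0 then Y X2 q.2 v else 0)).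
Definition exp_val : opser (int * int)%type V := fun p v =>
  if sector s p then P1 `|p.1|%N (P2 `|p.2|%N v) else 0.

Let Y_lin X k : (forall n, linear (X n)) -> linear (Y X k).
Proof. by move=> Xl; apply: linear_if; apply: linear_scale. Qed.

Let exp_arg_lin q : linear (exp_arg q).
Proof.
by apply/linear_scale/linear_add; apply: linear_if; apply: Y_lin.
Qed.

Let YC X X' k l v : (forall n, linear (X n)) -> (forall n, linear (X' n)) ->
  (forall m n v, X m (X' n v) = X' n (X m v)) -> Y X k (Y X' l v) = Y X' l (Y X k v).
Proof.
move=> Xl Xl' XX; rewrite /Y; case: ifP => _; case: ifP => _ //.
- by rewrite (linZ (Xl _)) (linZ (Xl' _)) XX !scalerA mulrC.
- by rewrite (lin0 (Xl _)) scaler0.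
- by rewrite (lin0 (Xl' _)) scaler0.
Qed.

Let exp_arg_comm q r v : exp_arg q (exp_arg r v) = exp_arg r (exp_arg q v).
Proof.
pose f1 q v := if q.2 == 0 :> int then Y X1 q.1 v else 0.
pose f2 q v := if q.1 == 0 :> int then Y X2 q.2 v else 0.
have f1l q' : linear (f1 q') by apply/linear_if/Y_lin.
have f2l q' : linear (f2 q') by apply/linear_if/Y_lin.
have c11 q' r' w : f1 q' (f1 r' w) = f1 r' (f1 q' w).
  rewrite /f1; case: ifP => _; case: ifP => _ //; first exact: YC.
  - by rewrite (lin0 (Y_lin _ X1_lin)).
  - by rewrite (lin0 (Y_lin _ X1_lin)).
have c22 q' r' w : f2 q' (f2 r' w) = f2 r' (f2 q' w).
  rewrite /f2; case: ifP => _; case: ifP => _ //; first exact: YC.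
  - by rewrite (lin0 (Y_lin _ X2_lin)).
  - by rewrite (lin0 (Y_lin _ X2_lin)).
have c12 q' r' w : f1 q' (f2 r' w) = f2 r' (f1 q' w).
  rewrite /f1 /f2; case: ifP => _; case: ifP => _ //; first exact: YC.
  - by rewrite (lin0 (Y_lin _ X1_lin)).
  - by rewrite (lin0 (Y_lin _ X2_lin)).
rewrite /exp_arg -!/(f1 _ _) -!/(f2 _ _).
rewrite (linZ (f1l q)) (linZ (f2l q)) (linZ (f1l r)) (linZ (f2l r)).
rewrite (linD (f1l q)) (linD (f2l q)) (linD (f1l r)) (linD (f2l r)).
by rewrite (c11 r q) (c22 r q) (c12 r q) -(c12 q r) -!scalerDr addrACA.
Qed.

Let abs_s (k : nat) : `|(s * k%:Z)%R|%N = k.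
Proof. by case: hs => ->; lia. Qed.
Let s_mul (k : nat) : s * (s * k%:Z) = k%:Z.
Proof. by case: hs => ->; lia. Qed.

Let sectorE (i j : nat) : sector s (s * i%:Z, s * j%:Z).
Proof. by rewrite /sector /= !s_mul. Qed.

Let Y_s X (k : nat) v : X 0%N v = 0 -> k%:R *: Y X (s * k%:Z) v = X k v.
Proof.
rewrite /Y s_mul abs_s; case: k => [|k] X0; first by rewrite scale0r X0.
by rewrite ltz_nat scalerA mulfV ?scale1r // pnatr_eq0.
Qed.

Let exp_val_rec N p v : p \in box s N ->
  (deg s p)%:~R *: exp_val p v =
  \sum_(q <- box s N) (deg s q)%:~R *: exp_arg q (exp_val (p - q) v).
Proof.
case/allpairsP => -[i j] [iN jN ->]; rewrite !mem_iota /= in iN jN.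
have valB (k l : nat) : exp_val ((s * i%:Z, s * j%:Z) - (s * k%:Z, s * l%:Z)) v =
    if (k <= i)%N && (l <= j)%N then P1 (i - k) (P2 (j - l) v) else 0.
  rewrite /exp_val; have -> : sector s ((s * i%:Z, s * j%:Z) - (s * k%:Z, s * l%:Z)) =
      (k <= i)%N && (l <= j)%N.
    by rewrite /sector /=; case: hs => ->; lia.
  case: ifP => // /andP[ki lj] /=.
  have -> : `|(s * i%:Z - s * k%:Z)%R|%N = (i - k)%N by case: hs => ->; lia.
  by have -> : `|(s * j%:Z - s * l%:Z)%R|%N = (j - l)%N by case: hs => ->; lia.
have argE (k l : nat) w : (deg s (s * k%:Z, s * l%:Z))%:~R *: exp_arg (s * k%:Z, s * l%:Z) w =
    (if l == 0%N then s%:~R *: X1 k w else 0) + (if k == 0%N then s%:~R *: X2 l w else 0).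
  have z0 (m : nat) : (s * m%:Z == 0) = (m == 0%N) by case: hs => ->; lia.
  rewrite /deg /exp_arg /= !z0 mulrDr !s_mul -PoszD -pmulrn scalerA mulrC -scalerA !scalerDr.
  case: eqP => [->|_]; case: eqP => [->|_]; rewrite ?addn0 ?add0n ?scaler0 ?addr0 ?add0r //.
  - by rewrite !scale0r X1_0 X2_0 scaler0 addr0.
  - by rewrite Y_s.
  - by rewrite Y_s.
have big_box (F : nat -> nat -> V) (FE : int * int -> V) :
    (forall k l, FE (s * k%:Z, s * l%:Z) = F k l) ->
    \sum_(q <- box s N) FE q = \sum_(k < N.+1) \sum_(l < N.+1) F k l.
  move=> e; have io m : iota 0 m = index_iota 0 m by rewrite /index_iota subn0.
  rewrite /box !io big_allpairs_dep big_mkord.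
  by apply: eq_bigr => k _; rewrite big_mkord; apply: eq_bigr => l _.
rewrite (big_box (fun k l => (if l == 0%N then s%:~R *: X1 k
     (if (k <= i)%N && (l <= j)%N then P1 (i - k) (P2 (j - l) v) else 0) else 0) +
   (if k == 0%N then s%:~R *: X2 l
     (if (k <= i)%N && (l <= j)%N then P1 (i - k) (P2 (j - l) v) else 0) else 0))); last first.
  by move=> k l; rewrite argE valB.
have cutsum (F : nat -> V) m : (m <= N)%N ->
    \sum_(k < N.+1) (if (k <= m)%N then F k else 0) = \sum_(k < m.+1) F k.
  by move=> le; rewrite -big_mkcond (big_ord_widen _ F (le : (m < N.+1)%N)).
under eq_bigr => k _ do rewrite big_split /=.
rewrite big_split /= [X in _ = X + _](_ : _ = i%:R *: P1 i (P2 j v)); last first.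
  rewrite P1_rec -(cutsum (fun k => X1 k (P1 (i - k) (P2 j v)))) // scaler_sumr.
  apply: eq_bigr => k _; rewrite big_ord_recl /= big1 ?addr0 => [|l _] //.
  rewrite andbT subn0; case: ifP => _ //; by rewrite (lin0 (X1_lin k)).
rewrite [X in _ = _ + X](_ : _ = j%:R *: P1 i (P2 j v)); last first.
  rewrite big_ord_recl /= [X in _ + X]big1 ?addr0 => [|k _]; last by rewrite big1.
  rewrite -(linZ (P1_lin i)) P2_rec (linZ (P1_lin i)) (linsum (P1_lin i)).
  rewrite -(cutsum (fun l => P1 i (X2 l (P2 (j - l) v)))) // scaler_sumr.
  apply: eq_bigr => l _; rewrite subn0; case: ifP => _; last by rewrite (lin0 (X2_lin l)).
  by rewrite X2P1.
rewrite -scalerDl -natrD /exp_val sectorE /= !abs_s; congr (_ *: _).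
by rewrite /deg /= mulrDr !s_mul -PoszD -pmulrn.
Qed.

Lemma ser_exp_pair p v : ser_exp exp_arg p v = exp_val p v.
Proof.
apply: (ser_expE hs exp_arg_lin _ _ exp_arg_comm _ _ exp_val_rec) => //.
- move=> q w; rewrite /sector /exp_arg => nq.
  have -> : (if q.2 == 0 then Y X1 q.1 w else 0) = 0.
    case: eqP => // q2; rewrite /Y ifN //; apply: contra nq; rewrite q2 mulr0 lexx andbT.
    exact: ltW.
  rewrite add0r; case: eqP => [q1|_]; last by rewrite scaler0.
  rewrite /Y ifN ?scaler0 //; apply: contra nq; rewrite q1 mulr0 lexx /=.
  exact: ltW.
- by move=> w; rewrite /exp_arg /Y /= mulr0 ltxx addr0 scaler0.
- by move=> q w nq; rewrite /exp_val (negbTE nq).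
- by move=> w; rewrite /exp_val /sector /= mulr0 lexx /= P1_0 P2_0.
Qed.

End ExpPair.

(** * The product of H_+ and E_- *)

Section FiniteSums.
Variable V : zmodType.

Lemma sum_ord_support (A B : nat) (g : nat -> V) : (A <= B)%N ->
  (forall m, (A <= m)%N -> g m = 0) -> \sum_(m < B) g m = \sum_(m < A) g m.
Proof.
move=> le g0; rewrite (big_ord_widen _ g le) [RHS]big_mkcond /=.
by apply: eq_bigr => m _; case: ltnP => // /g0.
Qed.

(** Summation along antidiagonals. *)
Lemma sum_triangle (h : nat -> nat -> V) (K N B : nat) : (K + N <= B)%N ->
  (forall k m, (K <= k)%N -> h k m = 0) -> (forall k m, (N <= m)%N -> h k m = 0) ->
  \sum_(m < B) \sum_(k < m.+1) h k (m - k)%N = \sum_(k < K) \sum_(m < N) h k m.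
Proof.
move=> le hK hN.
transitivity (\sum_(m < B) \sum_(k < B) \sum_(l < B) (if (k + l == m)%N then h k l else 0)).
  apply: eq_bigr => m _; rewrite (big_ord_widen B (fun k => h k (m - k)%N)) //.
  rewrite big_mkcond /=; apply: eq_bigr => k _; rewrite ltnS.
  case: leqP => [lekm|ltmk]; last first.
    by rewrite big1 // => l _; rewrite ifN // gtn_eqF // ltn_addr.
  have ltB : (m - k < B)%N by rewrite (leq_ltn_trans (leq_subr _ _)).
  rewrite (bigD1 (Ordinal ltB)) //= subnKC // eqxx big1 ?addr0 // => l ne.
  rewrite ifN //; apply: contraNneq ne => e; apply/eqP/val_inj => /=.
  by rewrite -e addKn.
rewrite exchange_big /=.
transitivity (\sum_(k < B) \sum_(l < B) h k l); last first.
  rewrite (@sum_ord_support K B (fun k => \sum_(l < B) h k l)); last 2 first.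
  - exact: leq_trans (leq_addr _ _) le.
  - by move=> k /hK e; rewrite big1.
  by apply: eq_bigr => k _; apply: sum_ord_support (leq_trans (leq_addl _ _) le) (hN k).
apply: eq_bigr => k _; rewrite exchange_big /=; apply: eq_bigr => l _.
case: (ltnP (k + l) B) => [lt|ge].
  rewrite (bigD1 (Ordinal lt)) //= eqxx big1 ?addr0 // => m ne.
  by rewrite ifN //; apply: contraNneq ne => e; apply/eqP/val_inj.
have -> : h k l = 0.
  case: (leqP K k) => [/hK //|ltk]; apply: hN; rewrite leqNgt; apply/negP => ltl.
  by move: le ge ltk ltl; lia.
by rewrite big1 // => m _; rewrite if_same.
Qed.

End FiniteSums.

Section VertexAlgebra.
Variables (gT : finGroupType) (C : numClosedFieldType) (xi : RZ C gT).
Local Notation V := (RGam C gT).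

(** H_(-k)(a) for an integer [k], zero if [k] is negative. *)
Definition Hz (a : RZ C gT) (k : int) (f : V) : V := if 0 <= k then Hop a `|k|%N f else 0.

Lemma Hz_linear a k : linear (Hz a k).
Proof. exact/linear_if/Hop_linear. Qed.

Lemma Hz0 a k : Hz a k 0 = 0.
Proof. exact: (lin0 (Hz_linear a k)). Qed.

Lemma Eop_Hz a b n l f :
  Eop xi a n (Hz b l f) = \sum_(k < n.+1)
    ((-1) ^+ k * gbinom C (iform xi a b) k) *: Hz b (l - k%:Z) (Eop xi a (n - k) f).
Proof.
rewrite /Hz; case: ifP => l0; last first.
  rewrite (lin0 (Eop_linear xi a n)) big1 // => k _; rewrite ifF ?scaler0 //.
  by move: l0; lia.
rewrite Eop_Hop big_mkcond /=; apply: eq_bigr => k _.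
have -> : (0 <= l - k%:Z) = (k <= `|l|)%N by lia.
case: ifP => le; last by rewrite scaler0.
by have -> : `|(l - k%:Z)%R|%N = (`|l| - k)%N by lia.
Qed.

Lemma dbound_Hz N a k f : dbound N f -> dbound (`|k| + N) (Hz a k f).
Proof. by move=> bf; rewrite /Hz; case: ifP => _ //; apply: dbound_Hop. Qed.

(** The coefficient of z^p in H_+(a, z) E_-(a, z). *)
Definition HE a (p : int) (f : V) : V :=
  \sum_(n \in [set: nat]%classic) Hz a (p + n%:Z) (Eop xi a n f).

Lemma HE_sum N a p f : dbound N f ->
  HE a p f = \sum_(n < N) Hz a (p + n%:Z) (Eop xi a n f).
Proof.
move=> bf; rewrite /HE (fsumE (r := index_iota 0 N)) ?iota_uniq ?big_mkord //.
move=> n; rewrite mem_index_iota /= -leqNgt => le.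
by rewrite (Eop_dbound _ _ bf le) Hz0.
Qed.

(** The coefficient of z^p1 w^p2 in H_+(a, z) H_+(b, w) E_-(a, z) E_-(b, w). *)
Definition HHEE a b (p : int * int) (f : V) : V :=
  \sum_(m \in [set: nat * nat]%classic)
    Hz a (p.1 + m.1%:Z) (Hz b (p.2 + m.2%:Z) (Eop xi a m.1 (Eop xi b m.2 f))).

Lemma HHEE_seq N a b p f : dbound N f ->
  HHEE a b p f = \sum_(m <- iota 0 N) \sum_(n <- iota 0 N)
    Hz a (p.1 + m%:Z) (Hz b (p.2 + n%:Z) (Eop xi a m (Eop xi b n f))).
Proof.
move=> bf; rewrite /HHEE (fsumE (r := [seq (m, n) | m <- iota 0 N, n <- iota 0 N])).
- by rewrite big_allpairs_dep.
- by apply: allpairs_uniq; rewrite ?iota_uniq // => -[m n] [m' n'] _ _ /= ->.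
move=> [m n] /= nin; have [/(Eop_dbound xi b bf) ->|ltn] := leqP N n.
  by rewrite (lin0 (Eop_linear xi a m)) !Hz0.
have [leN|ltm] := leqP N m.
  by rewrite (Eop_dbound _ _ (dbound_Eop _ _ _ bf) leN) !Hz0.
case/negP: nin; apply/allpairsP; exists (m, n); rewrite !mem_iota /=.
by split.
Qed.

Lemma HHEE_sum N a b p f : dbound N f ->
  HHEE a b p f = \sum_(m < N) \sum_(n < N)
    Hz a (p.1 + m%:Z) (Hz b (p.2 + n%:Z) (Eop xi a m (Eop xi b n f))).
Proof.
move=> bf; rewrite (HHEE_seq _ _ _ bf).
have io : iota 0 N = index_iota 0 N by rewrite /index_iota subn0.
by rewrite io big_mkord; apply: eq_bigr => m _; rewrite big_mkord.
Qed.

Lemma HE_linear a p : linear (HE a p).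
Proof.
move=> k f g; have [M bf] := dbound_ex f; have [N bg] := dbound_ex g.
have bf' := dboundW (leq_maxl M N) bf; have bg' := dboundW (leq_maxr M N) bg.
rewrite (HE_sum _ _ bf') (HE_sum _ _ bg') (@HE_sum (maxn M N)); last first.
  move=> t le; rewrite -[LHS]/(k * f t + g t) bf' // bg' // addr0 mulr0 //.
rewrite scaler_sumr -big_split /=; apply: eq_bigr => n _.
by rewrite (Eop_linear xi a n) (Hz_linear a).
Qed.

Lemma HHEE_linear a b p : linear (HHEE a b p).
Proof.
move=> k f g; have [M bf] := dbound_ex f; have [N bg] := dbound_ex g.
have bf' := dboundW (leq_maxl M N) bf; have bg' := dboundW (leq_maxr M N) bg.
rewrite (HHEE_sum _ _ _ bf') (HHEE_sum _ _ _ bg') (@HHEE_sum (maxn M N)); last first.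
  move=> t le; rewrite -[LHS]/(k * f t + g t) bf' // bg' // addr0 mulr0 //.
rewrite scaler_sumr -big_split /=; apply: eq_bigr => m _.
rewrite scaler_sumr -big_split /=; apply: eq_bigr => n _.
by rewrite (Eop_linear xi b n) (Eop_linear xi a m) (Hz_linear b) (Hz_linear a).
Qed.

Lemma HHEE_small N a b p f : dbound N f -> p.2 + N%:Z <= 0 -> HHEE a b p f = 0.
Proof.
case: p => [p1 p2] /= bf le; rewrite (HHEE_sum _ _ _ bf) /= big1 // => m _; rewrite big1 // => n _.
rewrite {2}/Hz ifF ?Hz0 //; have := ltn_ord n.
by move: le; lia.
Qed.

(** Moving E_-(a, z) past H_+(b, w) produces the binomial series. The bound on [K]
    is where the sum over k stops: beyond it the exponent of w is too small. *)
Lemma HE_HE N K a b i j f : dbound N f -> (`|j| + N <= K)%N ->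
  HE a i (HE b j f) = \sum_(k < K) ((-1) ^+ k * gbinom C (iform xi a b) k) *:
     HHEE a b (i + k%:Z, j - k%:Z) f.
Proof.
move=> bf leK.
(* [B] bounds the degree of [HE b j f], and k + m for k < K and m < N. *)
pose B := (N + K + N)%N.
have bg : dbound B (HE b j f).
  rewrite (HE_sum _ _ bf); apply: dbound_sum => n _.
  have bE := dbound_Eop xi b n bf; have bH := dbound_Hz (k := j + n%:Z) b bE.
  apply: (dboundW _ bH).
  by have := ltn_ord n; rewrite /B; lia.
pose h n k m := ((-1) ^+ k * gbinom C (iform xi a b) k) *:
  Hz a (i + k%:Z + m%:Z) (Hz b (j - k%:Z + n%:Z) (Eop xi a m (Eop xi b n f))).
transitivity (\sum_(n < N) \sum_(m < B) \sum_(k < m.+1) h n k (m - k)%N).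
  rewrite (HE_sum _ _ bg) exchange_big /=; apply: eq_bigr => m _.
  rewrite (HE_sum _ _ bf) (linsum (Eop_linear xi a m)) (linsum (Hz_linear a _)).
  apply: eq_bigr => n _; rewrite Eop_Hz (linsum (Hz_linear a _)).
  apply: eq_bigr => -[k lek] _ /=; rewrite (linZ (Hz_linear a _)); congr (_ *: Hz a _ (Hz b _ _)).
    by move: lek; lia.
  by rewrite addrAC.
transitivity (\sum_(n < N) \sum_(k < K) \sum_(m < N) h n k m).
  apply: eq_bigr => n _; apply: sum_triangle.
  - by rewrite /B -addnA leq_addl.
  - move=> k m le; rewrite /h {2}/Hz ifF ?Hz0 ?scaler0 //.
    by have := ltn_ord n; move: leK le; lia.
  - move=> k m le; rewrite /h (Eop_dbound _ _ (dbound_Eop _ _ _ bf) le) !Hz0.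
    by rewrite scaler0.
rewrite exchange_big /=; apply: eq_bigr => k _.
rewrite (HHEE_sum _ _ _ bf) exchange_big /= scaler_sumr; apply: eq_bigr => m _.
by rewrite scaler_sumr.
Qed.

End VertexAlgebra.

(** * Vertex operators on Fock space *)

Section FockSpace.
Variables (gT : finGroupType) (C : numClosedFieldType).
Local Notation V := (RGam C gT).
Local Notation F := (Fock C gT).
Local Notation RZ := (RZ C gT).

Lemma Fock_eq (u v : F) : (forall c, u c = v c) -> u = v.
Proof. by move=> e; apply/val_inj/funext. Qed.

Lemma Fock_sum (I : Type) (r : seq I) (P : pred I) (G : I -> F) c :
  (\sum_(i <- r | P i) G i : F) c = \sum_(i <- r | P i) G i c.
Proof. by elim/big_rec2: _ => // i y1 y2 _ <-. Qed.

Lemma lift_op_linear (A : {linear V -> V}) : linear (lift_op A).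
Proof. by move=> k u v; apply: Fock_eq => c /=; rewrite !fctE linearP. Qed.

Lemma Fock_support (u : F) : exists r : seq RZ, forall c, u c != 0 -> c \in r.
Proof.
have /asboolP/finite_seqP[r e] := fk_funP u; exists r => c ne.
by have : [set b | u b != 0]%classic c by []; rewrite e.
Qed.

Lemma Fock_max (u : F) (g : RZ -> nat) : exists N, forall c, u c != 0 -> (g c <= N)%N.
Proof.
have [r hr] := Fock_support u; exists (\max_(c <- r) g c)%N => c /hr cr.
exact: leq_bigmax_seq.
Qed.

Lemma Fock_dbound (u : F) : exists N, forall c, dbound N (u c).
Proof.
have [N hN] := Fock_max u (fun c => projT1 (cid (dbound_ex (u c)))).
exists N => c; have [->|ne] := eqVneq (u c) 0; first by [].
exact: dboundW (hN c ne) (projT2 (cid (dbound_ex (u c)))).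
Qed.

(** The series [X] acts on families indexed by the lattice by operators [x p c] on
    the components, after a translation of the index by [d]. *)
Definition local (I : zmodType) (X : opser I F) (d : RZ) (x : I -> RZ -> V -> V) :=
  (forall p c, x p c 0 = 0) /\ (forall p u c, X p u c = x p c (u (c - d))).

Lemma local0 (I : zmodType) (X : opser I F) d x p : local X d x -> X p 0 = 0.
Proof. by move=> [x0 hX]; apply: Fock_eq => c; rewrite hX; exact: x0. Qed.

Lemma ser_mul_const (I : zmodType) (X : opser I F) d x B p u : local X d x ->
  ser_mul X (ser_const B) p u = X p (B u).
Proof.
move=> lX; rewrite /ser_mul (fsumE (r := [:: p])) //.
  by rewrite big_seq1 /ser_const subrr eqxx.
move=> q; rewrite inE => ne; rewrite /ser_const subr_eq0 eq_sym (negbTE ne).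
exact: local0 lX.
Qed.

(** Multiplication by z^(partial), where [zeta] gives the exponent. *)
Lemma ser_mul_grade (I : zmodType) (X Z : opser I F) d x (zeta : RZ -> I) : local X d x ->
  (forall p u b, Z p u b = if zeta b == p then u b else 0) ->
  local (ser_mul X Z) d (fun p c => x (p - zeta (c - d)) c).
Proof.
move=> lX hZ; have [x0 hX] := lX; split=> [p c|p u c]; first exact: x0.
have [r hr] := Fock_support u.
rewrite /ser_mul (fsumE (r := undup [seq p - zeta b | b <- r])) ?undup_uniq //; last first.
  move=> q; rewrite mem_undup => nq.
  rewrite [Z _ _](_ : _ = 0); first exact: local0 lX.
  apply: Fock_eq => b; rewrite hZ; case: eqP => // e.
  have [//|ub] := eqVneq (u b) 0; case/negP: nq; apply/mapP; exists b; first exact: hr.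
  by rewrite e opprB addrCA subrr addr0.
rewrite Fock_sum; under eq_bigr => q _ do rewrite hX hZ.
have [e0|ne] := eqVneq (u (c - d)) 0.
  by rewrite e0 x0 big1 // => q _; rewrite if_same x0.
rewrite (bigD1_seq (p - zeta (c - d))) ?undup_uniq //=; last first.
  by rewrite mem_undup; apply/mapP; exists (c - d); rewrite ?hr.
rewrite opprB addrCA subrr addr0 eqxx big1 ?addr0 // => q nq.
rewrite ifN ?x0 //; apply: contraNneq nq => ->.
by rewrite opprB addrCA subrr addr0.
Qed.

Section Vertex.
Variables (xi : RZ) (epsilon : RZ -> RZ -> C).

Lemma local_HE a : local (ser_mul (H_plus a) (E_minus xi a)) 0 (fun p _ => HE xi a p).
Proof.
split=> [p c|p u c]; first exact: (lin0 (HE_linear xi a p)).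
have Hc q (v : F) b : H_plus a q v b = Hz a q (v b) by rewrite /H_plus /Hz; case: ifP.
have [N hN] := Fock_dbound u; rewrite subr0 (HE_sum _ _ _ (hN c)).
rewrite /ser_mul (fsumE (r := [seq p + n%:Z | n <- index_iota 0 N])).
- rewrite big_map big_mkord Fock_sum; apply: eq_bigr => n _.
  rewrite Hc; congr (Hz a _ _); rewrite /E_minus.
  have -> : p - (p + n%:Z) <= 0 by lia.
  by have -> : `|(p - (p + n%:Z))%R|%N = n by lia.
- by rewrite map_inj_uniq ?iota_uniq // => m n /addrI [].
move=> q nq; rewrite [E_minus _ _ _ _](_ : _ = 0).
  by apply: Fock_eq => b; rewrite Hc Hz0.
rewrite /E_minus; case: ifP => // le; apply: Fock_eq => b.
rewrite -[LHS]/(Eop xi a `|(p - q)%R|%N (u b)); apply: Eop_dbound (hN b) _.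
rewrite leqNgt; apply: contra nq => lt; apply/mapP; exists `|(p - q)%R|%N.
  by rewrite mem_index_iota.
by move: le; lia.
Qed.

Lemma local_vertex a : local (vertex xi epsilon a) a
  (fun k c f => HE xi a (k - iform xi a (c - a)) (epsilon a (c - a) *: f)).
Proof.
apply: (ser_mul_grade (x := fun p c f => HE xi a p (epsilon a (c - a) *: f))) => //.
split=> [p c|p u c]; first by rewrite scaler0; apply: (lin0 (HE_linear xi a p)).
by rewrite (ser_mul_const _ _ _ (local_HE a)) (proj2 (local_HE a)) subr0.
Qed.

Lemma sigmaT0 (a : gT -> C) t : tag t = 0%N -> sigmaT a t = 0.
Proof. by case: t => n x /= e; subst n; rewrite /sigmaT /=; case: sigmaP => // -[]. Qed.

Lemma Aneg0 a (f : V) : Aneg a 0 f = 0.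
Proof.
apply: RGam_eq => t; rewrite AnegE convE big1 // => A sA.
by rewrite /cut; case: eqP => [/sigmaT0 ->|_]; rewrite mul0r.
Qed.

Lemma Apos0 a (f : V) : Apos xi a 0 f = 0.
Proof.
apply: RGam_eq => t; rewrite AposE /ann avg0 // => s s0.
by rewrite sigmaT0 // mulr0 mul0r.
Qed.

(** H_+(a, z) H_+(b, w) as an exponential. *)
Lemma exp_neg (a b : RZ) p u :
  ser_exp (ser_add (in_z (heis_neg a)) (in_w (heis_neg b))) p u =
  exp_val 1 (H_op a) (H_op b) p u.
Proof.
have recP (a' : RZ) n (v : F) :
    n%:R *: H_op a' n v = 1%:~R *: \sum_(k < n.+1) a_neg (vchar a') k (H_op a' (n - k) v).
  apply: Fock_eq => c; rewrite scale1r Fock_sum.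
  exact: Hop_rec.
rewrite -(@ser_exp_pair _ _ 1 (or_introl erefl) (a_neg (vchar a)) (a_neg (vchar b))) //.
- congr (ser_exp _ p u); apply/funext => q; apply/funext => v.
  by rewrite /ser_add /exp_arg scale1r /in_z /in_w /heis_neg !mul1r.
- by move=> n; apply: lift_op_linear.
- by move=> n; apply: lift_op_linear.
- by move=> n; apply: lift_op_linear.
- by move=> v; apply: Fock_eq => c; apply: Aneg0.
- by move=> v; apply: Fock_eq => c; apply: Aneg0.
- by move=> v; apply: Fock_eq => c; apply: Hop0.
- by move=> v; apply: Fock_eq => c; apply: Hop0.
- by move=> m n v; apply: Fock_eq => c; apply: AnegC.
- by move=> m n v; apply: Fock_eq => c; apply: AnegC.
- by move=> m n v; apply: Fock_eq => c; apply: AnegC.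
- by move=> m n v; apply: Fock_eq => c; apply: Aneg_HopC.
Qed.

(** [Eop] on Fock space. *)
Definition Esgn_op (a : RZ) n (u : F) : F := (-1) ^+ n *: E_op xi a n u.

(** E_-(a, z) E_-(b, w) as an exponential. *)
Lemma exp_pos (a b : RZ) p u :
  ser_exp (ser_opp (ser_add (in_z (heis_pos xi a)) (in_w (heis_pos xi b)))) p u =
  exp_val (-1) (Esgn_op a) (Esgn_op b) p u.
Proof.
have recP (a' : RZ) n (v : F) : n%:R *: Esgn_op a' n v =
    (-1)%:~R *: \sum_(k < n.+1) a_pos xi (vchar a') k (Esgn_op a' (n - k) v).
  apply: Fock_eq => c; rewrite scaleN1r -sumrN Fock_sum.
  by rewrite -[LHS]/(n%:R *: Eop xi a' n (v c)) Eop_rec -sumrN.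
have EC (a' b' : RZ) m n (f : V) : Eop xi a' m (Apos xi b' n f) = Apos xi b' n (Eop xi a' m f).
  by rewrite Apos_EopC.
rewrite -(@ser_exp_pair _ _ (-1) (or_intror erefl) (a_pos xi (vchar a)) (a_pos xi (vchar b))) //.
- congr (ser_exp _ p u); apply/funext => q; apply/funext => v.
  by rewrite /ser_opp /ser_add /exp_arg scaleN1r /in_z /in_w /heis_pos !mulN1r !oppr_gt0.
- by move=> n; apply: lift_op_linear.
- by move=> n; apply: lift_op_linear.
- by move=> n; apply/linear_scale/lift_op_linear.
- by move=> v; apply: Fock_eq => c; apply: Apos0.
- by move=> v; apply: Fock_eq => c; apply: Apos0.
- by move=> v; apply: Fock_eq => c; apply: Eop0.
- by move=> v; apply: Fock_eq => c; apply: Eop0.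
- by move=> m n v; apply: Fock_eq => c; apply: Apos_C.
- by move=> m n v; apply: Fock_eq => c; apply: Apos_C.
- by move=> m n v; apply: Fock_eq => c; apply: Apos_C.
- by move=> m n v; apply: Fock_eq => c; apply: Apos_EopC.
Qed.

Lemma local_HHEE a b :
  local (ser_mul (ser_exp (ser_add (in_z (heis_neg a)) (in_w (heis_neg b))))
           (ser_exp (ser_opp (ser_add (in_z (heis_pos xi a)) (in_w (heis_pos xi b))))))
    0 (fun p _ => HHEE xi a b p).
Proof.
split=> [p c|p u c]; first exact: (lin0 (HHEE_linear xi a b p)).
have Hc q (v : F) d : ser_exp (ser_add (in_z (heis_neg a)) (in_w (heis_neg b))) q v d =
    Hz a q.1 (Hz b q.2 (v d)).
  rewrite exp_neg /exp_val /sector !mul1r /Hz; case: ifP => [/andP[-> ->] //|].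
  by case: (0 <= q.1) => //= ->; rewrite (lin0 (Hop_linear a _)).
have Ec (m n : nat) (v : F) d :
    ser_exp (ser_opp (ser_add (in_z (heis_pos xi a)) (in_w (heis_pos xi b)))) (- m%:Z, - n%:Z) v d =
    Eop xi a m (Eop xi b n (v d)).
  have sE : sector (-1) (- m%:Z, - n%:Z) by rewrite /sector /=; lia.
  by rewrite exp_pos /exp_val sE /= !abszN.
have [N hN] := Fock_dbound u; rewrite subr0 (HHEE_seq _ _ _ _ (hN c)).
rewrite /ser_mul (fsumE (r := [seq (p.1 + m%:Z, p.2 + n%:Z) | m <- iota 0 N, n <- iota 0 N])).
- rewrite big_allpairs_dep Fock_sum; apply: eq_bigr => m _.
  rewrite Fock_sum; apply: eq_bigr => n _; rewrite Hc /=.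
  have -> : p - (p.1 + m%:Z, p.2 + n%:Z) = (- m%:Z, - n%:Z).
    by case: p => p1 p2; congr (_, _); rewrite /= opprD addrA subrr sub0r.
  by rewrite Ec.
- apply: allpairs_uniq; rewrite ?iota_uniq // => -[m n] [m' n'] _ _ /= [].
  by move=> e1 e2; congr (_, _); lia.
move=> q nq; set w := ser_exp _ (p - q) u.
rewrite (_ : w = 0).
  by apply: Fock_eq => d; rewrite Hc !Hz0.
rewrite /w exp_pos /exp_val; case: ifP => // sq; apply: Fock_eq => d.
pose m := `|((p - q).1)%R|%N; pose n := `|((p - q).2)%R|%N.
rewrite -[LHS]/(Eop xi a m (Eop xi b n (u d))).
have [/(Eop_dbound xi b (hN d)) ->|ltn] := leqP N n.
  by rewrite (lin0 (Eop_linear xi a m)).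
have [leN|ltm] := leqP N m.
  by rewrite (Eop_dbound _ _ (dbound_Eop _ _ _ (hN d)) leN).
case/negP: nq; apply/allpairsP; exists (m, n); rewrite !mem_iota /=.
split=> //; move: sq; rewrite /m /n /sector; case: (p) (q) => [p1 p2] [q1 q2] /=.
by move=> sq; congr (_, _); lia.
Qed.

Lemma local_normal_ordered a b : local (normal_ordered xi epsilon a b) (a + b)
  (fun p c f => HHEE xi a b
     (p.1 - iform xi a (c - (a + b)), p.2 - iform xi b (c - (a + b)))
     (epsilon (a + b) (c - (a + b)) *: f)).
Proof.
pose X1 := ser_mul (ser_exp (ser_add (in_z (heis_neg a)) (in_w (heis_neg b))))
           (ser_exp (ser_opp (ser_add (in_z (heis_pos xi a)) (in_w (heis_pos xi b))))).
have l2 : local (ser_mul X1 (ser_const (e_op epsilon (a + b)))) (a + b)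
    (fun p c f => HHEE xi a b p (epsilon (a + b) (c - (a + b)) *: f)).
  split=> [p c|p u c]; first by rewrite scaler0; apply: (lin0 (HHEE_linear xi a b p)).
  by rewrite (ser_mul_const _ _ _ (local_HHEE a b)) (proj2 (local_HHEE a b)) subr0.
have hz p (u : F) c : in_z (z_op xi a) p u c = if (iform xi a c, 0) == p then u c else 0.
  case: p => p1 p2; rewrite /in_z /= -pair_eqE /pair_eq /= [0 == p2]eq_sym andbC.
  by case: (p2 == 0).
have hw p (u : F) c : in_w (z_op xi b) p u c = if (0, iform xi b c) == p then u c else 0.
  case: p => p1 p2; rewrite /in_w /= -pair_eqE /pair_eq /= [0 == p1]eq_sym.
  by case: (p1 == 0).
have [x0 hX] := ser_mul_grade (ser_mul_grade l2 hz) hw.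
split=> [p c|p u c]; first by rewrite scaler0; apply: (lin0 (HHEE_linear xi a b _)).
rewrite hX; congr (HHEE xi a b _ _); case: p => p1 p2.
by congr (_, _); rewrite /= ?subr0 // addr0.
Qed.

Hypothesis epsilon_cocycle : is_cocycle xi epsilon.

Lemma vertex_mul (a b : RZ) (p : int * int) (u : F) :
  ser_mul (in_z (vertex xi epsilon a)) (in_w (vertex xi epsilon b)) p u =
  epsilon a b *: ser_mul (normal_ordered xi epsilon a b)
     (ser_scal (zw_pow C (iform xi a b))) p u.
Proof.
have [_ _ eA _] := epsilon_cocycle.
have lva := local_vertex a; have lvb := local_vertex b; have lno := local_normal_ordered a b.
rewrite /ser_mul (fsumE (r := [:: (p.1, 0)])) //; last first.
  move=> q; rewrite inE => nq; rewrite /in_z; case: eqP => // q2; rewrite /in_w ifN.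
    exact: local0 lva.
  apply: contra nq; case: p q q2 => [p1 p2] [q1 q2] /= -> /=.
  by rewrite subr_eq0 => /eqP ->.
rewrite big_seq1 /in_z /in_w /= subrr eqxx subr0.
set c0 := iform xi a b.
have [N hN] := Fock_dbound u.
have [M hM] := Fock_max u (fun c => `|iform xi b c|%N).
(* [M] bounds the exponents of w contributed by the lattice, [N] the degrees that
   E_- can remove; from [K] on the terms of the binomial series vanish. *)
pose K := (`|p.2| + M + N)%N.
rewrite (fsumE (r := [seq (p.1 - c0 + k%:Z, p.2 - k%:Z) | k <- iota 0 K])); last 2 first.
- rewrite map_inj_uniq ?iota_uniq // => k l [].
  by move=> _ /addrI/oppr_inj [].
- move=> q nq; apply: Fock_eq => c; rewrite (proj2 lno) /ser_scal.
  set cc := c - (a + b).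
  rewrite -[(_ *: u) cc]/(zw_pow C c0 (p - q) *: u cc).
  have [->|ne] := eqVneq (u cc) 0.
    by rewrite !scaler0; apply: (lin0 (HHEE_linear xi a b _)).
  rewrite /zw_pow; case: ifP => [/andP[h1 h2]|_]; last first.
    by rewrite scale0r scaler0; apply: (lin0 (HHEE_linear xi a b _)).
  rewrite !(linZ (HHEE_linear xi a b _)) (HHEE_small _ _ _ (hN cc)) ?scaler0 //=.
  have := hM cc ne => hMc.
  rewrite leNgt; apply: contra nq => lt.
  apply/mapP; exists `|((p - q).2)%R|%N; move: h1 h2 lt; rewrite ?mem_iota /K;
    case: (p) (q) => [p1 p2] [q1 q2] /=; rewrite ?add0n.
    by move: hMc; lia.
  by move=> h1 /eqP h2 _; congr (_, _); lia.
apply: Fock_eq => c; rewrite (proj2 lva) (proj2 lvb).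
rewrite -[RHS]/(epsilon a b *: (\sum_(q <- _) _ : F) c) Fock_sum big_map.
have -> : c - a - b = c - (a + b) by rewrite opprD addrA.
set cc := c - (a + b).
have ca : c - a = b + cc by rewrite /cc opprD [RHS]addrC !addrA subrK.
have e_term k : normal_ordered xi epsilon a b (p.1 - c0 + k%:Z, p.2 - k%:Z)
      (ser_scal (zw_pow C c0) (p - (p.1 - c0 + k%:Z, p.2 - k%:Z)) u) c =
    (epsilon (a + b) cc * (gbinom C c0 k * (-1) ^+ k)) *:
      HHEE xi a b (p.1 - c0 - iform xi a cc + k%:Z, p.2 - iform xi b cc - k%:Z) (u cc).
  rewrite (proj2 lno) -/cc /ser_scal.
  rewrite -[(_ *: u) cc]/(zw_pow C c0 (p - (p.1 - c0 + k%:Z, p.2 - k%:Z)) *: u cc).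
  rewrite scalerA (linZ (HHEE_linear xi a b _)); congr (_ * _ *: HHEE xi a b _ _).
    have -> : p - (p.1 - c0 + k%:Z, p.2 - k%:Z) = (c0 - k%:Z, k%:Z).
      by case: (p) => p1 p2; congr (_, _) => /=; lia.
    by rewrite /zw_pow /= eqxx.
  by congr (_, _) => /=; rewrite addrAC.
under eq_bigr => k _ do rewrite e_term.
rewrite ca iformDr -/c0 opprD addrA.
have [->|ne] := eqVneq (u cc) 0.
  rewrite !(scaler0, lin0 (HE_linear xi b _), lin0 (HE_linear xi a _)).
  by rewrite big1 ?scaler0 // => k _; rewrite (lin0 (HHEE_linear xi a b _)) scaler0.
rewrite (linZ (HE_linear xi b _)) !(linZ (HE_linear xi a _)).
rewrite (@HE_HE _ _ xi N K) //; last first.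
  by have := hM cc ne; rewrite /K; lia.
have io : iota 0 K = index_iota 0 K by rewrite /index_iota subn0.
rewrite io big_mkord !scaler_sumr; apply: eq_bigr => k _.
rewrite !scalerA; congr (_ *: _); rewrite -/c0 -eA mulrA.
by congr (_ * _); exact: mulrC.
Qed.

End Vertex.
End FockSpace.

Theorem theorem7p1 (R : realType) (gT : finGroupType) (xi : RZ R[i] gT)
    (xi_self_dual : forall x : gT, vchar xi x = vchar xi (x^-1)%g)
    (epsilon : RZ R[i] gT -> RZ R[i] gT -> R[i])
    (epsilon_cocycle : is_cocycle xi epsilon)
    (alpha beta : RZ R[i] gT) (p : int * int) (u : Fock R[i] gT) :
  ser_mul (in_z (vertex xi epsilon alpha)) (in_w (vertex xi epsilon beta)) p u =
  epsilon alpha beta *: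
    ser_mul (normal_ordered xi epsilon alpha beta)
            (ser_scal (zw_pow R[i] (iform xi alpha beta))) p u.
Proof. exact: vertex_mul. Qed.
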